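(* Let nodal data $\rho_i^n\in\mathbb R$, $\boldsymbol m_i^n\in\mathbb R^3$, $E_i^n\in\mathbb R$ ($i\in\mathcal V$) and $\boldsymbol H_h^n\in\mathbb H_{h,0}$ be given, let $\boldsymbol v_i^n:=\boldsymbol m_i^n/\rho_i^n$, and assume that for all $i\in\mathcal V$ $$\rho_i^n>0,\qquad e_i^n:=\tfrac{E_i^n}{\rho_i^n}-\tfrac12|\boldsymbol v_i^n|^2>0,\qquad \theta_i^n:=\Big[\tfrac{\partial s}{\partial e}\big(\tfrac1{\rho_i^n},e_i^n\big)\Big]^{-1}>0 .$$ Let $\tau>0$ be the time-step size and let $(\rho_i^{n+1},\boldsymbol m_i^{n+1},E_i^{n+1})_{i\in\mathcal V}$, $\boldsymbol v_h^{n+1}\in\mathbb V_h^3$ and $\boldsymbol H_h^{n+1}\in\mathbb H_{h,0}$ be produced by the source-update scheme described in the context. Then the scheme satisfies the energy identity $$\begin{aligned} &\sum_{i\in\mathcal V}m_i\,\tfrac12\rho_i^n|\boldsymbol v_i^{n+1}|^2+\tfrac{\mu}{2}\|\boldsymbol H_h^{n+1}\|_{L^2(\Omega)}^2+\tau\,\big\|\sqrt{r_h^n}\,\mathrm{curl}\boldsymbol H_h^{n+\frac12}\big\|_{L^2(\Omega)}^2\\ &\qquad=\sum_{i\in\mathcal V}m_i\,\tfrac12\rho_i^n|\boldsymbol v_i^{n}|^2+\tfrac{\mu}{2}\|\boldsymbol H_h^{n}\|_{L^2(\Omega)}^2, \end{aligned}$$ and conservation of total energy $$\sum_{i\in\mathcal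 V}m_iE_i^{n+1}+\tfrac{\mu}{2}\|\boldsymbol H_h^{n+1}\|_{L^2(\Omega)}^2=\sum_{i\in\mathcal V}m_iE_i^{n}+\tfrac{\mu}{2}\|\boldsymbol H_h^{n}\|_{L^2(\Omega)}^2 .$$ Moreover, for every $i\in\mathcal V$, with $\boldsymbol u_i=[\rho_i,\boldsymbol m_i,E_i]^{\top}$, $$\rho_i^{n+1}=\rho_i^n,\quad e(\boldsymbol u_i^{n+1})\ge e(\boldsymbol u_i^n),\quad\theta(\boldsymbol u_i^{n+1})\ge\theta(\boldsymbol u_i^n),\quad s(\boldsymbol u_i^{n+1})\ge s(\boldsymbol u_i^n),\quad\eta(\boldsymbol u_i^{n+1})\le\eta(\boldsymbol u_i^n).$$ Finally, the following involution property is preserved: $$(\boldsymbol H_h^{n+1},\nabla\omega_h)_{L^2(\Omega)}=(\boldsymbol H_h^{n},\nabla\omega_h)_{L^2(\Omega)}\qquad\text{for all }\omega_h\in\mathbb P_{h,0}.$$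
   Context: Finite element spaces. $\Omega\subset\mathbb R^d$ ($d=2$ or $3$) is a bounded domain with outward unit normal $\boldsymbol n$ and a conforming simplicial mesh $\mathcal T_h$; $T_K:\widehat K\to K$ is a diffeomorphism from the unit simplex $\widehat K$ to $K\in\mathcal T_h$, and $\mathbb P^k(\widehat K)$ denotes polynomials of degree at most $k$. Define - $\mathbb V_h=\{v_h\in C^0(\Omega): v_h\circ T_K\in\mathbb P^1(\widehat K)\ \forall K\}$, with nodal basis $\{\phi_i\}_{i\in\mathcal V}$ ($\phi_i(\boldsymbol x_j)=\delta_{ij}$, $\sum_i\phi_i=1$), and lumped masses $m_i=\int_\Omega\phi_i\,d\boldsymbol x$; - $\mathbb H_h=\{\boldsymbol\xi_h\in H(\mathrm{curl},\Omega):[\nabla T_K]^{\top}(\boldsymbol\xi_h\circ T_K)\in[\mathbb P^1(\widehat K)]^d\ \forall K\}$ and $\mathbb H_{h,0}=\{\boldsymbol\xi_h\in\mathbb H_h:\boldsymbol\xi_h\times\boldsymbol n=\boldsymbol0\text{ on }\partial\Omega\}$; - $\mathbb P_h=\{\omega_h\in C^0(\Omega):\omega_h\circ T_K\in\mathbb P^2(\widehat K)\ \forall K\}$ and $\mathbb P_{h,0}=\{\omega_h\in\mathbb P_h:\omega_h=0\text{ on }\partial\Omega\}$. Convention for $d=2$: all vector fields have three components and are independent of the out-of-plane coordinate $z$ ($\partial_z\equiv 0$). The space $\mathbb H_h$ is replaced by fields whose in-plane part is in the two-dimensional space $\mathbb H_h$ above and whose $z$-component is in $\mathbb V_h$; $\mathbb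 H_{h,0}$ is its subspace with $\boldsymbol\xi_h\times\boldsymbol n=\boldsymbol0$ on $\partial\Omega$ where $\boldsymbol n=(n_x,n_y,0)$; $\mathrm{curl}\boldsymbol H=(\partial_yH_z,-\partial_xH_z,\partial_xH_y-\partial_yH_x)$; and $\nabla\omega=(\partial_x\omega,\partial_y\omega,0)$. Lumped product: $\langle\rho_h\boldsymbol v_h,\boldsymbol w_h\rangle=\sum_{i\in\mathcal V}m_i\rho_i\,\boldsymbol v_i\cdot\boldsymbol w_i$ for $\rho_h=\sum_i\rho_i\phi_i$, $\boldsymbol v_h=\sum_i\boldsymbol v_i\phi_i$, $\boldsymbol w_h=\sum_i\boldsymbol w_i\phi_i$. Source-update scheme. The constants $\mu>0$, $d_i>0$, $r>0$ are given, and $r_h^n\in\mathbb V_h$ is a given (explicit) function with $r_h^n\ge r$. Put $\rho_h^n=\sum_i\rho_i^n\phi_i$, $\boldsymbol v_h^n=\sum_i\boldsymbol v_i^n\phi_i$. Step 1: $\{\boldsymbol v_h^{n+1},\boldsymbol H_h^{n+1}\}\in\mathbb V_h^3\times\mathbb H_{h,0}$ solves, for all $\{\boldsymbol w_h,\boldsymbol\xi_h\}\in\mathbb V_h^3\times\mathbb H_{h,0}$, $$\begin{aligned} &\langle\rho_h^n(\boldsymbol v_h^{n+1}-\boldsymbol v_h^n),\boldsymbol w_h\rangle-\tau\mu(\mathrm{curl}\boldsymbol H_h^{n+\frac12}\times\boldsymbol H_h^{n+\frac12},\boldsymbol w_h)_{L^2(\Omega)}=0,\\ &\mu(\boldsymbol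 H_h^{n+1}-\boldsymbol H_h^n,\boldsymbol\xi_h)_{L^2(\Omega)}+\tau\mu(\mathrm{curl}\boldsymbol\xi_h\times\boldsymbol H_h^{n+\frac12},\boldsymbol v_h^{n+\frac12})_{L^2(\Omega)}+\tau(r_h^n\,\mathrm{curl}\boldsymbol H_h^{n+\frac12},\mathrm{curl}\boldsymbol\xi_h)_{L^2(\Omega)}\\ &\qquad+\tau\mu d_i\big(\tfrac1{\rho_h^n}\mathrm{curl}\boldsymbol H_h^{n+\frac12}\times\boldsymbol H_h^{n+\frac12},\mathrm{curl}\boldsymbol\xi_h\big)_{L^2(\Omega)}=0, \end{aligned}$$ where $\boldsymbol v_h^{n+\frac12}=\frac12(\boldsymbol v_h^n+\boldsymbol v_h^{n+1})$, $\boldsymbol H_h^{n+\frac12}=\frac12(\boldsymbol H_h^n+\boldsymbol H_h^{n+1})$ (a solution is assumed to be given). Step 2: for all $i\in\mathcal V$, $\rho_i^{n+1}:=\rho_i^n$, $\boldsymbol m_i^{n+1}:=\rho_i^n\boldsymbol v_i^{n+1}$, and $$E_i^{n+1}:=E_i^n+\frac12\frac{|\boldsymbol m_i^{n+1}|^2}{\rho_i^n}-\frac12\frac{|\boldsymbol m_i^n|^2}{\rho_i^n}+\tau J_i^{n+\frac12},\qquad J_i^{n+\frac12}:=\frac1{m_i}\int_\Omega r_h^n|\mathrm{curl}\boldsymbol H_h^{n+\frac12}|^2\phi_i\,d\boldsymbol x .$$ Equation of state. The specific entropy $s=s(\mathsf v,e)$ is a given twice continuously differentiable function of specific volume $\mathsf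 v=1/\rho$ and specific internal energy $e$, on a convex domain contained in $\mathbb R^+\times\mathbb R^+$; all thermodynamic states occurring are in this domain. For $\boldsymbol u=[\rho,\boldsymbol m,E]^{\top}$: $e(\boldsymbol u)=\frac E\rho-\frac{|\boldsymbol m|^2}{2\rho^2}$, $s(\boldsymbol u)=s(\frac1\rho,e(\boldsymbol u))$, $\theta(\boldsymbol u)=[\frac{\partial s}{\partial e}(\frac1\rho,e(\boldsymbol u))]^{-1}$, $\eta(\boldsymbol u)=-\rho\,s(\boldsymbol u)$. Standing assumptions: $\partial s/\partial e=1/\theta>0$ on the domain of $s$, and $s$ is concave: $\frac{\partial^2s}{\partial \mathsf v^2}\le0$, $\frac{\partial^2s}{\partial e^2}\le0$, $\frac{\partial^2s}{\partial \mathsf v^2}\frac{\partial^2s}{\partial e^2}-\big(\frac{\partial^2s}{\partial \mathsf v\partial e}\big)^2\ge0$. *)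

(* Defs.v *)
From HB Require Import structures.
From mathcomp Require Import all_boot all_order all_algebra.
From mathcomp Require Import all_classical all_reals all_analysis.
Set Implicit Arguments.
Unset Strict Implicit.
Unset Printing Implicit Defensive.
Import Order.TTheory GRing.Theory Num.Theory numFieldNormedType.Exports.
Local Open Scope classical_set_scope.
Local Open Scope ring_scope.

(* Borel sigma-algebra and Lebesgue measure on R^n, seen as row vectors; the
   measure is the n-fold product of [lebesgue_measure]. *)
Section rV_measurable.
Context (R : realType) (n : nat).
Let coords (i : 'I_n) (v : 'rV[R]_n) : R := v ord0 i.
Let rV0 : g_sigma_preimage coords set0.
Proof. exact: sigma_algebra0. Qed.
Let rVC A : g_sigma_preimage coords A -> g_sigma_preimage coords (~` A).
Proof. exact: sigma_algebraC. Qed.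
Let rVU (F : _^nat) : (forall i, g_sigma_preimage coords (F i)) ->
  g_sigma_preimage coords (\bigcup_i (F i)).
Proof. exact: sigma_algebra_bigcup. Qed.
HB.instance Definition _ :=
  @isMeasurable.Build (measure_tuple_display default_measure_display)
    'rV[R]_n (g_sigma_preimage coords) rV0 rVC rVU.
End rV_measurable.

Lemma measurable_coord (R : realType) n (i : 'I_n) :
  measurable_fun [set: 'rV[R]_n] (fun v : 'rV[R]_n => v ord0 i).
Proof.
move=> _ Y mY; rewrite setTI; apply: sub_sigma_algebra => /=.
rewrite -bigcup_seq/=; exists i => /=; first by rewrite mem_index_enum.
by exists Y => //; rewrite setTI.
Qed.

Lemma measurable_fun_rV d (T : measurableType d) (R : realType) n
    (f : T -> 'rV[R]_n) :
  (forall i, measurable_fun setT (fun x => f x ord0 i)) ->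
  measurable_fun setT f.
Proof.
move=> mf _ A mA; rewrite setTI.
suff : g_sigma_preimage (fun i x => f x ord0 i) `<=` @measurable _ T.
  apply; pose g i (v : 'rV[R]_n) := v ord0 i.
  have -> : (fun i x => f x ord0 i) = (fun i => g i \o f) by [].
  by rewrite (@g_sigma_preimage_comp _ _ _ _ g); exists A => //; rewrite setTI.
apply: smallest_sub; first exact: sigma_algebra_measurable.
move=> B; rewrite -bigcup_seq => -[i _ [C mC <-]].
exact: mf.
Qed.

Section lebesgue_rV_construction.
Context {R : realType}.

Definition consv n (p : measurableTypeR R * 'rV[R]_n) : 'rV[R]_n.+1 := row_mx p.1%:M p.2.



Lemma consv_head n (p : measurableTypeR R * 'rV[R]_n) : consv p ord0 ord0 = p.1.
Proof.
transitivity ((row_mx p.1%:M p.2) ord0 (@lshift 1 n ord0)).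
  by congr (_ _ _); exact/val_inj.
by rewrite row_mxEl mxE.
Qed.

Lemma consv_tail n (p : measurableTypeR R * 'rV[R]_n) j : consv p ord0 (lift ord0 j) = p.2 ord0 j.
Proof.
transitivity ((row_mx p.1%:M p.2) ord0 (@rshift 1 n j)).
  by congr (_ _ _); exact/val_inj.
by rewrite row_mxEr.
Qed.

Lemma measurable_consv n : measurable_fun setT (@consv n).
Proof.
apply: measurable_fun_rV => i.
case: (unliftP ord0 i) => [j|] ->.
  under eq_fun do rewrite consv_tail.
  apply: (measurableT_comp (@measurable_coord R n j) measurable_snd).
under eq_fun do rewrite consv_head.
exact: measurable_fst.
Qed.

Definition unconsv n (v : 'rV[R]_n.+1) : measurableTypeR R * 'rV[R]_n :=
  (v ord0 ord0, \row_j v ord0 (lift ord0 j)).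

Lemma measurable_unconsv n : measurable_fun setT (@unconsv n).
Proof.
apply: measurable_fun_pair; first exact: measurable_coord.
apply: measurable_fun_rV => i.
under eq_fun do rewrite mxE.
exact: measurable_coord.
Qed.

Lemma unconsvK n : cancel (@unconsv n) (@consv n).
Proof.
move=> v; apply/rowP => i.
by case: (unliftP ord0 i) => [j|] ->; rewrite ?consv_tail ?consv_head ?mxE.
Qed.

Lemma consvK n : cancel (@consv n) (@unconsv n).
Proof.
move=> [x v]; rewrite /unconsv consv_head; congr (_, _).
by apply/rowP => j; rewrite mxE consv_tail.
Qed.

Section step.
Variables (n : nat) (mu : {sigma_finite_measure set 'rV[R]_n -> \bar R}).

Definition lebesgue_step : set 'rV[R]_n.+1 -> \bar R :=
  pushforward (lebesgue_measure \x mu)%E (@consv n).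

Let step0 : lebesgue_step set0 = 0%E.
Proof. by rewrite /lebesgue_step /pushforward preimage_set0 measure0. Qed.

Let step_ge0 A : (0 <= lebesgue_step A)%E.
Proof. by rewrite /lebesgue_step /pushforward; exact: (measure_ge0 (lebesgue_measure \x mu)%E). Qed.

Let step_sigma_additive : semi_sigma_additive lebesgue_step.
Proof.
move=> F mF tF mUF; rewrite /lebesgue_step /pushforward preimage_bigcup.
have mp A : measurable A -> measurable (@consv n @^-1` A).
  by move=> mA; rewrite -[X in measurable X]setTI; exact: measurable_consv.
apply: measure_semi_sigma_additive.
- by move=> i; exact: mp.
- apply/trivIsetP => /= i j _ _ ij; rewrite -preimage_setI.
  by move/trivIsetP : tF => /(_ _ _ _ _ ij) ->//; rewrite preimage_set0.
- by rewrite -preimage_bigcup; exact: mp.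
Qed.

HB.instance Definition _ :=
  isMeasure.Build _ _ _ lebesgue_step step0 step_ge0 step_sigma_additive.

Let step_sigma_finite : sigma_finite setT lebesgue_step.
Proof.
have /sigma_finiteP[F [TF ndF Foo]] := sigma_finiteT (@lebesgue_measure R).
have /sigma_finiteP[G [TG ndG Goo]] := sigma_finiteT mu.
exists (fun i => @unconsv n @^-1` (F i `*` G i)).
  rewrite -preimage_bigcup (_ : \bigcup_i _ = setT) ?preimage_setT//.
  apply/seteqP; split => // -[x y] _.
  have [i _ Fix] : (\bigcup_i F i) x by rewrite -TF.
  have [k _ Gky] : (\bigcup_i G i) y by rewrite -TG.
  exists (maxn i k) => //; split => /=.
    by move: x Fix; exact/subsetPset/ndF/leq_maxl.
  by move: y Gky; exact/subsetPset/ndG/leq_maxr.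
move=> i; have [mF Fi] := Foo i; have [mG Gi] := Goo i; split.
  rewrite -[X in measurable X]setTI; apply: measurable_unconsv => //.
  exact: measurableX.
rewrite /lebesgue_step /pushforward.
rewrite (_ : @consv n @^-1` _ = F i `*` G i); last first.
  by apply/seteqP; split => x; rewrite /preimage /mkset consvK.
by rewrite product_measure1E// lte_mul_pinfty// ge0_fin_numE.
Qed.

HB.instance Definition _ :=
  Measure_isSigmaFinite.Build _ _ _ lebesgue_step step_sigma_finite.
End step.

Fixpoint lebesgue_rV n : {sigma_finite_measure set 'rV[R]_n -> \bar R} :=
  if n is m.+1 then lebesgue_step (lebesgue_rV m) else \d_(0 : 'rV[R]_0).

End lebesgue_rV_construction.

Section vectors.
Context {R : realType}.

(* The norm [`|u|] of the library on row vectors is the max norm; Euclidean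
   lengths are written with [dot]. *)
Definition dot n (u v : 'rV[R]_n) : R := \sum_i u ord0 i * v ord0 i.

Definition vec3 (a b c : R) : 'rV[R]_3 := \row_i [:: a; b; c]`_i.

Definition cross (u v : 'rV[R]_3) : 'rV[R]_3 :=
  vec3 (u 0 1 * v 0 2%R - u 0 2%R * v 0 1)
       (u 0 2%R * v 0 0 - u 0 0 * v 0 2%R)
       (u 0 0 * v 0 1 - u 0 1 * v 0 0).

(* R^d sits in R^3 as the first d coordinates ([d <= 3]). *)
Definition lift3 d (u : 'rV[R]_d) : 'rV[R]_3 := u *m pid_mx d.
Definition inplane d (u : 'rV[R]_3) : 'rV[R]_d := u *m pid_mx d.

End vectors.

Section calculus.
Context {R : realType}.

Fixpoint Ck (V : normedModType R) (k : nat) (D : set V) (f : V -> R) : Prop :=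
  (forall x, D x -> {for x, continuous f}) /\
  if k is k'.+1 then
    forall v, (forall x, D x -> derivable f x v) /\ Ck k' D ('D_v f)
  else True.

Context {d : nat}.
Local Notation pt := 'rV[R]_d.
Local Notation field := (pt -> 'rV[R]_3).

(* The k-th partial derivative in R^3 of a function on R^d. For [d <= k] the
   direction is the zero vector, so the derivative is 0: functions on R^2 are
   functions on R^3 which do not depend on z. *)
Definition partial (k : 'I_3) (f : pt -> R) : pt -> R :=
  'D_(\row_(j < d) (j == k :> nat)%:R) f.

Definition grad (w : pt -> R) : field := fun x => \row_k partial k w x.

Definition curl (f : field) : field := fun x =>
  let D k j := partial k (fun y => f y 0 j) x in
  vec3 (D 1 2%R - D 2%R 1) (D 2%R 0 - D 0 2%R) (D 0 1 - D 1 0).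

Definition integ (Omega : set pt) (f : pt -> R) : R :=
  (\int[lebesgue_rV d]_(x in Omega) f x)%R.

Definition ipL2 (Omega : set pt) (f g : field) : R :=
  integ Omega (fun x => dot (f x) (g x)).

Definition normL2 (Omega : set pt) (f : field) : R :=
  Num.sqrt (ipL2 Omega f f).

Definition inL2 (Omega : set pt) (f : field) : Prop :=
  measurable_fun Omega f /\
  (lebesgue_rV d).-integrable Omega (fun x => (dot (f x) (f x))%:E).

Definition test_field (Omega : set pt) (psi : field) : Prop :=
  (forall j k, Ck k setT (fun x => psi x 0 j)) /\
  exists2 C : set pt, compact C /\ C `<=` Omega &
    forall x, ~ C x -> psi x = 0.

(* [c] represents the distributional curl of [f]; both are in L^2. *)
Definition is_curl (Omega : set pt) (f c : field) : Prop :=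
  [/\ inL2 Omega f, inL2 Omega c &
      forall psi, test_field Omega psi ->
        ipL2 Omega c psi = ipL2 Omega f (curl psi)].

Definition Hcurl (Omega : set pt) (f : field) : Prop :=
  exists c, is_curl Omega f c.

(* [n] is the outward unit normal of [Omega] at the boundary point [x]: near
   [x], up to o(|y - x|), the set [Omega] is the half-space below [x]. Points
   of the boundary where there is no such vector (edges, corners) have no
   normal. *)
Definition outward_normal (Omega : set pt) (x n : pt) : Prop :=
  [/\ closure Omega x, ~ Omega x, dot n n = 1 &
      forall e : R, 0 < e -> \forall y \near x,
        (dot n (y - x) < - (e * `|y - x|) -> Omega y) /\
        (e * `|y - x| < dot n (y - x) -> ~ Omega y)].

Definition C1 (U : set pt) (F : pt -> pt) : Prop :=
  forall x, U x -> differentiable F x /\ {for x, continuous (fun y => 'J F y)}.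

(* A diffeomorphism of the closed set [A] onto its image: it extends to a
   diffeomorphism between open neighbourhoods. *)
Definition diffeo_on (A : set pt) (F : pt -> pt) : Prop :=
  exists U V : set pt, exists G : pt -> pt,
    [/\ open U /\ open V, A `<=` U, F @` U = V,
        forall x, U x -> G (F x) = x & C1 U F /\ C1 V G].

Definition polynomial_le (k : nat) (f : pt -> R) : Prop :=
  exists c : {ffun 'I_d -> 'I_k.+1} -> R, forall x,
    f x = \sum_(a : {ffun 'I_d -> 'I_k.+1} | (\sum_i a i <= k)%N)
            c a * \prod_i x ord0 i ^+ a i.

End calculus.

Section finite_elements.
Context {R : realType} {d : nat}.
Local Notation pt := 'rV[R]_d.
Local Notation field := (pt -> 'rV[R]_3).

Definition bary (a : 'I_d.+1) (x : pt) : R :=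
  if unlift ord0 a is Some i then x ord0 i else 1 - \sum_i x ord0 i.

Definition ref_simplex : set pt := [set x | forall a, 0 <= bary a x].
Definition ref_interior : set pt := [set x | forall a, 0 < bary a x].
Definition ref_vertex (a : 'I_d.+1) : pt := \row_i (a == lift ord0 i)%:R.

(* The face spanned by the vertices in [F]. *)
Definition ref_face (F : {set 'I_d.+1}) : set pt :=
  [set x | ref_simplex x /\ forall a, a \notin F -> bary a x = 0].

Definition domain (Omega : set pt) : Prop :=
  [/\ Omega !=set0, open Omega, connected Omega & bounded_set Omega].

Record conforming_mesh (Omega : set pt) (E : finType) (T : E -> pt -> pt) :
    Prop := {
  mesh_diffeo : forall k, diffeo_on ref_simplex (T k);
  mesh_cover : closure Omega = \bigcup_k (T k @` ref_simplex);
  mesh_conforming : forall k l, k != l -> exists F G : {set 'I_d.+1},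
    [/\ F != [set: 'I_d.+1]%SET, G != [set: 'I_d.+1]%SET,
        (T k @` ref_simplex) `&` (T l @` ref_simplex) = T k @` ref_face F &
        (T k @` ref_simplex) `&` (T l @` ref_simplex) = T l @` ref_face G] }.

Section spaces.
Context (Omega : set pt) (E : finType) (T : E -> pt -> pt).

Definition lagrange (k : nat) (f : pt -> R) : Prop :=
  {within closure Omega, continuous f} /\
  forall K, exists2 p, polynomial_le k p &
    forall x, ref_simplex x -> f (T K x) = p x.

Definition Vh : (pt -> R) -> Prop := lagrange 1.
Definition Vh3 (w : field) : Prop := forall j, Vh (fun x => w x 0 j).

Definition Ph : (pt -> R) -> Prop := lagrange 2.
Definition Ph0 (w : pt -> R) : Prop :=
  Ph w /\ forall x, closure Omega x -> ~ Omega x -> w x = 0.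

(* The row convention makes ['J F x] the transpose of the usual Jacobian
   matrix, hence row vector times [('J F x)^T] below is [DF(x)]^T times column
   vector. Fields in H(curl) are only defined up to null sets, so that the
   polynomial condition bears on the open elements. For [d = 3] the last
   condition is void and [lift3 (inplane u) = u]. *)
Definition Hh (xi : field) : Prop :=
  [/\ Hcurl Omega (fun x => lift3 (inplane d (xi x))),
      forall K, exists2 p : pt -> pt,
        forall j, polynomial_le 1 (fun x => p x ord0 j) &
        forall x, ref_interior x ->
          inplane d (xi (T K x)) *m ('J (T K) x)^T = p x &
      forall j : 'I_3, (d <= j)%N -> Vh (fun x => xi x 0 j)].

(* [xi x n = 0] on the boundary, where [xi] is the trace from the element [K]
   at the points of a facet of [K] which lies on the boundary. *)
Definition zero_tangential_trace (xi : field) : Prop :=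
  forall K a x n l, (T K @` ref_face [set~ a]%SET) `&` Omega = set0 ->
    (T K @` ref_face [set~ a]%SET) x -> outward_normal Omega x n ->
    xi y @[y --> within (T K @` ref_interior) (nbhs x)] --> l ->
    cross l (lift3 n) = 0.

Definition Hh0 (xi : field) : Prop := Hh xi /\ zero_tangential_trace xi.

(* The gradient of a continuous, piecewise smooth function, computed element by
   element; the value 0 on the mesh skeleton (a null set) is immaterial. *)
Definition grad_h (w : pt -> R) : field :=
  grad w \_ (\bigcup_k (T k @` ref_interior)).

Record nodal_basis (V : finType) (x : V -> pt) (phi : V -> pt -> R) :
    Prop := {
  nodal_points : range x = [set T k (ref_vertex a) | k in setT & a in setT];
  nodal_in_Vh : forall i, Vh (phi i);
  nodal_kronecker : forall i j, phi i (x j) = (i == j)%:R;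
  nodal_sum1 : forall y, closure Omega y -> \sum_i phi i y = 1;
  nodal_span : forall v, Vh v ->
    forall y, closure Omega y -> v y = \sum_i v (x i) * phi i y }.

End spaces.
End finite_elements.

Section thermodynamics.
Context {R : realType}.

Record state := State { dens : R; mom : 'rV[R]_3; ener : R }.

Definition spec_volume (u : state) : R := 1 / dens u.
Definition spec_energy (u : state) : R :=
  ener u / dens u - dot (mom u) (mom u) / (2 * dens u ^+ 2).
Definition velocity (u : state) : 'rV[R]_3 := (dens u)^-1 *: mom u.

Definition d_v (s : R * R -> R) : R * R -> R := 'D_((1, 0) : R * R) s.
Definition d_e (s : R * R -> R) : R * R -> R := 'D_((0, 1) : R * R) s.

(* The arguments of [s] are (specific volume, specific internal energy). *)
Record entropy_law (D : set (R * R)) (s : R * R -> R) : Prop := {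
  eos_open : open D;
  eos_convex : forall p q t, D p -> D q -> 0 <= t <= 1 ->
    D (t * p.1 + (1 - t) * q.1, t * p.2 + (1 - t) * q.2);
  eos_pos : forall p, D p -> 0 < p.1 /\ 0 < p.2;
  eos_C2 : Ck 2 D s;
  eos_d_e_gt0 : forall p, D p -> 0 < d_e s p;
  eos_d_vv_le0 : forall p, D p -> d_v (d_v s) p <= 0;
  eos_d_ee_le0 : forall p, D p -> d_e (d_e s) p <= 0;
  eos_hess_ge0 : forall p, D p ->
    0 <= d_v (d_v s) p * d_e (d_e s) p - d_v (d_e s) p ^+ 2 }.

Definition entropy (s : R * R -> R) (u : state) : R :=
  s (spec_volume u, spec_energy u).
Definition temperature (s : R * R -> R) (u : state) : R :=
  (d_e s (spec_volume u, spec_energy u))^-1.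
Definition math_entropy (s : R * R -> R) (u : state) : R :=
  - dens u * entropy s u.

End thermodynamics.
Arguments state : clear implicits.

Section scheme.
Context {R : realType} {d : nat}.
Local Notation pt := 'rV[R]_d.
Local Notation field := (pt -> 'rV[R]_3).
Context (Omega : set pt) (E : finType) (T : E -> pt -> pt).
Context (V : finType) (x : V -> pt) (phi : V -> pt -> R).

Definition mass (i : V) : R := integ Omega (phi i).

Definition interp (r : V -> R) : pt -> R := fun y => \sum_i r i * phi i y.
Definition interp3 (v : V -> 'rV[R]_3) : field :=
  fun y => \sum_i phi i y *: v i.

Definition lumped (rho : V -> R) (v w : V -> 'rV[R]_3) : R :=
  \sum_i mass i * rho i * dot (v i) (w i).

Definition midpoint (f g : field) : field := fun y => 2^-1 *: (f y + g y).

(* [cH] and [cxi] represent the curls of the midpoint magnetic field and of the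
   test field; the choice is immaterial, since the curl is unique up to null
   sets. The coefficients of a field of [Vh3] in the nodal basis are its values
   at the nodes. *)
Record source_step1 (mu di tau : R) (r : pt -> R) (rho : V -> R)
    (v0 : V -> 'rV[R]_3) (v1 : field) (H0 H1 cH : field) : Prop := {
  step1_v : Vh3 Omega T v1;
  step1_H : Hh0 Omega T H1;
  step1_curl : is_curl Omega (midpoint H0 H1) cH;
  step1_eqs : forall w xi cxi,
    Vh3 Omega T w -> Hh0 Omega T xi -> is_curl Omega xi cxi ->
    let lorentz := fun y => cross (cH y) (midpoint H0 H1 y) in
    lumped rho (fun i => v1 (x i) - v0 i) (fun i => w (x i))
      - tau * mu * ipL2 Omega lorentz w = 0 /\
    mu * ipL2 Omega (fun y => H1 y - H0 y) xi
      + tau * mu * ipL2 Omega (fun y => cross (cxi y) (midpoint H0 H1 y))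
                              (midpoint (interp3 v0) v1)
      + tau * ipL2 Omega (fun y => r y *: cH y) cxi
      + tau * mu * di *
          ipL2 Omega (fun y => (1 / interp rho y) *: lorentz y) cxi = 0 }.

Definition joule (r : pt -> R) (cH : field) (i : V) : R :=
  1 / mass i * integ Omega (fun y => r y * dot (cH y) (cH y) * phi i y).

Definition source_step2 (tau : R) (r : pt -> R) (v1 : field) (cH : field)
    (u0 u1 : V -> state R) : Prop :=
  forall i,
    [/\ dens (u1 i) = dens (u0 i),
        mom (u1 i) = dens (u0 i) *: v1 (x i) &
        ener (u1 i) = ener (u0 i)
          + 2^-1 * (dot (mom (u1 i)) (mom (u1 i)) / dens (u0 i))
          - 2^-1 * (dot (mom (u0 i)) (mom (u0 i)) / dens (u0 i))
          + tau * joule r cH i].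

End scheme.

(* Main.v *)
Require Import Defs.
From HB Require Import structures.
From mathcomp Require Import all_boot all_order all_algebra.
From mathcomp Require Import all_classical all_reals all_analysis.
From mathcomp Require Import measurable_realfun ring lra.
Set Implicit Arguments.
Unset Strict Implicit.
Unset Printing Implicit Defensive.
Import Order.TTheory GRing.Theory Num.Theory numFieldNormedType.Exports.
Local Open Scope classical_set_scope.
Local Open Scope ring_scope.

(** The three integral identities come from testing the two equations of the
    implicit step with well chosen functions.

    Energy. The fluid equation is tested with the midpoint velocity and the
    magnetic equation with the midpoint field, whose curl is the one that
    occurs in the scheme. The Lorentz terms of the two equations cancel, the
    Hall term vanishes pointwise because [cross c h] is orthogonal to [c], and
    the time differences paired with midpoints are differences of squares
    ([source_energy]). Total energy follows because the Joule heat of all nodes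
    adds up to the dissipation, the nodal functions being a partition of unity
    ([joule_sum], [source_total_energy]).

    Thermodynamics. The nodal functions are nonnegative, so the Joule heat of
    each node is too; the update keeps the density and raises the internal
    energy by that heat. Along a line of constant specific volume the entropy
    is nondecreasing and its energy derivative, the inverse temperature, is
    nonincreasing ([heating_monotone]).

    Involution. The magnetic equation is tested with the gradient of a
    piecewise quadratic function [w] that vanishes on the boundary: its curl is zero, so
    that only the time difference survives ([source_involution]). The work lies
    in showing that such a gradient is an admissible test field
    ([grad_h_Hh0], [grad_h_is_curl]):
    - It is curl free in the sense of distributions. The elements are only C^1
      images of the reference simplex; rather than integrating over their curved
      faces, the proof uses that [w] is Lipschitz along the segments of the
      domain, being continuous and piecewise C^1 ([le_increment_piecewise]),
      and that it is differentiable off the mesh skeleton, which is a null set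
      ([skeleton_negligible]). Difference quotients, translation invariance and
      dominated convergence then give the integration by parts formula with the
      elementwise gradient ([integration_by_parts_lipschitz]), and the second
      derivatives of the test field commute ([schwarz]).
    - Its tangential trace on a boundary facet vanishes. The trace is orthogonal
      to the edges of the facet because [w] is zero there, and the normal is
      orthogonal to them because they stay in the closure of the domain without
      entering it ([tangent_orthogonal_normal]). Both are thus multiples of one
      covector ([face_conormal]), also at the corners of the facet.

    The skeleton is null because each face lies in a level set of a C^1 function
    with nonzero derivative in some direction: small pieces of it have pairwise
    disjoint translates of equal measure in a bounded set
    ([null_of_disjoint_shifts]).

    The midpoint of two fields is admissible because the trace of a discrete
    field on an element always exists ([Hh_trace]): inside the element the field
    is the pull-back of an affine covector field by a C^1 map. *)

(** * Lebesgue measure on row vectors *)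

Section measurable_rV.
Context {R : realType} (n : nat).
Implicit Types (A : set 'rV[R]_n).

(** An open set is the union of the cubes of rational centre and radius [1 / (m + 1)]
    that it contains. *)
Lemma measurable_open_rV A : open A -> measurable A.
Proof.
move=> oA.
(* Cubes are cut out by their coordinates to make them measurable. *)
pose Q (p : 'rV[rat]_n * nat) : set 'rV[R]_n :=
  \bigcap_(i in [set: 'I_n])
     ((fun v : 'rV[R]_n => v ord0 i) @^-1` ball (ratr (p.1 ord0 i) : R) p.2.+1%:R^-1).
have mQ p : measurable (Q p).
  apply: fin_bigcap_measurable; first exact: finite_finset.
  move=> i _; rewrite -[X in measurable X]setTI.
  apply: (@measurable_coord R n i) => //.
  by apply: measurable_realfun.open_measurable; exact: ball_open.
have -> : A = \bigcup_p (if `[< Q p `<=` A >] then Q p else set0).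
  apply/seteqP; split => [v Av|v [p _]]; last by case: asboolP => // sQA /sQA.
  have /nbhs_ballP[e /= e0 veA] := oA _ Av.
  have e2 : 0 < e / 2 by rewrite divr_gt0.
  have [N _ /(_ N (leqnn N))/= Ne] := near_infty_natSinv_lt (PosNum e2).
  have /choice[q Hq] : forall i, exists q : rat, ratr q \in `]v ord0 i, (v ord0 i + N.+1%:R^-1)[.
    by move=> i; apply: rat_in_itvoo; rewrite ltrDl invr_gt0.
  have Qv : Q (\row_i q i, N) v.
    move=> i _ /=; rewrite mxE /ball/= ltr_distlC.
    have := Hq i; rewrite in_itv/= => /andP[h1 h2].
    by rewrite ltrBlDr h2/= (lt_trans h1)// ltrDl invr_gt0.
  exists (\row_i q i, N) => //; case: asboolP => //; case => u Qu; apply: veA.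
  split => // i j; rewrite !ord1.
  have /= := Qu j Logic.I; have /= := Qv j Logic.I.
  rewrite mxE /ball/= => h1 h2.
  rewrite distrC in h1; rewrite (le_lt_trans (ler_distD (ratr (q j)) _ _))//.
  rewrite (splitr e) ltrD// ?(lt_trans h1)// (lt_trans h2)//.
apply: countable_bigcupT_measurable => [|p]; first exact: countableP.
by case: ifP => _.
Qed.

Lemma continuous_measurable_rV A (f : 'rV[R]_n -> R) : open A ->
  (forall x, A x -> {for x, continuous f}) -> measurable_fun A f.
Proof.
move=> oA cf.
apply: (measurability _ (RGenOpens.measurableE R)) => _ [_ [a [b ->] <-]].
apply: measurable_open_rV.
rewrite openE => x [Ax fx]; apply: filterI; first exact: oA.
by apply: (cf x Ax); exact: (@open_nbhs_nbhs _ (f x) `]a, b[%classic (conj (interval_open _ _) fx)).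
Qed.

End measurable_rV.

Section lebesgue_rV_facts.
Context {R : realType}.

Lemma lebesgue_measure_shift (a : R) (A : set (measurableTypeR R)) :
  measurable A -> lebesgue_measure ((fun x : measurableTypeR R =>
    a + x : measurableTypeR R) @^-1` A) = lebesgue_measure A.
Proof.
move=> mA; have mf : measurable_fun setT (fun x : measurableTypeR R => a + x : measurableTypeR R).
  exact: measurable_funD.
rewrite -[LHS]/(pushforward lebesgue_measure (fun x : measurableTypeR R =>
  a + x : measurableTypeR R) A).
apply/esym/lebesgue_measure_unique => //= _ [[b c]] _ <-.
rewrite /pushforward (_ : _ @^-1` _ = `](b - a), (c - a)]%classic); last first.
  apply/seteqP; split => x; rewrite /preimage/= !in_itv/= => /andP[h1 h2];
  by apply/andP; split; lra.
rewrite !lebesgue_measure_itv/= !lte_fin ltrD2r -!EFinD.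
by congr (if _ then _%:E else _); ring.
Qed.

Definition shiftrV n (u v : 'rV[R]_n) := u + v.

Lemma measurable_shiftrV n (u : 'rV[R]_n) : measurable_fun setT (shiftrV u).
Proof.
apply: measurable_fun_rV => i; rewrite /shiftrV; under eq_fun do rewrite mxE.
by apply: measurable_funD => //; exact: measurable_coord.
Qed.

(** By induction on the dimension: the translate of a product measure agrees with
    it on rectangles. *)
Lemma lebesgue_rV_shift n (u : 'rV[R]_n) (A : set 'rV[R]_n) :
  measurable A -> lebesgue_rV n (shiftrV u @^-1` A) = lebesgue_rV n A.
Proof.
elim: n u A => [|n IH] u A mA.
  by rewrite (_ : _ @^-1` _ = A)//; apply/seteqP; split => x;
    rewrite /preimage/= (thinmx0 (shiftrV u x)) (thinmx0 x).
rewrite /= /lebesgue_step /pushforward.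
have mC : measurable (@consv R n @^-1` A).
  by rewrite -[X in measurable X]setTI; exact: measurable_consv.
pose g (p : measurableTypeR R * 'rV[R]_n) : measurableTypeR R * 'rV[R]_n :=
  ((unconsv u).1 + p.1 : measurableTypeR R, shiftrV (unconsv u).2 p.2).
have mg : measurable_fun setT g.
  apply: measurable_fun_pair; first by apply: measurable_funD.
  exact: (measurableT_comp (measurable_shiftrV _) measurable_snd).
have E p : shiftrV u (consv p) = consv (g p).
  apply/rowP => i; rewrite /shiftrV mxE; case: (unliftP ord0 i) => [j|] ->.
    by rewrite !consv_tail !mxE.
  by rewrite !consv_head.
rewrite (_ : _ @^-1` (_ @^-1` A) = g @^-1` (@consv R n @^-1` A)); last first.
  by rewrite /preimage; apply/seteqP; split => p /=; rewrite E.
apply/esym/(@product_measure_unique _ _ _ _ R lebesgue_measure (lebesgue_rV n)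
  (pushforward (lebesgue_measure \x lebesgue_rV n)%E g)) => //.
move=> B C mB mC'; rewrite /pushforward.
transitivity ((lebesgue_measure \x lebesgue_rV n)%E (
   ((fun x : measurableTypeR R => (unconsv u).1 + x :
     measurableTypeR R) @^-1` B) `*` (shiftrV (unconsv u).2 @^-1` C))) => //.
rewrite product_measure1E.
- by congr (_ * _)%E; [exact: lebesgue_measure_shift|exact: IH].
- by rewrite -[X in measurable X]setTI; apply: measurable_funD.
- by rewrite -[X in measurable X]setTI; exact: measurable_shiftrV.
Qed.

Definition rV_box n (M : R) : set 'rV[R]_n :=
  [set v | forall i, `|v ord0 i| <= M].

Lemma measurable_rV_box n (M : R) : measurable (@rV_box n M).
Proof.
rewrite (_ : rV_box M =
    \bigcap_(i in [set: 'I_n]) ((fun v : 'rV[R]_n => v ord0 i) @^-1` `[-M, M])).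
  apply: fin_bigcap_measurable; first exact: finite_finset.
  by move=> i _; rewrite -[X in measurable X]setTI; exact: (@measurable_coord R n i).
apply/seteqP; split => v /= h i; [move=> _ /=|]; first by rewrite in_itv/= -ler_norml.
by have := h i Logic.I; rewrite /= in_itv/= -ler_norml.
Qed.

Lemma lebesgue_rV_box n (M : R) : (lebesgue_rV n (rV_box M) < +oo)%E.
Proof.
elim: n => [|n IH].
  by rewrite /= diracE; case: (_ \in _); rewrite ltry.
rewrite /= /lebesgue_step /pushforward.
rewrite (_ : _ @^-1` _ = `[-M, M] `*` rV_box M); last first.
  apply/seteqP; split => [p /= h|p /= [h1 h2] i].
    split; first by have := h ord0; rewrite consv_head ler_norml /= in_itv.
    by move=> i; have := h (lift ord0 i); rewrite consv_tail.
  case: (unliftP ord0 i) => [j|] ->; rewrite ?consv_tail// consv_head ler_norml.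
  by move: h1; rewrite /= in_itv.
rewrite product_measure1E//; last exact: measurable_rV_box.
apply: lte_mul_pinfty => //.
rewrite ge0_fin_numE//.
suff : (@lebesgue_measure R (`[(- M)%R, M])%classic < +oo)%E by [].
by rewrite lebesgue_measure_itv/=; case: ifP => // _; rewrite -?EFinD ltry.
Qed.

Lemma lebesgue_rV_bounded n (A : set 'rV[R]_n) :
  measurable A -> bounded_set A -> (lebesgue_rV n A < +oo)%E.
Proof.
move=> mA [M [_ HM]].
have := HM (M + 1); rewrite ltrDl ltr01 => /(_ isT) HA.
apply: le_lt_trans (lebesgue_rV_box n (M + 1)).
apply: le_measure; rewrite ?inE//; first exact: measurable_rV_box.
move=> v Av i; apply: le_trans (HA _ Av).
by rewrite [leRHS]mx_normrE; apply: (@le_bigmax _ _ _ 0 (fun ij => `|v ij.1 ij.2|) (ord0, i)).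
Qed.

End lebesgue_rV_facts.

(** * Null sets from translations *)

Section line_calculus.
Context {R : realType} {V : normedModType R}.
Implicit Types (f : V -> R) (y u : V).

Lemma line_is_derive f y u (t : R) : derivable f (y + t *: u) u ->
  is_derive t 1 (fun s => f (y + s *: u)) ('D_u f (y + t *: u)).
Proof.
move=> df.
have E : (fun h => h^-1 *: (((fun s => f (y + s *: u)) \o shift t) (h *: (1 : R)) - f (y + t *: u)))
  = (fun h => h^-1 *: ((f \o shift (y + t *: u)) (h *: u) - f (y + t *: u))).
  apply/funext => h /=; congr (_ *: (f _ - _)).
  by rewrite [h *: 1]mulr1 scalerDl addrCA.
split; first by rewrite /derivable E.
by rewrite /derive E.
Qed.

(** Stated with directional derivatives alone, since smoothness is defined by them. *)
Lemma line_mvt f y u (a b : R) : a < b ->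
  (forall t, a <= t <= b -> derivable f (y + t *: u) u) ->
  exists2 c, a < c < b & f (y + b *: u) - f (y + a *: u) = 'D_u f (y + c *: u) * (b - a).
Proof.
move=> ab df.
have [||c cab E] := @MVT R (fun s => f (y + s *: u)) (fun s => 'D_u f (y + s *: u)) _ _ ab.
- move=> x; rewrite in_itv/= => /andP[ax xb].
  by apply: line_is_derive; apply: df; rewrite !ltW.
- apply: derivable_within_continuous => x; rewrite in_itv/= => xab.
  by have [] := line_is_derive (df _ xab).
by exists c => //; move: cab; rewrite in_itv.
Qed.

End line_calculus.

Lemma bounded_subset (R : realType) (V : normedModType R) (A B : set V) :
  A `<=` B -> bounded_set B -> bounded_set A.
Proof. by move=> AB [M [Mr HM]]; exists M; split => // N /HM H y /AB /H. Qed.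

Section null_sets.
Context {R : realType} {n : nat}.
Implicit Types (S : set 'rV[R]_n).
Local Notation mu := (lebesgue_rV n).

(** The translates by [u / (k + 1)] are disjoint, have the measure of [S], and stay
    in one box of finite measure. *)
Lemma null_of_disjoint_shifts S u : measurable S -> bounded_set S ->
  (forall s t, 0 <= s < t -> t <= 1 ->
    shiftrV (s *: u) @^-1` S `&` shiftrV (t *: u) @^-1` S = set0) ->
  mu S = 0%E.
Proof.
move=> mS bS dS.
pose F (k : nat) := shiftrV ((k.+1%:R^-1 : R) *: u) @^-1` S.
have mF k : measurable (F k).
  by rewrite -[X in measurable X]setTI; exact: measurable_shiftrV.
have tF : trivIset setT F.
  have dF j k : (j < k)%N -> F j `&` F k = set0.
    move=> jk; rewrite setIC; apply: dS;
      rewrite ?invr_ge0 ?ler0n ?ltf_pV2 ?posrE ?ltr0n ?ltr_nat ?ltnS//.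
    by rewrite invf_le1 ?ler1n ?ltr0n.
  apply/trivIsetP => j k _ _; rewrite neq_ltn => /orP[|] jk; first exact: dF.
  by rewrite setIC dF.
have [M [_ HM]] := bS.
have := HM (M + 1); rewrite ltrDl ltr01 => /(_ isT) HA.
set B := @rV_box R n (M + 1 + `|u|).
have FB k : F k `<=` B.
  move=> v Fv i; have H := HA _ Fv.
  have : `|v| <= M + 1 + `|u|.
    rewrite -[v](addrK (k.+1%:R^-1 *: u)) (le_trans (ler_normB _ _))// lerD//.
      by rewrite addrC; exact: H.
    rewrite normrZ ger0_norm ?invr_ge0 ?ler0n// ler_piMl// invf_le1 ?ler1n ?ltr0n//.
  apply: le_trans.
  by rewrite [leRHS]mx_normrE; apply: (@le_bigmax _ _ _ 0 (fun ij => `|v ij.1 ij.2|) (ord0, i)).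
have mB := @measurable_rV_box R n (M + 1 + `|u|).
have Bfin := @lebesgue_rV_box R n (M + 1 + `|u|).
have NS N : (\sum_(k < N) mu S <= mu B)%E.
  have -> : (\sum_(k < N) mu S = mu (\big[setU/set0]_(k < N) F k))%E.
    rewrite measure_semi_additive_ord_I//; [|exact: sub_trivIset tF|exact: bigsetU_measurable].
    by apply: eq_bigr => k _; apply: esym; exact: lebesgue_rV_shift.
  apply: le_measure; rewrite ?inE//; first exact: bigsetU_measurable.
  by rewrite -bigcup_mkord => v [k _]; exact: FB.
have Sfin : mu S \is a fin_num by rewrite ge0_fin_numE// lebesgue_rV_bounded.
have Bf : mu B \is a fin_num by rewrite ge0_fin_numE.
move: NS; rewrite -(fineK Sfin) -(fineK Bf) => NS.
have c0 : 0 <= fine (mu S) by apply: fine_ge0.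
congr (_%:E); apply/eqP; rewrite eq_le c0 andbT leNgt; apply/negP => c1.
have [N HN] : exists N : nat, fine (mu B) / fine (mu S) < N%:R.
  by exists (Num.truncn (fine (mu B) / fine (mu S))).+1; exact: truncnS_gt.
have := NS N; rewrite sumEFin lee_fin sumr_const card_ord -mulr_natl.
by rewrite leNgt -ltr_pdivrMr// HN.
Qed.

Lemma negligible_compact (K S : set 'rV[R]_n) : compact K ->
  (forall z, K z -> exists2 B, open_nbhs z B & mu.-negligible (B `&` S)) ->
  mu.-negligible (K `&` S).
Proof.
rewrite compact_cover => cK H.
have H' z : exists B, open B /\ (K z -> B z /\ mu.-negligible (B `&` S)).
  have [Kz|nKz] := pselect (K z); last by exists set0; split => //; exact: open0.
  by have [B [oB Bz] nB] := H z Kz; exists B.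
move: H' => /choice[f Hf].
have [|z Kz|D DK KD] := cK _ K f; first by move=> i _; have [] := Hf i.
  by exists z => //; have [_ /(_ Kz)[]] := Hf z.
have KS : K `&` S `<=` \big[setU/set0]_(i <- finmap.enum_fset D) (if `[< K i >] then f i `&` S
  else set0).
  move=> y [Ky Sy]; rewrite -bigcup_fset; have [i /= iD fiy] := KD _ Ky.
  exists i => //; case: asboolP => //; case.
  by have := DK _ iD; rewrite inE.
apply: (negligibleS KS).
elim/big_ind : _ => //; first exact: negligible_set0.
  by move=> *; exact: negligibleU.
move=> i _; case: asboolP => [Ki|_]; last exact: negligible_set0.
by have [_ /(_ Ki)[]] := Hf i.
Qed.

Lemma bounded_ball (z : 'rV[R]_n) e : bounded_set (ball z e).
Proof.
exists (`|z| + e); split; first exact: num_real.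
move=> M HM y; rewrite mx_norm_ball /ball_/= => zy.
rewrite ltW// (le_lt_trans _ HM)// -[y](subrK z) addrC (le_trans (ler_normD _ _))// lerD2l.
by rewrite distrC ltW.
Qed.

Lemma ball_segment (z y u : 'rV[R]_n) e s t c : ball z e (y + s *: u) -> ball z e (y + t *: u) ->
  s <= c <= t -> ball z e (y + c *: u).
Proof.
rewrite mx_norm_ball /ball_/= => Bs Bt /andP[sc ct].
have [st|] := ltP s t; last first.
  by move=> ts; have <- : s = c by apply/eqP; rewrite eq_le sc (le_trans ct).
have st0 : t - s != 0 by rewrite subr_eq0 gt_eqF.
pose a := (t - c) / (t - s); pose b := (c - s) / (t - s).
have ab : a + b = 1 by rewrite /a /b -mulrDl addrA subrK divff.
have a0 : 0 <= a by rewrite divr_ge0// subr_ge0// ltW.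
have b0 : 0 <= b by rewrite divr_ge0// subr_ge0// ltW.
have E : z - (y + c *: u) = a *: (z - (y + s *: u)) + b *: (z - (y + t *: u)).
  apply/rowP => i; rewrite !mxE.
  have -> : c = a * s + b * t by rewrite /a /b; field.
  by rewrite -[z 0 i in LHS]mul1r -[y 0 i in LHS]mul1r -ab; ring.
have nZ k (x : 'rV[R]_n) : 0 <= k -> `|k *: x| = k * `|x|.
  by move=> k0; rewrite normrZ ger0_norm.
rewrite E (le_lt_trans (ler_normD _ _))// !nZ//.
have -> : e = a * e + b * e by rewrite -mulrDl ab mul1r.
have [a00|] := eqVneq a 0.
  rewrite a00 !mul0r !add0r; have -> : b = 1 by rewrite -ab a00 add0r.
  by rewrite !mul1r.
move=> an0; apply: ltr_leD; last by rewrite ler_wpM2l// ltW.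
by rewrite ltr_pM2l// lt_neqAle eq_sym an0 a0.
Qed.

(** On a ball where the derivative in direction [u] does not vanish, [g] takes
    different values at different points of a line of direction [u], so that the
    translates of the level set along [u] are disjoint. *)
Lemma negligible_level_set (g : 'rV[R]_n -> R) (z u : 'rV[R]_n) :
  (\forall y \near z, [/\ {for y, continuous g}, derivable g y u & 'D_u g y != 0]) ->
  exists2 B, open_nbhs z B & mu.-negligible (B `&` [set y | g y = 0]).
Proof.
move=> /nbhs_ballP[e /= e0 He].
exists (ball z e); first by split; [exact: ball_open|exact: ballxx].
have mS : measurable (ball z e `&` [set y | g y = 0]).
  have /= := @continuous_measurable_rV R n (ball z e) g (ball_open _ _).
  have cg y : ball z e y -> {for y, continuous g} by move=> /He[].
  by move=> /(_ cg (measurable_open_rV (ball_open z e)) [set 0] (measurable_set1 _)).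
apply/negligibleP => //; apply: (null_of_disjoint_shifts (u := u)) => //.
  by apply: bounded_subset (@bounded_ball z e); exact: subIsetl.
move=> s t /andP[s0 st] t1; apply/seteqP; split => // v [[Bs gs] [Bt gt]].
have st0 : t - s != 0 by rewrite subr_eq0 gt_eqF.
rewrite /shiftrV ![_ + v]addrC in Bs Bt gs gt.
have Bc := ball_segment Bs Bt.
have [r sr|c /andP[sc ct]] := @line_mvt R _ g v u s t st.
  by have [] := He _ (Bc _ sr).
rewrite gs gt subr0 => /esym/eqP; rewrite mulf_eq0 (negbTE st0) orbF.
by have [|_ _ /negP] := He (v + c *: u); first by apply: Bc; rewrite !ltW.
Qed.

End null_sets.

(** * Square-integrable fields *)

Lemma measurable_fun_rVP d (T : measurableType d) (R : realType) n (D : set T)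
    (f : T -> 'rV[R]_n) :
  (forall i, measurable_fun D (fun x => f x ord0 i)) -> measurable_fun D f.
Proof.
move=> mf mD.
suff : measurable_fun D f by exact.
apply: (measurability
  (\bigcup_(i in [set` index_enum 'I_n]) preimage_set_system setT (fun v : 'rV[R]_n =>
    v ord0 i) measurable)).
  by rewrite bigcup_seq.
move=> _ [B [i _ [Y mY <-]] <-].
by rewrite setTI; exact: mf.
Qed.

Section dot.
Context {R : realType} {n : nat}.
Implicit Types (u v w : 'rV[R]_n) (a : R).

Lemma dotC u v : dot u v = dot v u.
Proof. by apply: eq_bigr => i _; rewrite mulrC. Qed.

Lemma dotDl u v w : dot (u + v) w = dot u w + dot v w.
Proof. by rewrite -big_split/=; apply: eq_bigr => i _; rewrite mxE mulrDl. Qed.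

Lemma dotZl a u w : dot (a *: u) w = a * dot u w.
Proof. by rewrite mulr_sumr; apply: eq_bigr => i _; rewrite mxE mulrA. Qed.

Lemma dotDr u v w : dot w (u + v) = dot w u + dot w v.
Proof. by rewrite dotC dotDl ![dot w _]dotC. Qed.

Lemma dotZr a u w : dot w (a *: u) = a * dot w u.
Proof. by rewrite dotC dotZl dotC. Qed.

Lemma dotNl u v : dot (- u) v = - dot u v.
Proof. by rewrite -scaleN1r dotZl mulN1r. Qed.

Lemma dot0l v : dot 0 v = 0.
Proof. by rewrite -(scale0r 0) dotZl mul0r. Qed.

Lemma dot_ge0 u : 0 <= dot u u.
Proof. by apply: sumr_ge0 => i _; rewrite -expr2 sqr_ge0. Qed.

(** A rough Cauchy-Schwarz inequality, enough for the product of two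
    square-integrable fields to be integrable. *)
Lemma dot_le u v : `|dot u v| <= dot u u + dot v v.
Proof.
have h1 := dot_ge0 (u + v); have h2 := dot_ge0 (u - v).
move: h1 h2; rewrite !dotDl !dotDr !dotNl ![dot _ (- _)]dotC !dotNl (dotC v u) => h1 h2.
by rewrite ler_norml; apply/andP; split; have := dot_ge0 u; have := dot_ge0 v; lra.
Qed.

End dot.

Section L2.
Context {R : realType} {d : nat} (Omega : set 'rV[R]_d).
Hypotheses (oO : open Omega) (bO : bounded_set Omega).
Local Notation mu := (lebesgue_rV d).
Local Notation field := ('rV[R]_d -> 'rV[R]_3).
Implicit Types (f g : field) (h : 'rV[R]_d -> R).

Let mO : measurable Omega := measurable_open_rV oO.
Let fO : (mu Omega < +oo)%E := lebesgue_rV_bounded mO bO.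

Lemma bounded_integrable h (M : R) : measurable_fun Omega h ->
  (forall y, Omega y -> `|h y| <= M) -> mu.-integrable Omega (EFin \o h).
Proof.
move=> mh hM; apply: measurable_bounded_integrable => //.
exists M; split; first exact: num_real.
by move=> N MN y Oy; apply: (le_trans (hM _ Oy)); exact: ltW.
Qed.

Lemma measurable_dot f g : measurable_fun Omega f -> measurable_fun Omega g ->
  measurable_fun Omega (fun y => dot (f y) (g y)).
Proof.
move=> mf mg; apply: measurable_sum => i; apply: measurable_funM.
  exact: (measurableT_comp (@measurable_coord R 3 i) mf).
exact: (measurableT_comp (@measurable_coord R 3 i) mg).
Qed.

Lemma inL2_dot f g : inL2 Omega f -> inL2 Omega g ->
  mu.-integrable Omega (EFin \o (fun y => dot (f y) (g y))).
Proof.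
move=> [mf f2] [mg g2].
apply: (le_integrable _ _ _ (integrableD _ f2 g2)) => //.
  by apply/measurable_EFinP; exact: measurable_dot.
move=> y Oy /=; rewrite lee_fin [leRHS]ger0_norm ?addr_ge0 ?dot_ge0//.
exact: dot_le.
Qed.

Lemma inL2Z a f : inL2 Omega f -> inL2 Omega (fun y => a *: f y).
Proof.
move=> [mf f2]; split.
  apply: measurable_fun_rVP => i; under eq_fun do rewrite mxE.
  apply: measurable_funM => //.
  exact: (measurableT_comp (@measurable_coord R 3 i) mf).
apply: eq_integrable (integrableZl _ (a * a) f2) => //.
by move=> y _; rewrite dotZl dotZr mulrA EFinM.
Qed.

Lemma inL2D f g : inL2 Omega f -> inL2 Omega g -> inL2 Omega (fun y => f y + g y).
Proof.
move=> f2 g2; have fg := inL2_dot f2 g2; have [mf if_] := f2; have [mg ig] := g2.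
split.
  apply: measurable_fun_rVP => i; under eq_fun do rewrite mxE.
  by apply: measurable_funD; [exact: (measurableT_comp (@measurable_coord R 3 i) mf)|
    exact: (measurableT_comp (@measurable_coord R 3 i) mg)].
apply: eq_integrable (integrableD _ (integrableD _ if_ ig) (integrableZl _ 2 fg)) => //.
by move=> y _ /=; rewrite dotDl !dotDr (dotC (g y) (f y)) -EFinM -!EFinD; congr _%:E; ring.
Qed.

Lemma bounded_inL2 f (M : R) : measurable_fun Omega f ->
  (forall y, Omega y -> dot (f y) (f y) <= M) -> inL2 Omega f.
Proof.
move=> mf fM; split => //; apply: (@bounded_integrable _ M); first exact: measurable_dot.
by move=> y Oy; rewrite ger0_norm ?dot_ge0// fM.
Qed.

Lemma ipL2C f g : ipL2 Omega f g = ipL2 Omega g f.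
Proof. by apply: eq_Rintegral => y _; rewrite dotC. Qed.

Lemma ipL2Dl f g k : inL2 Omega f -> inL2 Omega g -> inL2 Omega k ->
  ipL2 Omega (fun y => f y + g y) k = ipL2 Omega f k + ipL2 Omega g k.
Proof.
move=> f2 g2 k2; rewrite /ipL2 /integ -RintegralD//; [|exact: inL2_dot..].
by apply: eq_Rintegral => y _; rewrite dotDl.
Qed.

Lemma ipL2Zl a f k : inL2 Omega f -> inL2 Omega k ->
  ipL2 Omega (fun y => a *: f y) k = a * ipL2 Omega f k.
Proof.
move=> f2 k2; rewrite /ipL2 /integ -RintegralZl//; last exact: inL2_dot.
by apply: eq_Rintegral => y _; rewrite dotZl.
Qed.

Lemma normL2_sqr f : normL2 Omega f ^+ 2 = ipL2 Omega f f.
Proof. by rewrite sqr_sqrtr//; apply: Rintegral_ge0 => y _; exact: dot_ge0. Qed.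

End L2.

(** * Integration by parts for functions that are Lipschitz on segments *)

Section integration_by_parts.
Context {R : realType} {d : nat} (Omega : set 'rV[R]_d).
Hypotheses (oO : open Omega) (bO : bounded_set Omega).
Local Notation pt := 'rV[R]_d.
Local Notation mu := (lebesgue_rV d).

Let mO : measurable Omega := measurable_open_rV oO.

Lemma integrable_supported (f : pt -> R) (M : R) : measurable_fun setT f ->
  (forall y, Omega y -> `|f y| <= M) -> (forall y, ~ Omega y -> f y = 0) ->
  mu.-integrable setT (EFin \o f).
Proof.
move=> mf fM f0.
have -> : EFin \o f = (EFin \o f) \_ Omega.
  apply/funext => y; rewrite patchE; case: ifPn => // /negP yO.
  by rewrite /= f0// => Oy; apply: yO; rewrite inE.
apply/(integrable_mkcond _ mO); apply: (bounded_integrable oO bO _ fM).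
exact: measurable_funTS.
Qed.

Lemma integral_shift (f : pt -> R) (u : pt) : mu.-integrable setT (EFin \o f) ->
  \int[mu]_(y in setT) f (u + y) = \int[mu]_(y in setT) f y.
Proof.
move=> fi; rewrite /Rintegral; congr fine.
have mf : measurable_fun setT (EFin \o f) by case/integrableP : fi.
have ms := @measurable_shiftrV R d u.
have E A : measurable A -> pushforward mu (shiftrV u) A = mu A.
  by move=> mA; exact: lebesgue_rV_shift.
transitivity (\int[pushforward mu (shiftrV u)]_(y in setT) (EFin \o f) y)%E; last first.
  by apply: eq_measure_integral => A mA _; exact: E.
rewrite (integral_pushforward ms) //.
have := fi; rewrite preimage_setT => /integrableP[_ foo].
apply/integrableP; split; first exact: measurableT_comp mf ms.
rewrite (_ : (\int[_]_(_ in _) _ = \int[mu]_(y in setT) (`|(EFin \o f) y|))%E)//.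
transitivity (\int[pushforward mu (shiftrV u)]_(y in setT) (abse \o (EFin \o f)) y)%E.
  rewrite ge0_integral_pushforward//; first exact: measurableT_comp.
  by move=> y _; exact: abse_ge0.
by apply: eq_measure_integral => A mA _; exact: E.
Qed.

Lemma difference_quotient_cvg (f : pt -> R) (y u : pt) (a : R^nat) :
  derivable f y u -> (forall n, a n != 0) -> a @ \oo --> (0 : R) ->
  (fun n => (f (y + a n *: u) - f y) / a n) @ \oo --> ('D_u f y).
Proof.
move=> df a0 acv.
have /cvgr_dnbhsP/(_ a) : (fun h : R =>
  h^-1 *: ((f \o shift y) (h *: u) - f y)) h @[h --> 0^'] --> 'D_u f y.
  exact: df.
move=> /(_ (conj a0 acv)) acvg.
rewrite (_ : (fun n => _) = (fun n => (a n)^-1 *: ((f \o shift y) (a n *: u) - f y))).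
  exact: acvg.
by apply/funext => n /=; rewrite [RHS]mulrC [_ + y]addrC.
Qed.

Lemma integrable_indic_scaled (K : R) :
  mu.-integrable setT (EFin \o (fun y : pt => K * \1_Omega y)).
Proof.
apply: (@integrable_supported _ `|K|).
- by apply: measurable_funM => //; exact: measurable_indic.
- by move=> y Oy; rewrite indicE mem_set// mulr1.
- by move=> y nO; rewrite indicE memNset// mulr0.
Qed.

Lemma dominated_Rintegral (f_ : nat -> pt -> R) (f : pt -> R) (N : set pt) (K : R) :
  (forall n, measurable_fun setT (f_ n)) -> measurable_fun setT f ->
  mu.-negligible N -> (forall y, ~ N y -> f_ n y @[n --> \oo] --> f y) ->
  (forall n y, `|f_ n y| <= K * \1_Omega y) ->
  \int[mu]_(y in setT) f_ n y @[n --> \oo] --> \int[mu]_(y in setT) f y.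
Proof.
move=> mf_ mf [B [mB B0 NB]] cf fK.
have mf_E n : measurable_fun setT (EFin \o f_ n) by exact/measurable_EFinP.
have mfE : measurable_fun setT (EFin \o f) by exact/measurable_EFinP.
have ae_cvg : {ae mu, forall y, [set: pt] y -> (EFin \o f_ n) y @[n --> \oo] --> (EFin \o f) y}.
  exists B; split => // y /= nB; apply: NB => /=; apply: contrapT => nN; apply: nB => _.
  by apply: cvg_EFin; [exact: nearW|exact: cf].
have ae_le : {ae mu, forall y, forall n, [set: pt] y ->
    (`|(EFin \o f_ n) y| <= (EFin \o (fun y => (K * \1_Omega y)%R)) y)%E}.
  by apply: aeW => y n _ /=; rewrite lee_fin.
have [fi _ cI] := dominated_convergence measurableT mf_E mfE ae_cvg (integrable_indic_scaled K)
  ae_le.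
apply: fine_cvg; rewrite fineK; last exact: integrable_fin_num.
exact: cI.
Qed.

Lemma compact_bound (C : set pt) (f : pt -> R) : compact C -> continuous f ->
  (forall y, ~ C y -> f y = 0) -> exists M : R, 0 <= M /\ forall y, `|f y| <= M.
Proof.
move=> cC cf f0.
have /compact_bounded[M [_ HM]] : compact (f @` C).
  by apply: continuous_compact => //; exact: continuous_subspaceT.
exists (Num.max 0 (M + 1)); split; first by rewrite le_max lexx.
move=> y; have [Cy|/f0 ->] := pselect (C y); last by rewrite normr0 le_max lexx.
by rewrite le_max (HM (M + 1)) ?ltrDl ?ltr01 ?orbT//; exists y.
Qed.

(** Compactness makes uniform in [y] the room that each [y] of [C] has in
    direction [u]. *)
Lemma compact_shift (C : set pt) (u : pt) : compact C -> C `<=` Omega ->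
  \forall s \near (0 : R), forall y, C y -> Omega (y + s *: u).
Proof.
move=> /compact_near_coveringP cC CO.
apply: (cC R (nbhs (0 : R)) (fun s y => Omega (y + s *: u))) => y Cy.
have : (fun p : pt * R => p.1 + p.2 *: u) @ (y, 0 : R) --> y + (0 : R) *: u.
  by apply: cvgD; [exact: cvg_fst|apply: cvgZr_tmp; exact: cvg_snd].
rewrite scale0r addr0; apply; exact: oO (CO _ Cy).
Qed.

Lemma support_derive (phi : pt -> R) (C : set pt) u : compact C ->
  (forall y, ~ C y -> phi y = 0) -> forall y, ~ C y -> 'D_u phi y = 0.
Proof.
move=> cC phi0 y nCy; have oC : open (~` C).
  by rewrite openC; apply: compact_closed => //; exact: norm_hausdorff.
have nz : \forall z \near y, phi z = cst 0 z.
  by apply: filterS (open_nbhs_nbhs (conj oC nCy)) => z; exact: phi0.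
by rewrite (near_eq_derive u nz) derive_cst.
Qed.

(** Moving the difference quotient from [w] to [phi] is a translation of the
    integral. The Lipschitz bound along segments dominates the quotients of [w],
    whose limit is [h] almost everywhere; the derivative of [phi] dominates those
    of [phi]. The steps are so short that the support of [phi], moved by them,
    stays in [Omega]. *)
Lemma integration_by_parts_lipschitz (w h phi : pt -> R) (u : pt) (N C : set pt) (M0 M : R) :
  measurable_fun Omega w -> (forall y, Omega y -> `|w y| <= M0) ->
  measurable_fun Omega h ->
  mu.-negligible N ->
  (forall y, Omega y -> ~ N y -> derivable w y u /\ 'D_u w y = h y) ->
  (forall y t, 0 <= t -> (forall s, 0 <= s <= t -> Omega (y + s *: u)) ->
     `|w (y + t *: u) - w y| <= M * t) ->
  continuous phi -> (forall y, derivable phi y u) -> continuous ('D_u phi) ->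
  compact C -> C `<=` Omega -> (forall y, ~ C y -> phi y = 0) ->
  integ Omega (fun y => h y * phi y) = - integ Omega (fun y => w y * 'D_u phi y).
Proof.
move=> mw wM0 mh N0 wh lip cphi dphi cdphi cC CO phi0.
have CO' y : ~ Omega y -> ~ C y by move=> nO /CO.
have dphi0 y : ~ C y -> 'D_u phi y = 0 by apply: (support_derive _ cC).
have [Mphi [Mphi_ge0 phiM]] := compact_bound cC cphi phi0.
have [Md [Md_ge0 dM]] := compact_bound cC cdphi dphi0.
have mphi : measurable_fun setT phi.
  by apply: continuous_measurable_rV => [|y _]; [exact: openT|exact: cphi].
have mdphi : measurable_fun setT ('D_u phi).
  by apply: continuous_measurable_rV => [|y _]; [exact: openT|exact: cdphi].
(* The extension of [w] by 0 makes the translation of the integral meaningful. *)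
pose W := w \_ Omega.
have mW : measurable_fun setT W by apply/(measurable_restrictT _ mO).
have WE y : Omega y -> W y = w y by move=> Oy; rewrite /W patchE mem_set.
have W0 y : ~ Omega y -> W y = 0 by move=> nO; rewrite /W patchE memNset.
have M0W y : `|W y| <= `|M0|.
  have [Oy|nO] := pselect (Omega y); last by rewrite W0// normr0.
  by rewrite WE// (le_trans (wM0 _ Oy))// ler_norm.
have [e /= e0 He] : exists2 e : R, 0 < e & forall s y, `|s| <= e -> C y -> Omega (y + s *: u).
  have /nbhs_ballP[e /= e0 He] := compact_shift u cC CO.
  exists (e / 2); first by rewrite divr_gt0.
  move=> s y se; apply: He; rewrite /ball/= sub0r normrN (le_lt_trans se)//.
  by rewrite ltr_pdivrMr// ltr_pMr// ltr1n.
pose a (n : nat) : R := e * n.+1%:R^-1.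
have a_gt0 n : 0 < a n by rewrite mulr_gt0// invr_gt0.
have a_le n : a n <= e by rewrite ger_pMr// invf_le1// ler1n.
have a_neq0 n : a n != 0 by rewrite gt_eqF.
have a_cvg : a @ \oo --> (0 : R).
  by rewrite -(mulr0 e); apply: cvgMl_tmp; exact: cvg_harmonic.
pose q n y := (W (y + a n *: u) - W y) / a n * phi y.
pose p n y := W y * ((phi (y + (- a n) *: u) - phi y) / - a n).
have mshift (f : pt -> R) (v : pt) : measurable_fun setT f ->
  measurable_fun setT (fun y : pt => f (y + v)).
  move=> mf; rewrite (_ : (fun y => _) = f \o shiftrV v).
    exact: measurableT_comp mf (measurable_shiftrV v).
  by apply/funext => y; rewrite /= /shiftrV addrC.
have mq n : measurable_fun setT (q n).
  apply: measurable_funM => //; apply: measurable_funM => //.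
  by apply: measurable_funB => //; exact: mshift.
have mp n : measurable_fun setT (p n).
  apply: measurable_funM => //; apply: measurable_funM => //.
  by apply: measurable_funB => //; exact: mshift.
have qM n y : `|q n y| <= `|M| * Mphi * \1_Omega y.
  have [Cy|nC] := pselect (C y); last first.
    by rewrite /q phi0// mulr0 normr0 mulr_ge0// mulr_ge0.
  have Oy := CO _ Cy.
  rewrite indicE mem_set// mulr1 /q normrM ler_pM//.
  have Oa : forall s, 0 <= s <= a n -> Omega (y + s *: u).
    by move=> s /andP[s0 sa]; apply: He => //; rewrite ger0_norm// (le_trans sa).
  rewrite !WE//; last by apply: Oa; rewrite lexx ltW.
  rewrite normrM normfV (ger0_norm (ltW (a_gt0 n))) ler_pdivrMr//.
  rewrite (le_trans (lip _ _ (ltW (a_gt0 n)) Oa))// ler_wpM2r ?ler_norm// ltW//.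
have pM n y : `|p n y| <= `|M0| * Md * \1_Omega y.
  have [Oy|nO] := pselect (Omega y); last first.
    by rewrite /p W0// mul0r normr0 mulr_ge0// mulr_ge0.
  rewrite indicE mem_set// mulr1 /p normrM ler_pM//.
  have an : - a n < 0 by rewrite oppr_lt0.
  have [t _|c _ E] := @line_mvt R _ phi y u (- a n) 0 an; first exact: dphi.
  rewrite scale0r addr0 sub0r opprK in E.
  by rewrite -[X in X / _]opprB E invrN mulrNN mulfK.
have Lq : \int[mu]_(y in setT) q n y @[n --> \oo] --> integ Omega (fun y => h y * phi y).
  rewrite /integ Rintegral_mkcond.
  apply: (@dominated_Rintegral q _ N _ mq _ N0 _ qM).
    apply/(measurable_restrictT _ mO); apply: measurable_funM => //.
    exact: measurable_funTS.
  move=> y nN; rewrite patchE.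
  have [Oy|nO] := pselect (Omega y); last first.
    rewrite memNset// /q phi0; last exact: CO'.
    by under eq_fun do rewrite mulr0; exact: cvg_cst.
  rewrite mem_set//; have [dw <-] := wh _ Oy nN.
  apply: cvgMr_tmp; have dq := difference_quotient_cvg dw a_neq0 a_cvg.
  refine (cvg_trans _ dq); apply: near_eq_cvg.
  have ycv : (fun n => y + a n *: u) @ \oo --> y + (0 : R) *: u.
    by apply: cvgD; [exact: cvg_cst|exact: cvgZr_tmp].
  have yO : \forall n \near \oo, Omega (y + a n *: u).
    by apply: ycv; rewrite scale0r addr0; exact: open_nbhs_nbhs.
  by near=> n; rewrite /= !WE//; near: n.
have Lp : \int[mu]_(y in setT) p n y @[n --> \oo] --> integ Omega (fun y => w y * 'D_u phi y).
  rewrite /integ Rintegral_mkcond.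
  apply: (@dominated_Rintegral p _ set0 _ mp _ _ _ pM).
  - apply/(measurable_restrictT _ mO); apply: measurable_funM => //.
    exact: measurable_funTS.
  - exact: negligible_set0.
  move=> y _; rewrite patchE /p.
  have [Oy|nO] := pselect (Omega y); last first.
    rewrite memNset// W0//.
    by under eq_fun do rewrite mul0r; exact: cvg_cst.
  rewrite mem_set// WE//; apply: cvgMl_tmp.
  apply: (@difference_quotient_cvg phi y u (fun n => - a n)) => //.
    by move=> n; rewrite oppr_eq0.
  by rewrite -oppr0; exact: cvgN.
have E n : \int[mu]_(y in setT) q n y = - (\int[mu]_(y in setT) p n y).
  have iWs : mu.-integrable setT (EFin \o (fun y : pt =>
    (a n)^-1 * (W y * phi (y + (- a n) *: u)))).
    apply: (@integrable_supported _ (`|(a n)^-1| * (`|M0| * Mphi))).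
    - by apply: measurable_funM => //; apply: measurable_funM => //; exact: mshift.
    - by move=> y _; rewrite !normrM ler_wpM2l// ler_pM.
    - by move=> y nO; rewrite W0// mul0r mulr0.
  have iW : mu.-integrable setT (EFin \o (fun y : pt => (a n)^-1 * (W y * phi y))).
    apply: (@integrable_supported _ (`|(a n)^-1| * (`|M0| * Mphi))).
    - by apply: measurable_funM => //; apply: measurable_funM.
    - by move=> y _; rewrite !normrM ler_wpM2l// ler_pM.
    - by move=> y nO; rewrite W0// mul0r mulr0.
  have iWs' : mu.-integrable setT (EFin \o (fun y : pt => (a n)^-1 * (W (a n *: u + y) * phi y))).
    apply: (@integrable_supported _ (`|(a n)^-1| * (`|M0| * Mphi))).
    - apply: measurable_funM => //; apply: measurable_funM => //.
      by under eq_fun do rewrite addrC; exact: mshift.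
    - by move=> y _; rewrite !normrM ler_wpM2l// ler_pM.
    - by move=> y nO; rewrite phi0 ?mulr0//; exact: CO'.
  transitivity (\int[mu]_(y in setT) ((a n)^-1 * (W (a n *: u + y) * phi y))
    - \int[mu]_(y in setT) ((a n)^-1 * (W y * phi y))).
    rewrite -RintegralB//; apply: eq_Rintegral => y _.
    by rewrite /q [y + _]addrC; ring.
  transitivity (\int[mu]_(y in setT) ((a n)^-1 * (W y * phi (y + (- a n) *: u)))
    - \int[mu]_(y in setT) ((a n)^-1 * (W y * phi y))).
    congr (_ - _); rewrite -(integral_shift (a n *: u) iWs).
    by apply: eq_Rintegral => y _; rewrite scaleNr addrAC subrr add0r.
  have ip : mu.-integrable setT (EFin \o p n).
    apply: (@integrable_supported _ (`|M0| * Md)) => // y Oy.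
      by have := pM n y; rewrite indicE mem_set// mulr1.
    by rewrite /p W0// mul0r.
  have -> : - (\int[mu]_(y in setT) p n y) = \int[mu]_(y in setT) (-1 * p n y).
    by rewrite RintegralZl// mulN1r.
  rewrite -RintegralB//; apply: eq_Rintegral => y _.
  by rewrite /p invrN; ring.
have Lq' : \int[mu]_(y in setT) q n y @[n --> \oo] --> - integ Omega (fun y => w y * 'D_u phi y).
  by under eq_fun do rewrite E; exact: cvgN.
exact: cvg_unique Lq Lq'.
Unshelve. all: by end_near. Qed.

End integration_by_parts.

(** * Increments of piecewise differentiable functions *)

Section lipschitz.
Context {R : realType}.

(** Continuous induction: the supremum of the points up to which the bound holds
    belongs to that set and can only be [b]. *)
Lemma le_increment_of_local (f : R -> R) (a b L : R) : a <= b ->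
  (forall t, a <= t <= b -> \forall s \near t, a <= s <= b -> `|f s - f t| <= L * `|s - t|) ->
  `|f b - f a| <= L * (b - a).
Proof.
move=> ab loc.
pose S := [set t | a <= t <= b /\ `|f t - f a| <= L * (t - a)].
have Sa : S a by split; rewrite ?lexx// !subrr normr0 mulr0.
have hS : has_sup S by split; [exists a|exists b => t [/andP[]]].
have ac : a <= sup S by apply: ub_le_sup => //; case: hS.
have cb : sup S <= b by apply: ge_sup; [exists a|move=> t [/andP[]]].
have /nbhs_ballP[e /= e0 He] : \forall s \near sup S, a <= s <= b ->
  `|f s - f (sup S)| <= L * `|s - sup S| by apply: loc; rewrite ac.
have Hc s : `|s - sup S| < e -> a <= s <= b -> `|f s - f (sup S)| <= L * `|s - sup S|.
  by move=> se; apply: He; rewrite /ball/= distrC.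
have Sc : S (sup S).
  have [s [/andP[as_ sb] Hs] cs] := sup_adherent e0 hS.
  have sc : s <= sup S by apply: ub_le_sup; [case: hS|split; rewrite ?as_].
  split; first by rewrite ac.
  have -> : f (sup S) - f a = - (f s - f (sup S)) + (f s - f a) by ring.
  rewrite (le_trans (ler_normD _ _))// normrN.
  have := Hc s; rewrite as_ sb ler0_norm ?subr_le0// opprB => /(_ _ isT).
  rewrite ltrBlDr -ltrBlDl => /(_ cs) h; rewrite (le_trans (lerD h Hs))//.
  by rewrite -mulrDr; have -> : sup S - s + (s - a) = sup S - a by ring.
have [<-|cb'] := eqVneq (sup S) b; first by case: Sc.
have {cb' cb}cb : sup S < b by rewrite lt_neqAle cb'.
pose t := Num.min b (sup S + e / 2).
have ct : sup S < t by rewrite lt_min cb ltrDl divr_gt0.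
suff St : S t.
  by have := ub_le_sup (proj2 hS) St; rewrite leNgt ct.
have tb : a <= t <= b by rewrite (le_trans ac (ltW ct)) ge_min lexx.
split => //.
have -> : f t - f a = (f t - f (sup S)) + (f (sup S) - f a) by ring.
rewrite (le_trans (ler_normD _ _))//.
have := Hc t; rewrite gtr0_norm ?subr_gt0// => /(_ _ tb) h.
have {}h : `|f t - f (sup S)| <= L * (t - sup S).
  by apply: h; rewrite ltrBlDl gt_min orbC ltrD2l ltr_pdivrMr// ltr_pMr// ltr1n.
case: Sc => _ h'; rewrite (le_trans (lerD h h'))// -mulrDr.
by have -> : t - sup S + (sup S - a) = t - a by ring.
Qed.

Lemma derivable_local_bound (f : R -> R) (t e : R) : 0 < e -> derivable f t 1 ->
  \forall s \near t, `|f s - f t| <= (`|'D_1 f t| + e) * `|s - t|.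
Proof.
move=> e0 df.
have /cvgrPdist_lt/(_ _ e0) : (fun h : R =>
  h^-1 *: ((f \o shift t) (h *: 1) - f t)) h @[h --> 0^'] --> 'D_1 f t.
  exact: df.
move=> /nbhs_ballP[r /= r0 Hr]; apply/nbhs_ballP; exists r => //= s ts.
have [->|st] := eqVneq s t; first by rewrite !subrr !normr0 mulr0.
have st0 : s - t != 0 by rewrite subr_eq0.
have := Hr (s - t); rewrite /ball/= sub0r normrN distrC => /(_ ts st0).
rewrite [_ *: 1]mulr1 subrK => h.
set q := (s - t)^-1 *: (f s - f t) in h.
have -> : f s - f t = q * (s - t) by rewrite /q [_ *: _]mulrC mulfVK.
rewrite normrM (distrC s t); apply: ler_wpM2r => //.
rewrite -[q](subKr ('D_1 f t)) (le_trans (ler_normB _ _))// lerD2l ltW//.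
Qed.

(** At each point of the segment only the pieces that contain it matter nearby, the
    others being closed. On each of these the increment of [w] from the point is
    one of a differentiable function, so that it is locally bounded by the
    derivative up to an arbitrarily small error. *)
Lemma le_increment_piecewise (V : normedModType R) (E : finType) (A : E -> set V)
    (g : E -> V -> R) (w : V -> R) (y u : V) (M t : R) :
  (forall k, closed (A k)) -> (forall k z, A k z -> w z = g k z) ->
  (forall k z, A k z -> derivable (g k) z u /\ `|'D_u (g k) z| <= M) ->
  0 <= t -> (forall s, 0 <= s <= t -> exists k, A k (y + s *: u)) ->
  `|w (y + t *: u) - w y| <= M * t.
Proof.
move=> cA wg dg t0 At; apply/ler_addgt0Pr => e e0.
have [->|tn0] := eqVneq t 0; first by rewrite scale0r addr0 subrr normr0 mulr0 add0r ltW.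
have tgt : 0 < t by rewrite lt_neqAle eq_sym tn0.
have -> : M * t + e = (M + e / t) * (t - 0) by rewrite subr0; field.
have := @le_increment_of_local (fun s => w (y + s *: u)) 0 t (M + e / t) t0.
rewrite scale0r addr0; apply => s0 s0t.
have cl : continuous (fun s : R => y + s *: u).
  by move=> s; apply: cvgD; [exact: cvg_cst|exact: cvgZr_tmp].
have H k : \forall s \near s0, A k (y + s *: u) ->
    `|w (y + s *: u) - w (y + s0 *: u)| <= (M + e / t) * `|s - s0|.
  have [As|nAs] := pselect (A k (y + s0 *: u)); last first.
    have oA : open (~` A k) by rewrite openC.
    have nA : \forall s \near s0, (~` A k) (y + s *: u).
      by apply: cl; exact: open_nbhs_nbhs.
    by apply: filterS nA => s nAs' /nAs'.
  have [dgk gM] := dg _ _ As.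
  have [dgl dgE] := line_is_derive dgk.
  have et : 0 < e / t by rewrite divr_gt0.
  have := derivable_local_bound et dgl; apply: filterS => s Hs As'.
  rewrite (wg _ _ As) (wg _ _ As') (le_trans Hs)// ler_wpM2r// lerD2r.
  by rewrite dgE.
apply: filterS (filter_forall _ H) => s Hs sin.
by have [k Ak] := At _ sin; exact: (Hs k).
Qed.

End lipschitz.

(** * Symmetry of second derivatives *)

Lemma dist_half (R : realFieldType) (p q z e : R) :
  `|p - z| < e / 2 -> `|q - z| < e / 2 -> `|p - q| <= e.
Proof.
move=> h1 h2; have -> : p - q = (p - z) - (q - z) by ring.
by rewrite (le_trans (ler_normB _ _))// (splitr e) lerD// ltW.
Qed.

Lemma cross_difference (R : zmodType) (p q a b : R) : p - q - (a - b) = p - a - (q - b).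
Proof. by rewrite !opprB addrACA [RHS]addrACA [- q + _]addrC [- a + _]addrC. Qed.

Section schwarz.
Context {R : realType} {V : normedModType R}.
Implicit Types (f : V -> R) (x y z u v : V).

Lemma is_derive_translate f y z u : derivable f (y + z) u ->
  is_derive y u (fun y' => f (y' + z)) ('D_u f (y + z)).
Proof.
move=> df.
have E : (fun h => h^-1 *: (((fun y' => f (y' + z)) \o shift y) (h *: u) - f (y + z)))
  = (fun h => h^-1 *: ((f \o shift (y + z)) (h *: u) - f (y + z))).
  by apply/funext => h /=; rewrite addrA.
by split; rewrite /derivable /derive E.
Qed.

(** The mean value theorem, applied first to the increment of [f] in direction [v]
    along [u], then to the derivative along [v]. *)
Lemma second_increment f x u v (t : R) : 0 < t ->
  (forall y, derivable f y u) -> (forall y, derivable ('D_u f) y v) ->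
  exists c c', [/\ 0 <= c <= t, 0 <= c' <= t &
   f (x + t *: u + t *: v) - f (x + t *: u) - (f (x + t *: v) - f x) =
     'D_v ('D_u f) (x + c *: u + c' *: v) * t ^+ 2].
Proof.
move=> t0 du dv.
pose F y := f (y + t *: v) - f y.
have dF y : is_derive y u F ('D_u f (y + t *: v) - 'D_u f y).
  apply: is_deriveB; last exact/derivableP.
  exact: is_derive_translate.
have [s _|c /andP[c0 ct]] := @line_mvt R V F x u 0 t t0; first by have [] := dF (x + s *: u).
rewrite scale0r addr0 subr0 derive_val => E1.
have [s _|c' /andP[c'0 c't]] := @line_mvt R V ('D_u f) (x + c *: u) v 0 t t0; first exact: dv.
rewrite scale0r addr0 subr0 => E2.
exists c, c'; split; rewrite ?ltW//.
by rewrite -/(F (x + t *: u)) -/(F x) E1 E2 expr2 mulrA.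
Qed.

(** The second increment is symmetric in [u] and [v]; both mixed derivatives take,
    at points close to [x], its value divided by [t ^+ 2]. *)
Lemma schwarz f u v :
  (forall y, derivable f y u) -> (forall y, derivable f y v) ->
  (forall y, derivable ('D_u f) y v) -> (forall y, derivable ('D_v f) y u) ->
  continuous ('D_v ('D_u f)) -> continuous ('D_u ('D_v f)) ->
  'D_v ('D_u f) = 'D_u ('D_v f).
Proof.
move=> du dv duv dvu cuv cvu; apply/funext => x; apply/eqP; rewrite -subr_eq0 -normr_le0.
apply/ler_addgt0Pr => e e0; rewrite add0r.
have e2 : 0 < e / 2 by rewrite divr_gt0.
have /cvgrPdist_lt/(_ _ e2)/nbhs_ballP[r1 /= r10 H1] := cuv x.
have /cvgrPdist_lt/(_ _ e2)/nbhs_ballP[r2 /= r20 H2] := cvu x.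
pose r := Num.min r1 r2; have r0 : 0 < r by rewrite lt_min r10.
(* All the points [x + a u + b v] with [a, b <= t] lie in the ball of radius [r]. *)
pose t := r / (`|u| + `|v| + 1).
have uv0 : 0 < `|u| + `|v| + 1 by rewrite ltr_wpDl// addr_ge0.
have t0 : 0 < t by rewrite divr_gt0.
have nearx (a b : R) (p q : V) : `|p| + `|q| = `|u| + `|v| -> 0 <= a <= t -> 0 <= b <= t ->
  ball x r (x + a *: p + b *: q).
  move=> pq /andP[a0 at_] /andP[b0 bt]; rewrite -ball_normE /ball_/= -addrA opprD addNKr normrN.
  rewrite (le_lt_trans (ler_normD _ _))// !normrZ (ger0_norm a0) (ger0_norm b0).
  rewrite (le_lt_trans (lerD (ler_wpM2r (normr_ge0 p) at_) (ler_wpM2r (normr_ge0 q) bt)))//.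
  by rewrite -mulrDr pq /t mulrAC ltr_pdivrMr// ltr_pM2l// ltrDl.
have [c [c' [cin c'in E]]] := second_increment x t0 du duv.
have [b [b' [bin b'in E']]] := second_increment x t0 dv dvu.
have EE : 'D_v ('D_u f) (x + c *: u + c' *: v) = 'D_u ('D_v f) (x + b *: v + b' *: u).
  apply: (@mulIf _ (t ^+ 2)); first by rewrite sqrf_eq0 gt_eqF.
  apply: (etrans (esym E)); apply: (etrans _ E').
  by rewrite [x + t *: v + _]addrAC; exact: cross_difference.
have rr1 : r <= r1 by rewrite ge_min lexx.
have rr2 : r <= r2 by rewrite ge_min lexx orbT.
have h1 := H1 _ (le_ball rr1 (nearx _ _ _ _ erefl cin c'in)).
have h2 := H2 _ (le_ball rr2 (nearx _ _ _ _ (addrC _ _) bin b'in)).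
rewrite -EE in h2.
exact: (dist_half h1 h2).
Qed.

End schwarz.

(** * Polynomials *)

Section polynomials.
Context {R : realType} {d : nat}.
Local Notation pt := 'rV[R]_d.
Implicit Types (f g : pt -> R) (x : pt).

Definition monomial (a : 'I_d -> nat) (x : pt) : R := \prod_i x ord0 i ^+ a i.

Lemma polynomial_leD k f g : polynomial_le k f -> polynomial_le k g ->
  polynomial_le k (fun x => f x + g x).
Proof.
move=> [c fE] [c' gE]; exists (fun a => c a + c' a) => x.
by rewrite fE gE -big_split/=; apply: eq_bigr => a _; rewrite mulrDl.
Qed.

Lemma polynomial_leZ k (a : R) f : polynomial_le k f -> polynomial_le k (fun x => a * f x).
Proof.
move=> [c fE]; exists (fun b => a * c b) => x.
by rewrite fE mulr_sumr; apply: eq_bigr => b _; rewrite mulrA.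
Qed.

Lemma polynomial_le0 k : polynomial_le k (fun _ : pt => 0 : R).
Proof. by exists (fun=> 0) => x; rewrite big1// => a _; rewrite mul0r. Qed.

Lemma polynomial_le_sum k (I : Type) (r : seq I) (P : pred I) (F : I -> pt -> R) :
  (forall i, P i -> polynomial_le k (F i)) ->
  polynomial_le k (fun x => \sum_(i <- r | P i) F i x).
Proof.
move=> HF; elim: r => [|i r IH].
  by under eq_fun do rewrite big_nil; exact: polynomial_le0.
under eq_fun do rewrite big_cons; case: (P i) (HF i) => [/(_ isT) Fi|_ //].
exact: polynomial_leD.
Qed.

Lemma polynomial_le_monomial k (a : 'I_d -> nat) : (\sum_i a i <= k)%N ->
  polynomial_le k (monomial a).
Proof.
move=> ak; have ai i : (a i < k.+1)%N.
  by rewrite ltnS (leq_trans _ ak)// (bigD1 i)//= leq_addr.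
pose a' : {ffun 'I_d -> 'I_k.+1} := [ffun i => inord (a i)].
have aE i : a' i = a i :> nat by rewrite ffunE inordK.
exists (fun b => (b == a')%:R) => x.
rewrite (bigD1 a')/=; last by rewrite (eq_bigr a) => // i _; rewrite aE.
rewrite eqxx mul1r [X in _ + X]big1 ?addr0; last by move=> b /andP[_ /negbTE ->]; rewrite mul0r.
by apply: eq_bigr => i _; rewrite aE.
Qed.

(** Turns a statement on polynomials into one on monomials, where the exponents are
    plain functions, free of the bound built into their finite type. *)
Lemma polynomial_ind k (P : (pt -> R) -> Prop) :
  P (fun _ => 0) -> (forall f g, P f -> P g -> P (fun x => f x + g x)) ->
  (forall (a : R) f, P f -> P (fun x => a * f x)) ->
  (forall a : 'I_d -> nat, (\sum_i a i <= k)%N -> P (monomial a)) ->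
  forall f, polynomial_le k f -> P f.
Proof.
move=> P0 PD PZ Pm f [c fE].
have -> : f = fun x => \sum_(a : {ffun 'I_d ->
  'I_k.+1} | (\sum_i a i <= k)%N) c a * monomial (fun i => a i) x.
  exact/funext.
elim: (index_enum _) => [|a r IH]; first by under eq_fun do rewrite big_nil.
under eq_fun do rewrite big_cons; case: (boolP (\sum_i a i <= k)%N) => [ak|_ //].
by apply: PD => //; apply: PZ; exact: Pm.
Qed.

Lemma differentiable_monomial a x : differentiable (monomial a) x.
Proof.
rewrite /monomial; elim: (index_enum _) => [|i r IH].
  by under eq_fun do rewrite big_nil; exact: differentiable_cst.
under eq_fun do rewrite big_cons.
apply: differentiableM => //.
elim: (a i) => [|n IHn]; first by under eq_fun do rewrite expr0; exact: differentiable_cst.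
under eq_fun do rewrite exprS.
by apply: differentiableM => //; exact: differentiable_coord.
Qed.

Lemma differentiable_polynomial k f x : polynomial_le k f -> differentiable f x.
Proof.
move: f; apply: polynomial_ind => [|f g|a f|a _]; first exact: differentiable_cst.
- exact: differentiableD.
- exact: differentiableZ.
- exact: differentiable_monomial.
Qed.

Lemma continuous_polynomial k f : polynomial_le k f -> continuous f.
Proof. by move=> pf x; apply: differentiable_continuous; exact: differentiable_polynomial pf. Qed.

Definition lower_exponent (a : 'I_d ->
  nat) (j : 'I_d) (i : 'I_d) : nat := if i == j then (a i).-1 else a i.

Lemma is_derive_monomial (a : 'I_d -> nat) (j : 'I_d) x :
  is_derive x (delta_mx 0 j : pt) (monomial a) ((a j)%:R * monomial (lower_exponent a j) x).
Proof.
pose C x : R := \prod_(i | i != j) x ord0 i ^+ a i.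
have -> : monomial a = ((fun x : pt => x ord0 j) ^+ a j) * C.
  by apply/funext => y; rewrite /monomial (bigD1 j)//= !fctE.
have -> : monomial (lower_exponent a j) x = x ord0 j ^+ (a j).-1 * C x.
  rewrite /monomial (bigD1 j)//= /lower_exponent eqxx; congr (_ * _).
  by apply: eq_bigr => i /negbTE ->.
have dC : is_derive x (delta_mx 0 j : pt) C 0.
  have E : (fun h : R => h^-1 *: ((C \o shift x) (h *: (delta_mx 0 j : pt)) - C x)) = cst 0.
    apply/funext => h /=; rewrite (_ : C _ = C x) ?subrr ?scaler0//.
    by apply: eq_bigr => i ij; rewrite !mxE eqxx (negbTE ij) mulr0 add0r.
  split; first by rewrite /derivable E; exact: is_cvg_cst.
  by rewrite /derive E; exact: lim_cst.
have dx : is_derive x (delta_mx 0 j : pt) (fun x : pt => x ord0 j) 1.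
  have dj := @differentiable_coord R 1 d x ord0 j.
  have E : (fun h : R => h^-1 *: (((fun x : pt =>
    x ord0 j) \o shift x) (h *: (delta_mx 0 j : pt)) - x ord0 j)) =
     fun h => h^-1 * h.
    by apply/funext => h /=; rewrite !mxE !eqxx mulr1 addrK.
  have cE : (fun h : R => h^-1 * h) @ 0^' --> (1 : R).
    apply: cvg_near_cst; near=> h.
    by rewrite mulVf//; near: h; exact: nbhs_dnbhs_neq.
  split; first by rewrite /derivable E; exact: cvgP cE.
  by rewrite /derive E; exact: cvg_lim cE.
have := is_deriveM (is_deriveX (a j) dx) dC.
rewrite scaler0 add0r => h.
apply: is_derive_eq h _.
by rewrite [_%:A]mulr1 [LHS]mulrC mulrA.
Unshelve. all: by end_near. Qed.

Lemma polynomial_le_derive k f (j : 'I_d) : polynomial_le k.+1 f ->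
  polynomial_le k ('D_(delta_mx 0 j) f).
Proof.
move=> pf; have df x : derivable f x (delta_mx 0 j).
  by apply: diff_derivable; exact: differentiable_polynomial pf.
suff : polynomial_le k ('D_(delta_mx 0 j) f) /\ polynomial_le k.+1 f by case.
have H : forall g, polynomial_le k.+1 g ->
  polynomial_le k ('D_(delta_mx 0 j) g) /\ polynomial_le k.+1 g.
  apply: polynomial_ind => [|g h [pg g2] [ph h2]|a g [pg g2]|a ak].
  - split; last exact: polynomial_le0.
    by rewrite (_ : 'D_ _ _ = fun=> 0); [exact: polynomial_le0|apply/funext => x;
      rewrite derive_cst].
  - split; last exact: polynomial_leD.
    rewrite (_ : 'D_ _ _ = fun x => 'D_(delta_mx 0 j) g x + 'D_(delta_mx 0 j) h x);
      first exact: polynomial_leD.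
    by apply/funext => x; rewrite (deriveD (f := g) (g := h))//; apply: diff_derivable;
      [exact: differentiable_polynomial g2|exact: differentiable_polynomial h2].
  - split; last exact: polynomial_leZ.
    rewrite (_ : 'D_ _ _ = fun x => a * 'D_(delta_mx 0 j) g x); first exact: polynomial_leZ.
    by apply/funext => x; rewrite (deriveZ (f := g))//; apply: diff_derivable;
      exact: differentiable_polynomial g2.
  - split; last exact: polynomial_le_monomial.
    rewrite (_ : 'D_ _ _ = fun x => (a j)%:R * monomial (lower_exponent a j) x); last first.
      by apply/funext => x; have h := is_derive_monomial a j x; rewrite derive_val.
    have [aj0|aj0] := posnP (a j).
      rewrite aj0; under eq_fun do rewrite mul0r; exact: polynomial_le0.
    apply: polynomial_leZ; apply: polynomial_le_monomial.
    rewrite -ltnS (leq_trans _ ak)// (bigD1 j)//= [X in (_ < X)%N](bigD1 j)//= /lower_exponent eqxx.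
    rewrite -addSn prednK// leq_add2l leq_eqVlt; apply/orP; left; apply/eqP.
    by apply: eq_bigr => i /negbTE ->.
exact: H.
Qed.

(** An affine function is determined by its values at the vertices. *)
Lemma polynomial_bary f : polynomial_le 1 f ->
  forall x, f x = \sum_a bary a x * f (ref_vertex a).
Proof.
move=> pf x; move: f pf; apply: polynomial_ind => [|f g -> ->|c f ->|a a1].
- by rewrite big1// => a _; rewrite mulr0.
- by rewrite -big_split/=; apply: eq_bigr => a _; rewrite mulrDr.
- by rewrite mulr_sumr; apply: eq_bigr => a _; rewrite mulrCA.
have bl i : bary (lift ord0 i) x = x ord0 i by rewrite /bary liftK.
have b0 : bary ord0 x = 1 - \sum_i x ord0 i by rewrite /bary unlift_none.
have [j aj|a0] := pickP (fun j => a j != 0%N).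
  have aE i : a i = (i == j).
    move: a1; rewrite (bigD1 j)//=; have [->|ij] := eqVneq i j.
      by move: aj; case: (a j) => [//|[//|n]]; rewrite addSn.
    rewrite (bigD1 i)//=; move: aj; case: (a j) => [//|n] _; rewrite addSn ltnS leqn0 !addn_eq0.
    by case/andP => _ /andP[/eqP -> _].
  have mE y : monomial a y = y ord0 j.
    rewrite /monomial (bigD1 j)//= aE eqxx expr1 big1 ?mulr1// => i ij.
    by rewrite aE (negbTE ij) expr0.
  rewrite mE big_ord_recl mE mxE /= mulr0 add0r (bigD1 j)//= mE mxE eqxx mulr1 bl big1 ?addr0//
    => i ij.
  by rewrite mE mxE (inj_eq lift_inj) (negbTE ij) mulr0.
have mE y : monomial a y = 1.
  by rewrite /monomial big1// => i _; have := a0 i => /negbFE/eqP ->.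
rewrite mE big_ord_recl mE mulr1 b0.
rewrite [X in _ = _ + X](eq_bigr (fun i => x ord0 i)) ?subrK// => i _.
by rewrite mE mulr1 bl.
Qed.

End polynomials.

(** * Curved simplices *)

Section geometry.
Context {R : realType} {d : nat}.
Local Notation pt := 'rV[R]_d.

(** A diffeomorphism of [A] with its inverse [G] and the two open sets spelled out,
    so that [F] is invertible on both sides of the boundary of [A]. *)
Record inverse_pair (A : set pt) (F G : pt -> pt) (U W : set pt) : Prop := {
  ip_openU : open U;
  ip_openW : open W;
  ip_sub : A `<=` U;
  ip_F : forall x, U x -> W (F x);
  ip_G : forall y, W y -> U (G y);
  ip_FK : forall x, U x -> G (F x) = x;
  ip_GK : forall y, W y -> F (G y) = y;
  ip_C1F : C1 U F;
  ip_C1G : C1 W G }.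

Lemma diffeo_inverse_pair (A : set pt) (F : pt -> pt) : diffeo_on A F ->
  exists G U W, inverse_pair A F G U W.
Proof.
move=> [U [W [G [[oU oW] AU FU FK [CF CG]]]]]; exists G, U, W; split => //.
- by move=> x Ux; rewrite -FU; exists x.
- by move=> y; rewrite -FU => -[x Ux <-]; rewrite FK.
- by move=> y; rewrite -FU => -[x Ux <-]; rewrite FK.
Qed.

Lemma mulmx_delta_inj (B : 'M[R]_d) : (forall v : pt, v *m B = v) -> B = 1%:M.
Proof. by move=> H; apply/row_matrixP => i; rewrite !rowE H mulmx1. Qed.

Section pair.
Context (A : set pt) (F G : pt -> pt) (U W : set pt) (ip : inverse_pair A F G U W).

Lemma ip_diffF x : U x -> differentiable F x.
Proof. by move=> Ux; have [] := ip_C1F ip Ux. Qed.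

Lemma ip_diffG y : W y -> differentiable G y.
Proof. by move=> Wy; have [] := ip_C1G ip Wy. Qed.

Lemma ip_contF x : U x -> {for x, continuous F}.
Proof. by move=> Ux; apply: differentiable_continuous; exact: ip_diffF. Qed.

Lemma ip_contG y : W y -> {for y, continuous G}.
Proof. by move=> Wy; apply: differentiable_continuous; exact: ip_diffG. Qed.

Lemma jacobian_inverse x : U x -> 'J F x *m 'J G (F x) = 1%:M.
Proof.
move=> Ux; apply: mulmx_delta_inj => v.
have dF := ip_diffF Ux; have dG := ip_diffG (ip_F ip Ux).
rewrite mulmxA -!deriveEjacobian// !deriveE//.
have dGF := diff_comp dF dG.
have /= dGFv := congr1 (fun h => h v) dGF.
rewrite -dGFv.
rewrite -deriveE; last exact: differentiable_comp.
have nx : \forall y \near x, (G \o F) y = id y.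
  by apply: filterS (open_nbhs_nbhs (conj (ip_openU ip) Ux)) => y; exact: (ip_FK ip).
by rewrite (near_eq_derive v nx) derive_id.
Qed.

Lemma jacobian_inverse' x : U x -> 'J G (F x) *m 'J F x = 1%:M.
Proof. by move=> Ux; apply: mulmx1C; exact: jacobian_inverse. Qed.

Lemma ip_image_open (B : set pt) : open B -> B `<=` U -> open (F @` B).
Proof.
move=> oB BU; rewrite openE => _ [x Bx <-].
have Wx := ip_F ip (BU _ Bx).
have nB : \forall y \near F x, B (G y).
  have cG : G @ F x --> G (F x) := ip_contG Wx.
  by apply: cG; rewrite (ip_FK ip (BU _ Bx)); exact: open_nbhs_nbhs.
have nW : \forall y \near F x, W y by apply: open_nbhs_nbhs; split => //; exact: (ip_openW ip).
by near=> y; exists (G y); [near: y|apply: (ip_GK ip); near: y].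
Unshelve. all: by end_near. Qed.

Lemma ip_image (B : set pt) y : B `<=` U -> (F @` B) y <-> W y /\ B (G y).
Proof.
move=> BU; split => [[x Bx <-]|[Wy BG]]; last by exists (G y) => //; exact: (ip_GK ip).
by split; [exact/(ip_F ip)/BU|rewrite (ip_FK ip)//; exact: BU].
Qed.

Lemma ip_compact (B : set pt) : compact B -> B `<=` U -> compact (F @` B).
Proof.
move=> cB BU; apply: continuous_compact => //; apply: continuous_in_subspaceT => x.
by rewrite inE => /BU; exact: ip_contF.
Qed.

(** In the row convention the chain rule multiplies the direction by the Jacobian
    matrix on the right. *)
Lemma derive_pullback (p : pt -> R) y v : W y -> differentiable p (G y) ->
  is_derive y v (p \o G) ('D_(v *m 'J G y) p (G y)).
Proof.
move=> Wy dp; have dG := ip_diffG Wy.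
have dpG : differentiable (p \o G) y by exact: differentiable_comp.
split; first exact: diff_derivable.
have dpG' := diff_comp dG dp.
by rewrite deriveE// dpG' -deriveEjacobian// !deriveE.
Qed.

End pair.

Lemma derive_coord (p : pt -> R) x v : differentiable p x ->
  'D_v p x = \sum_i v ord0 i * 'D_(delta_mx 0 i) p x.
Proof.
move=> dp; rewrite deriveE// {1}(row_sum_delta v) linear_sum.
by apply: eq_bigr => i _; rewrite linearZ/= deriveE.
Qed.

Lemma jacobian_continuous_entry (F : pt -> pt) y i j :
  {for y, continuous (fun z => 'J F z)} -> {for y, continuous (fun z => 'J F z i j)}.
Proof.
move=> cJ; exact: (@continuous_comp _ _ _ (fun z => 'J F z) (fun M : 'M[R]_d =>
  M i j) y cJ (@coord_continuous _ _ _ _ _ _)).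
Qed.

Lemma cvg_rV (T : Type) (H : set_system T) {FH : Filter H} n (f : T -> 'rV[R]_n) (l : 'rV[R]_n) :
  (forall i, (fun t => f t ord0 i) @ H --> l ord0 i) -> f @ H --> l.
Proof.
move=> fl; apply/cvgrPdist_lt => e e0.
have H' : \forall t \near H, forall i, `|l ord0 i - f t ord0 i| < e.
  by apply: filter_forall => i; exact: ((cvgrPdist_lt _ _).1 (fl i)).
apply: filterS H' => t Ht.
rewrite [X in X < _]mx_normrE; apply: bigmax_lt => // -[i j] _ /=.
by rewrite (ord1 i) !mxE.
Qed.

Lemma cvg_rV_coord (T : Type) (H : set_system T) {FH : Filter H} n (f : T ->
  'rV[R]_n) (l : 'rV[R]_n) i :
  f @ H --> l -> (fun t => f t ord0 i) @ H --> l ord0 i.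
Proof.
move=> fl.
exact: (@cvg_comp _ _ _ f (fun v : 'rV[R]_n =>
  v ord0 i) H (nbhs l) (nbhs (l ord0 i)) fl (@coord_continuous _ _ _ _ _ _)).
Qed.

Lemma polynomial_le_coord (i : 'I_d) : polynomial_le 1 (fun x : pt => x ord0 i).
Proof.
have -> : (fun x : pt => x ord0 i) = monomial (fun j => j == i : nat).
  apply/funext => y; rewrite /monomial (bigD1 i)//= eqxx expr1 big1 ?mulr1// => j /negbTE ->.
  by rewrite expr0.
by apply: polynomial_le_monomial; rewrite (bigD1 i)//= eqxx big1// => j /negbTE ->.
Qed.

Lemma polynomial_le_bary (a : 'I_d.+1) : polynomial_le 1 (@bary R d a).
Proof.
rewrite /bary; case: (unlift ord0 a) => [i|]; first exact: polynomial_le_coord.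
have -> : (fun x : pt => 1 - \sum_i x ord0 i) =
    (fun x => monomial (fun=> 0%N) x + -1 * \sum_i x ord0 i).
  by apply/funext => x; rewrite mulN1r /monomial [X in _ = X - _]big1.
apply: polynomial_leD; first by apply: polynomial_le_monomial; rewrite big1.
by apply: polynomial_leZ; apply: polynomial_le_sum => i _; exact: polynomial_le_coord.
Qed.

Lemma continuous_bary (a : 'I_d.+1) : continuous (@bary R d a).
Proof. exact: continuous_polynomial (polynomial_le_bary a). Qed.

Lemma ref_interior_open : open (@ref_interior R d).
Proof.
rewrite openE => x Hx.
have H a : \forall y \near x, 0 < bary a y.
  have cb : bary a @ x --> bary a x  := @continuous_bary a x.
  have b0 : `]0, +oo[%classic (bary a x) by rewrite /= in_itv/= Hx.
  have nb : nbhs (bary a x) [set z | 0 < z].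
    have := open_nbhs_nbhs (conj (interval_open (a := BRight 0) (b := BInfty R false) isT isT) b0).
    by apply: filterS => z /=; rewrite in_itv/= andbT.
  exact: (cb _ nb).
by apply: filterS (filter_forall _ H).
Qed.

Lemma ref_interior_sub : @ref_interior R d `<=` ref_simplex.
Proof. by move=> x H a; exact/ltW/H. Qed.

Lemma ref_simplex_compact : compact (@ref_simplex R d).
Proof.
apply: bounded_closed_compact.
  exists 1; split; first exact: num_real.
  move=> M M1 x Hx; apply: (le_trans _ (ltW M1)).
  rewrite [leLHS]mx_normrE; apply: bigmax_le => // -[i j] _ /=; rewrite (ord1 i).
  have h k : 0 <= x ord0 k by have := Hx (lift ord0 k); rewrite /bary liftK.
  have := Hx ord0; rewrite /bary unlift_none subr_ge0 (bigD1 j)//= ger0_norm//.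
  by apply: le_trans; rewrite lerDl sumr_ge0.
have -> : @ref_simplex R d = \bigcap_(a in [set: 'I_d.+1]) (bary a @^-1` `[0, +oo[).
  by apply/seteqP; split => x /= H a; [move=> _|have := H a Logic.I];
    rewrite /= in_itv/= ?andbT//; apply: H.
apply: closed_bigI => a _; apply: preimage_closed; first by move=> x _; exact: continuous_bary.
exact: interval_closed.
Qed.

End geometry.

(** * Fields in the plane and in space *)

Section planes.
Context {R : realType} {d : nat} (d3 : (d <= 3)%N).

Lemma inplaneE (u : 'rV[R]_3) (j : 'I_d) : inplane d u ord0 j = u ord0 (widen_ord d3 j).
Proof.
rewrite mxE (bigD1 (widen_ord d3 j))//= mxE /= eqxx (ltn_ord j) mulr1 big1 ?addr0// => i ij.
by rewrite mxE (_ : (i == j :> nat) = false) ?mulr0//; apply/negbTE.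
Qed.

Lemma lift3E (u : 'rV[R]_d) (j : 'I_d) : lift3 u ord0 (widen_ord d3 j) = u ord0 j.
Proof.
rewrite mxE (bigD1 j)//= mxE /= eqxx (ltn_ord j) mulr1 big1 ?addr0// => i ij.
by rewrite mxE (_ : (i == j :> nat) = false) ?mulr0//; apply/negbTE.
Qed.

Lemma lift3_ge (u : 'rV[R]_d) (i : 'I_3) : (d <= i)%N -> lift3 u ord0 i = 0.
Proof.
move=> di; rewrite mxE big1// => j _.
by rewrite mxE (_ : (j == i :> nat) = false) ?mulr0//; apply/negbTE;
  rewrite neq_ltn (leq_trans (ltn_ord j) di).
Qed.

Lemma ord3_cases (i : 'I_3) : (exists j : 'I_d, i = widen_ord d3 j) \/ (d <= i)%N.
Proof.
have [id|di] := ltnP i d; last by right.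
by left; exists (Ordinal id); exact: val_inj.
Qed.

Lemma lift3K (u : 'rV[R]_3) : (forall i : 'I_3, (d <= i)%N -> u ord0 i = 0) ->
  lift3 (inplane d u) = u.
Proof.
move=> u0; apply/rowP => i; have [[j ->]|di] := ord3_cases i.
  by rewrite lift3E inplaneE.
by rewrite lift3_ge// u0.
Qed.

End planes.

Lemma continuous_sub (R : realType) (S : topologicalType) (f g : S -> R) :
  continuous f -> continuous g -> continuous (fun y => f y - g y).
Proof. by move=> cf cg y; apply: cvgB; [exact: cf|exact: cg]. Qed.

(** * Linearity of the weak curl and of the discrete spaces *)

Section linear.
Context {R : realType} {d : nat} (Omega : set 'rV[R]_d).
Hypotheses (oO : open Omega) (bO : bounded_set Omega).
Local Notation pt := 'rV[R]_d.
Local Notation field := (pt -> 'rV[R]_3).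
Implicit Types (f g : field).

Lemma curl_continuous_coord (psi : field) : test_field Omega psi ->
  forall j i : 'I_3, continuous (partial i (fun y => psi y 0 j)).
Proof.
by move=> [Hpsi _] j i x; have [_ /(_ (\row_(l < d) (l == i :> nat)%:R))[_ [c _]]] := Hpsi j
  1%N; apply: c.
Qed.

(** Test fields and their curls are of this kind, which makes both sides of the
    definition of the weak curl linear in the field. *)
Lemma continuous_supported_inL2 f (C : set pt) : compact C ->
  (forall j, continuous (fun y => f y ord0 j)) -> (forall y, ~ C y -> f y = 0) ->
  inL2 Omega f.
Proof.
move=> cC cf f0.
have /choice[M HM] : forall j, exists M : R, 0 <= M /\ forall y, `|f y ord0 j| <= M.
  by move=> j; apply: (compact_bound cC (cf j)) => y /f0 ->; rewrite mxE.
apply: (bounded_inL2 oO bO (M := \sum_j M j * M j)).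
  apply: measurable_fun_rVP => j; apply: continuous_measurable_rV => // y _; exact: cf.
move=> y _; apply: ler_sum => j _; have [M0 HMj] := HM j.
by rewrite -[leLHS]ger0_norm -?expr2 ?sqr_ge0// normrX !expr2 ler_pM.
Qed.

Lemma test_field_inL2 psi : test_field Omega psi -> inL2 Omega psi.
Proof.
move=> [cpsi [C [cC _] psi0]]; apply: (continuous_supported_inL2 cC) => // j x.
by have [c _] := cpsi j 0%N; exact: c.
Qed.

Lemma curl_eq0 (psi : field) y : (forall j i, partial i (fun y => psi y 0 j) y = 0) ->
  curl psi y = 0.
Proof.
move=> H; apply/rowP => k; rewrite !mxE !H !subr0.
by case: k => -[|[|[|]]].
Qed.

Lemma curl_test_field_inL2 psi : test_field Omega psi -> inL2 Omega (curl psi).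
Proof.
move=> tpsi; have cp := curl_continuous_coord tpsi; case: tpsi => cpsi [C [cC _] psi0].
apply: (continuous_supported_inL2 cC) => [j|y nC].
  have cB (a b : 'I_3 * 'I_3) : continuous (fun y : pt => partial a.1 (fun y =>
    psi y 0 a.2) y - partial b.1 (fun y => psi y 0 b.2) y).
    exact: continuous_sub (cp a.2 a.1) (cp b.2 b.1).
  case: j => -[|[|[|//]]] ij.
  - by rewrite (_ : (fun y => _) = (fun y => partial 1 (fun y =>
    psi y 0 2%R) y - partial 2%R (fun y => psi y 0 1) y));
      [exact: (cB (1, 2%R) (2%R, 1))|apply/funext => y; rewrite mxE].
  - by rewrite (_ : (fun y => _) = (fun y => partial 2%R (fun y =>
    psi y 0 0) y - partial 0 (fun y => psi y 0 2%R) y));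
      [exact: (cB (2%R, 0) (0, 2%R))|apply/funext => y; rewrite mxE].
  - by rewrite (_ : (fun y => _) = (fun y => partial 0 (fun y =>
    psi y 0 1) y - partial 1 (fun y => psi y 0 0) y));
      [exact: (cB (0, 1) (1, 0))|apply/funext => y; rewrite mxE].
apply: curl_eq0 => j i; apply: (support_derive _ cC) => // z nCz.
by rewrite psi0// mxE.
Qed.

Lemma is_curlD f g cf cg : is_curl Omega f cf -> is_curl Omega g cg ->
  is_curl Omega (fun y => f y + g y) (fun y => cf y + cg y).
Proof.
move=> [f2 cf2 Hf] [g2 cg2 Hg]; split; [exact: inL2D|exact: inL2D|].
move=> psi tpsi; have p2 := test_field_inL2 tpsi; have cp2 := curl_test_field_inL2 tpsi.
by rewrite !ipL2Dl// Hf// Hg.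
Qed.

Lemma is_curlZ a f cf : is_curl Omega f cf ->
  is_curl Omega (fun y => a *: f y) (fun y => a *: cf y).
Proof.
move=> [f2 cf2 Hf]; split; [exact: inL2Z|exact: inL2Z|].
move=> psi tpsi; have p2 := test_field_inL2 tpsi; have cp2 := curl_test_field_inL2 tpsi.
by rewrite !ipL2Zl// Hf.
Qed.

End linear.

Section lagrange_spaces.
Context {R : realType} {d : nat} (Omega : set 'rV[R]_d) (E : finType) (T : E -> 'rV[R]_d ->
  'rV[R]_d).
Local Notation pt := 'rV[R]_d.

Lemma lagrangeD k (f g : pt -> R) : Defs.lagrange Omega T k f -> Defs.lagrange Omega T k g ->
  Defs.lagrange Omega T k (fun y => f y + g y).
Proof.
move=> [cf pf] [cg pg]; split; first by move=> y; apply: cvgD; [exact: cf|exact: cg].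
move=> K; have [p pp fE] := pf K; have [q pq gE] := pg K.
exists (fun y => p y + q y); first exact: polynomial_leD.
by move=> x Hx; rewrite fE// gE.
Qed.

Lemma lagrangeZ k (a : R) (f : pt -> R) : Defs.lagrange Omega T k f ->
  Defs.lagrange Omega T k (fun y => a * f y).
Proof.
move=> [cf pf]; split; first by move=> y; apply: cvgMl_tmp; exact: cf.
move=> K; have [p pp fE] := pf K.
exists (fun y => a * p y); first exact: polynomial_leZ.
by move=> x Hx; rewrite fE.
Qed.

Lemma lagrange0 k : Defs.lagrange Omega T k (fun _ => 0).
Proof.
split; first by move=> y; exact: cvg_cst.
by move=> K; exists (fun=> 0) => //; exact: polynomial_le0.
Qed.

Lemma lagrange_sum k (I : Type) (r : seq I) (F : I -> pt -> R) :
  (forall i, Defs.lagrange Omega T k (F i)) ->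
    Defs.lagrange Omega T k (fun y => \sum_(i <- r) F i y).
Proof.
move=> HF; elim: r => [|i r IH]; first by under eq_fun do rewrite big_nil; exact: lagrange0.
by under eq_fun do rewrite big_cons; exact: lagrangeD.
Qed.

End lagrange_spaces.

(** * Traces of discrete fields *)

Section pointwise_continuity.
Context {R : realType} {S : topologicalType}.

Lemma continuous_mulr (f g : S -> R) (y : S) :
  {for y, continuous f} -> {for y, continuous g} -> {for y, continuous (fun t => f t * g t)}.
Proof. by move=> cf cg; apply: cvgM. Qed.

Lemma continuous_sumr (I : Type) (r : seq I) (f : I -> S -> R) (y : S) :
  (forall i, {for y, continuous (f i)}) -> {for y, continuous (fun t => \sum_(i <- r) f i t)}.
Proof.
move=> cf.
suff H : (fun t => \sum_(i <- r) f i t) @ y --> \sum_(i <- r) f i y by exact: H.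
elim: r => [|i r IH].
  by rewrite big_nil; under eq_fun do rewrite big_nil; exact: cvg_cst.
by rewrite big_cons; under eq_fun do rewrite big_cons; apply: cvgD => //; exact: cf.
Qed.

(** Gives the trace, from a subset, of a function that has a continuous extension. *)
Lemma within_eq_cvg (B : set S) (f g : S -> R) (y : S) :
  {for y, continuous f} -> (forall z, B z -> g z = f z) ->
  g z @[z --> within B (nbhs y)] --> f y.
Proof.
move=> cf gf P /cf HP; have HP' : nbhs y [set z | P (f z)] := HP.
suff : nbhs y [set z | B z -> P (g z)] by exact.
by apply: filterS HP' => z h /gf ->.
Qed.

Lemma within_continuous_cvg (A B : set S) (f : S -> R) (y : S) :
  {within A, continuous f} -> A y -> B `<=` A ->
  f z @[z --> within B (nbhs y)] --> f y.
Proof.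
move=> cf Ay BA; have := cf y; rewrite /continuous_at /= => cfy.
have {cfy} : f @ (within A (nbhs y)) --> f y by rewrite (nbhs_subspace_in Ay).
move=> cfy P /cfy HP; have HP' : nbhs y [set z | A z -> P (f z)] := HP.
suff : nbhs y [set z | B z -> P (f z)] by exact.
by apply: filterS HP' => z h /BA/h.
Qed.

End pointwise_continuity.

Section traces.
Context {R : realType} {d : nat} (d3 : (d <= 3)%N).
Context (Omega : set 'rV[R]_d) (E : finType) (T : E -> 'rV[R]_d -> 'rV[R]_d).
Hypotheses (oO : open Omega) (bO : bounded_set Omega) (mesh : conforming_mesh Omega T).
Local Notation pt := 'rV[R]_d.
Local Notation field := (pt -> 'rV[R]_3).
Implicit Types (xi : field).

(** The pull-back by [G] of the covector field with components [q]: the covariant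
    (Piola) transform of the edge elements. *)
Definition covector (G : pt -> pt) (q : 'I_d -> pt -> R) (y : pt) : pt :=
  (\row_i q i (G y)) *m ('J G y)^T.

Lemma covectorE G q y j : covector G q y ord0 j = \sum_i q i (G y) * 'J G y j i.
Proof. by rewrite mxE; apply: eq_bigr => i _; rewrite !mxE. Qed.

Lemma continuous_covector A F G U W q : inverse_pair A F G U W ->
  (forall i, continuous (q i)) -> forall y j, W y ->
    {for y, continuous (fun z => covector G q z ord0 j)}.
Proof.
move=> ip cq y j Wy.
rewrite (_ : (fun t => _) = (fun t => \sum_i q i (G t) * 'J G t j i)); last first.
  by apply/funext => t; rewrite covectorE.
apply: continuous_sumr => i; apply: continuous_mulr.
  exact: (@continuous_comp _ _ _ G (q i) y (ip_contG ip Wy) (cq i _)).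
by apply: jacobian_continuous_entry; have [_] := ip_C1G ip Wy.
Qed.

Lemma mesh_sub k x : ref_simplex x -> closure Omega (T k x).
Proof. by move=> sx; rewrite (mesh_cover mesh); exists k => //; exists x. Qed.

Lemma covector_of_pullback A F G U W q (v : pt) x : inverse_pair A F G U W -> U x ->
  v *m ('J F x)^T = (\row_i q i x) -> v = covector G q (F x).
Proof.
move=> ip Ux E0; rewrite /covector (ip_FK ip Ux) -E0 -mulmxA -trmx_mul.
by rewrite (jacobian_inverse' ip Ux) trmx1 mulmx1.
Qed.

(** Multiplying the defining condition of the space by the inverse Jacobian shows
    that the field extends continuously beyond the element. *)
Lemma Hh_covector xi k G U W : Hh Omega T xi -> inverse_pair ref_simplex (T k) G U W ->
  exists2 q : 'I_d -> pt -> R, (forall i, polynomial_le 1 (q i)) &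
   forall y, (T k @` ref_interior) y -> inplane d (xi y) = covector G q y.
Proof.
move=> [_ pxi _] ip; have [p pp pE] := pxi k.
exists (fun i x => p x ord0 i) => // _ [x ix <-].
apply: (covector_of_pullback ip); first by apply: (ip_sub ip); exact: ref_interior_sub.
by rewrite pE//; apply/rowP => i; rewrite mxE.
Qed.

Lemma element_closure k : T k @` ref_interior `<=` closure Omega.
Proof. by move=> _ [x ix <-]; apply: mesh_sub; exact: ref_interior_sub. Qed.

(** The in-plane components extend continuously as a covector field, the other
    components are continuous on the closed domain. *)
Lemma Hh_trace xi k x : Hh Omega T xi -> (T k @` ref_simplex) x ->
  exists l : 'rV[R]_3, xi y @[y --> within (T k @` ref_interior) (nbhs x)] --> l.
Proof.
move=> Hxi sx; have [G [U [W ip]]] := diffeo_inverse_pair (mesh_diffeo mesh k).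
have [q pq qE] := Hh_covector Hxi ip; have [_ _ Hz] := Hxi.
have Wx : W x by have [] := (ip_image ip x (ip_sub ip)).1 sx.
have cc j : {for x, continuous (fun z => covector G q z ord0 j)}.
  by apply: (continuous_covector ip) => // i; exact: continuous_polynomial (pq i).
have FW : Filter (within (T k @` ref_interior) (nbhs x)) by exact: within_filter.
have /choice[l Hl] : forall i, exists l : R,
    xi y ord0 i @[y --> within (T k @` ref_interior) (nbhs x)] --> l.
  move=> i; have [[j ->]|di] := ord3_cases d3 i.
    exists (covector G q x ord0 j).
    by apply: (within_eq_cvg (cc j)) => y Ty; rewrite -qE// inplaneE.
  exists (xi x ord0 i); have [cz _] := Hz i di.
  apply: (within_continuous_cvg cz); last exact: element_closure.
  by case: sx => z sz <-; exact: mesh_sub.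
exists (\row_i l i); apply: cvg_rV => i; rewrite mxE; exact: Hl.
Qed.

(** A limit of the sum says something on the summands only because each of them has
    a limit of its own. *)
Lemma Hh0_trace_add xi eta : Hh0 Omega T xi -> Hh0 Omega T eta ->
  zero_tangential_trace Omega T (fun y => xi y + eta y).
Proof.
move=> [Hxi txi] [Heta teta] k a x n l fO fx xn Hl.
have sx : (T k @` ref_simplex) x by case: fx => z [sz _] <-; exists z.
have [l1 Hl1] := Hh_trace Hxi sx; have [l2 Hl2] := Hh_trace Heta sx.
have FW : Filter (within (T k @` ref_interior) (nbhs x)) by exact: within_filter.
(* For a trivial trace filter every vector is a limit, in particular of [xi]. *)
have [F0|nF0] := pselect (within (T k @` ref_interior) (nbhs x) set0).
  apply: (txi _ _ _ _ _ fO fx xn) => P _.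
  suff : within (T k @` ref_interior) (nbhs x) (xi @^-1` P) by exact.
  exact: (filterS (@sub0set _ _) F0).
have PF : ProperFilter (within (T k @` ref_interior) (nbhs x)) by [].
have Hs : (fun y => xi y + eta y) @ (within (T k @` ref_interior) (nbhs x)) --> l1 + l2.
  exact: (@cvgD _ _ _ _ FW _ _ _ _ Hl1 Hl2).
have -> : l = l1 + l2 by exact: (cvg_unique _ Hl Hs).
have h1 := txi _ _ _ _ _ fO fx xn Hl1; have h2 := teta _ _ _ _ _ fO fx xn Hl2.
rewrite -[RHS](addr0 0) -{1}h1 -h2; apply/rowP => i; rewrite !mxE.
by case: i => -[|[|[|]]]//= ?; ring.
Qed.

Lemma Hh0D xi eta : Hh0 Omega T xi -> Hh0 Omega T eta -> Hh0 Omega T (fun y => xi y + eta y).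
Proof.
move=> Hx He; split; last exact: Hh0_trace_add.
have [[[c cx] px zx] _] := Hx; have [[[c' ce] pe ze] _] := He; split.
- exists (fun y => c y + c' y).
  rewrite (_ : (fun x => _) = (fun y => lift3 (inplane d (xi y)) + lift3 (inplane d (eta y))));
    last first.
    by apply/funext => y; rewrite /inplane /lift3 !mulmxDl.
  exact: is_curlD.
- move=> k; have [p pp pE] := px k; have [q pq qE] := pe k.
  exists (fun x => p x + q x) => [j|x ix]; last by rewrite /inplane !mulmxDl pE// qE.
  by under eq_fun do rewrite mxE; exact: polynomial_leD.
- by move=> j dj; under eq_fun do rewrite mxE; apply: lagrangeD; [exact: zx|exact: ze].
Qed.

Lemma Hh0Z (b : R) xi : b != 0 -> Hh0 Omega T xi -> Hh0 Omega T (fun y => b *: xi y).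
Proof.
move=> b0 [[[c cx] px zx] tx]; split; first split.
- exists (fun y => b *: c y).
  rewrite (_ : (fun x => _) = (fun y => b *: lift3 (inplane d (xi y)))); last first.
    by apply/funext => y; rewrite /inplane /lift3 -!scalemxAl.
  exact: is_curlZ.
- move=> k; have [p pp pE] := px k.
  exists (fun x => b *: p x) => [j|x ix]; last by rewrite /inplane -!scalemxAl pE.
  by under eq_fun do rewrite mxE; exact: polynomial_leZ.
- by move=> j dj; under eq_fun do rewrite mxE; apply: lagrangeZ; exact: zx.
move=> k a x n l fO fx xn Hl.
have FW : Filter (within (T k @` ref_interior) (nbhs x)) by exact: within_filter.
have h : cross (b^-1 *: l) (lift3 n) = 0.
  apply: (tx _ _ _ _ _ fO fx xn).
  rewrite (_ : (fun y => xi y) = (fun y => b^-1 *: (b *: xi y))); first by apply: cvgZl_tmp.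
  by apply/funext => y; rewrite scalerA mulVf// scale1r.
rewrite -(scaler0 _ b) -h; apply/rowP => i; rewrite !mxE.
by case: i => -[|[|[|]]]//= ?; field.
Qed.

End traces.

(** * The mesh skeleton *)

Lemma negligible_fin_bigcup (disp : measure_display) (S : measurableType disp) (R : realType)
    (mu : {measure set S -> \bar R}) (I : finType) (F : I -> set S) :
  (forall i, mu.-negligible (F i)) -> mu.-negligible (\bigcup_(i in [set: I]) F i).
Proof.
move=> nF; have H : \bigcup_(i in [set: I]) F i `<=` \big[setU/set0]_i F i.
  by move=> y [i _ Fi]; rewrite (bigD1 i)//=; left.
apply: (negligibleS H); elim/big_ind : _ => //; first exact: negligible_set0.
by move=> *; exact: negligibleU.
Qed.

Lemma mulmx_entry (R : pzRingType) m n (u : 'rV[R]_m) (B : 'M[R]_(m, n)) i :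
  (u *m B) ord0 i = \sum_j u ord0 j * B j i.
Proof. by rewrite mxE. Qed.

Section skeleton.
Context {R : realType} {d : nat} (d0 : (0 < d)%N).
Context (Omega : set 'rV[R]_d) (E : finType) (T : E -> 'rV[R]_d -> 'rV[R]_d).
Hypothesis mesh : conforming_mesh Omega T.
Local Notation pt := 'rV[R]_d.
Local Notation mu := (lebesgue_rV d).

Lemma bary_derive (a : 'I_d.+1) (x v : pt) :
  'D_v (bary a) x = \sum_i v ord0 i * (if unlift ord0 a is Some j then (i == j)%:R else -1).
Proof.
have H (h : R) : h != 0 -> h^-1 *: (bary a (h *: v + x) - bary a x) =
   \sum_i v ord0 i * (if unlift ord0 a is Some j then (i == j)%:R else -1).
  move=> h0; rewrite /bary; case: (unlift ord0 a) => [j|].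
    rewrite !mxE addrK [LHS]mulKf// (bigD1 j)//= eqxx mulr1 big1 ?addr0// => i /negbTE ->.
    by rewrite mulr0.
  have -> : 1 - \sum_i (h *: v + x) ord0 i - (1 - \sum_i x ord0 i) = h * (\sum_i v ord0 i * -1).
    rewrite -mulr_suml mulrN1.
    have -> : \sum_i (h *: v + x) ord0 i = h * \sum_i v ord0 i + \sum_i x ord0 i.
      by rewrite mulr_sumr -big_split/=; apply: eq_bigr => i _; rewrite !mxE.
    ring.
  by rewrite [LHS]mulKf.
rewrite /derive; apply: cvg_lim => //; apply: cvg_near_cst; near=> h.
by apply: H; near: h; exact: nbhs_dnbhs_neq.
Unshelve. all: by end_near. Qed.

(** A barycentric coordinate is affine and not constant. *)
Lemma bary_transversal (a : 'I_d.+1) : exists v : pt, forall x, 'D_v (bary a) x != 0.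
Proof.
case E0 : (unlift ord0 a) => [j|].
  exists (delta_mx 0 j) => x; rewrite bary_derive E0 (bigD1 j)//= !mxE !eqxx mulr1 big1 ?addr0
    ?oner_neq0// => i ij.
  by rewrite mxE eqxx (negbTE ij) mul0r.
exists (delta_mx 0 (Ordinal d0)) => x;
  rewrite bary_derive E0 (bigD1 (Ordinal d0))//= !mxE !eqxx mul1r big1 ?addr0 ?oppr_eq0
    ?oner_neq0// => i ij.
by rewrite mxE eqxx (negbTE ij) mul0r.
Qed.

(** The face lies in the zero set of a barycentric coordinate pulled back by the
    inverse of the element map. The derivative of this function in a fixed
    direction is continuous, hence nonzero near a point where it is nonzero. *)
Lemma face_negligible k (a : 'I_d.+1) :
  mu.-negligible (T k @` [set x | ref_simplex x /\ bary a x = 0]).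
Proof.
have [G [U [W ip]]] := diffeo_inverse_pair (mesh_diffeo mesh k).
have sU := ip_sub ip.
apply: (@negligibleS _ _ _ _ ((T k @` ref_simplex) `&` [set y | (bary a \o G) y = 0])).
  move=> _ [x [sx bx] <-]; split; first by exists x.
  by rewrite /= (ip_FK ip)//; exact: sU.
apply: negligible_compact; first apply: (ip_compact ip) => //.
  exact: (@ref_simplex_compact R d).
move=> z /(ip_image ip _ sU)[Wz sz].
have [v Hv] := bary_transversal a.
pose u := v *m 'J (T k) (G z).
have df y : differentiable (bary a) y := differentiable_polynomial y (polynomial_le_bary a).
apply: (@negligible_level_set R d _ z u).
have DE y : W y -> is_derive y u (bary a \o G) ('D_(u *m 'J G y) (bary a) (G y)).
  by move=> Wy; apply: (derive_pullback ip).
pose c i : R := if unlift ord0 a is Some j then (i == j)%:R else -1.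
pose L (y : pt) : R := \sum_i (\sum_j u ord0 j * 'J G y j i) * c i.
have DL y x : 'D_(u *m 'J G y) (bary a) x = L y.
  rewrite bary_derive; apply: eq_bigr => i _.
  by congr (_ * _); exact: mulmx_entry.
have cL : {for z, continuous L}.
  apply: continuous_sumr => i; apply: continuous_mulr; last exact: cst_continuous.
  apply: continuous_sumr => j; apply: continuous_mulr; first exact: cst_continuous.
  by apply: jacobian_continuous_entry; have [_] := ip_C1G ip Wz.
have Lz : L z != 0.
  have := jacobian_inverse ip (ip_G ip Wz); rewrite (ip_GK ip Wz) => JJ.
  by rewrite -(DL z 0) /u -mulmxA JJ mulmx1; exact: Hv.
have nW : \forall y \near z, W y by apply: open_nbhs_nbhs; split => //; exact: (ip_openW ip).
have nD : \forall y \near z, L y != 0 by exact: (cvgr_neq0 _ cL).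
near=> y; have Wy : W y by near: y.
split.
- exact: (@continuous_comp _ _ _ G (bary a) y (ip_contG ip Wy) (@continuous_bary R d a _)).
- by have [] := DE y Wy.
- by have DEy := DE y Wy; rewrite derive_val DL; near: y.
Unshelve. all: by end_near. Qed.

Definition open_elements : set pt := \bigcup_k (T k @` ref_interior).

Lemma open_elements_open : open open_elements.
Proof.
apply: bigcup_open => k _; have [G [U [W ip]]] := diffeo_inverse_pair (mesh_diffeo mesh k).
apply: (ip_image_open ip); first exact: ref_interior_open.
by apply: subset_trans (ip_sub ip); exact: ref_interior_sub.
Qed.

(** A point of an element outside its open part has a zero barycentric
    coordinate. *)
Lemma skeleton_negligible : mu.-negligible (closure Omega `\` open_elements).
Proof.
apply: (@negligibleS _ _ _ _ (\bigcup_(p in [set: E * 'I_d.+1]) (T p.1 @` [set x | ref_simplex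
  x /\ bary p.2 x = 0]))).
  move=> y [cy nU]; move: cy; rewrite (mesh_cover mesh) => -[k _ [x sx xy]].
  have : ~ ref_interior x by move=> ix; apply: nU; exists k => //; exists x.
  move=> /existsNP[a /negP]; rewrite -leNgt => ba.
  exists (k, a) => //; exists x => //; split => //.
  by apply/eqP; rewrite eq_le ba /=; exact: sx.
by apply: negligible_fin_bigcup => p; exact: face_negligible.
Qed.

End skeleton.

(** * Weak derivatives of continuous piecewise smooth functions *)

Lemma continuous_near_eq (R : realType) (S : topologicalType) (f g : S -> R) (y : S) :
  (\forall z \near y, g z = f z) -> {for y, continuous f} -> {for y, continuous g}.
Proof.
move=> gf cf P; rewrite (nbhs_singleton gf) => /cf HP.
have HP' : nbhs y [set z | P (f z)] := HP.
suff : nbhs y [set z | P (g z)] by exact.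
by apply: filterS2 gf HP' => z E1 H; move: H; rewrite /= E1.
Qed.

Section closed_domain.
Context {R : realType} {d : nat} (Omega : set 'rV[R]_d).
Hypotheses (oO : open Omega) (bO : bounded_set Omega).
Local Notation pt := 'rV[R]_d.
Context (w : pt -> R) (cw : {within closure Omega, continuous w}).

Lemma continuous_domain y : Omega y -> {for y, continuous w}.
Proof.
move=> Oy; have cwO : {within Omega, continuous w} by apply: continuous_subspaceW cw;
  exact: subset_closure.
by move: cwO; rewrite (continuous_open_subspace _ oO) => /(_ y); rewrite inE; apply.
Qed.

Lemma closure_compact : compact (closure Omega).
Proof.
apply: bounded_closed_compact; last exact: closed_closure.
have [M [_ HM]] := bO; exists (M + 1); split; first exact: num_real.
move=> N MN y cy.
have M1 : M < M + 1 by rewrite ltrDl.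
suff : closure Omega `<=` [set z : pt | `|z| <= N] by exact.
rewrite closureE; apply: smallest_sub.
  rewrite (_ : [set _ | _] = (fun z : pt => `|z|) @^-1` `]-oo, N]); last first.
    by apply/seteqP; split => z /=; rewrite in_itv.
  apply: preimage_closed; last exact: interval_closed.
  by move=> z _; exact: norm_continuous.
by move=> z Oz; apply: (HM N) => //; exact: lt_trans MN.
Qed.

Lemma closure_bounded : exists M : R, forall y, Omega y -> `|w y| <= M.
Proof.
have /compact_bounded[M [_ HM]] : compact (w @` closure Omega).
  by apply: continuous_compact => //; exact: closure_compact.
exists (M + 1) => y Oy; apply: (HM (M + 1)); first by rewrite ltrDl.
by exists y => //; exact: subset_closure.
Qed.

End closed_domain.

Section piecewise.
Context {R : realType} {d : nat} (d0 : (0 < d)%N).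
Context (Omega : set 'rV[R]_d) (E : finType) (T : E -> 'rV[R]_d -> 'rV[R]_d).
Hypotheses (oO : open Omega) (bO : bounded_set Omega) (mesh : conforming_mesh Omega T).
Local Notation pt := 'rV[R]_d.
Local Notation mu := (lebesgue_rV d).
Context (w : pt -> R) (wP : Ph Omega T w).

(** The derivative of [p \o G] in direction [u] when [q] is the gradient of [p],
    as a formula that is continuous beyond the element. *)
Definition pull_derive (G : pt -> pt) (q : 'I_d -> pt -> R) (u y : pt) : R :=
  \sum_j u ord0 j * covector G q y ord0 j.

Lemma pull_deriveE A F G U W p y u : inverse_pair A F G U W -> W y -> polynomial_le 2 p ->
  is_derive y u (p \o G) (pull_derive G (fun i => 'D_(delta_mx 0 i) p) u y).
Proof.
move=> ip Wy pp; have dp := differentiable_polynomial (G y) pp.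
have H := derive_pullback ip u Wy dp.
apply: (is_derive_eq H); rewrite (derive_coord _ dp) /pull_derive.
transitivity (\sum_i \sum_j u ord0 j * 'J G y j i * 'D_(delta_mx 0 i) p (G y)).
  apply: eq_bigr => i _; rewrite -mulr_suml; congr (_ * _); exact: mulmx_entry.
rewrite exchange_big/=; apply: eq_bigr => j _; rewrite covectorE mulr_sumr.
by apply: eq_bigr => i _; rewrite -mulrA [X in _ * X]mulrC.
Qed.

Lemma continuous_pull_derive A F G U W p u y : inverse_pair A F G U W -> W y -> polynomial_le 2 p ->
  {for y, continuous (pull_derive G (fun i => 'D_(delta_mx 0 i) p) u)}.
Proof.
move=> ip Wy pp; apply: continuous_sumr => j; apply: continuous_mulr; first exact: cst_continuous.
apply: (continuous_covector ip) => // i; apply: (@continuous_polynomial _ _ 1).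
exact: polynomial_le_derive.
Qed.

Lemma element_data k : exists G U W p, [/\ inverse_pair ref_simplex (T k) G U W,
  polynomial_le 2 p & forall x, ref_simplex x -> w (T k x) = p x].
Proof.
have [G [U [W ip]]] := diffeo_inverse_pair (mesh_diffeo mesh k).
by have [_ /(_ k)[p pp pE]] := wP; exists G, U, W, p.
Qed.

Lemma element_value k G U W p y : inverse_pair ref_simplex (T k) G U W ->
  (forall x, ref_simplex x -> w (T k x) = p x) -> (T k @` ref_simplex) y -> w y = p (G y).
Proof. by move=> ip pE [x sx <-]; rewrite pE// (ip_FK ip)//; exact: (ip_sub ip). Qed.

(** On the open set covered by the open element, [w] is [p \o G]. *)
Lemma interior_derive k G U W p y u : inverse_pair ref_simplex (T k) G U W ->
  polynomial_le 2 p -> (forall x, ref_simplex x -> w (T k x) = p x) ->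
  (T k @` ref_interior) y -> is_derive y u w (pull_derive G (fun i => 'D_(delta_mx 0 i) p) u y).
Proof.
move=> ip pp pE iy.
have sU := ip_sub ip; have iU := subset_trans (@ref_interior_sub R d) sU.
have Wy : W y by have [] := (ip_image ip y iU).1 iy.
apply: near_eq_is_derive (pull_deriveE u ip Wy pp).
have oi := ip_image_open ip ref_interior_open iU.
apply: filterS (open_nbhs_nbhs (conj oi iy)) => z [x ix xz].
by rewrite (element_value ip pE)//; exists x => //; exact: ref_interior_sub.
Qed.

Lemma pull_derive_bound k G U W p u : inverse_pair ref_simplex (T k) G U W -> polynomial_le 2 p ->
  exists M : R, forall y, (T k @` ref_simplex) y ->
    `|pull_derive G (fun i => 'D_(delta_mx 0 i) p) u y| <= M.
Proof.
move=> ip pp; set f := pull_derive _ _ _.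
have /compact_bounded[M [_ HM]] : compact (f @` (T k @` ref_simplex)).
  apply: continuous_compact; last first.
    by apply: (ip_compact ip); [exact: ref_simplex_compact|exact: (ip_sub ip)].
  apply: continuous_in_subspaceT => y; rewrite inE => sy.
  have Wy : W y by have [] := (ip_image ip y (ip_sub ip)).1 sy.
  exact: (continuous_pull_derive (u := u) ip Wy pp).
exists (M + 1) => y sy; apply: (HM (M + 1)); first by rewrite ltrDl.
by exists y.
Qed.

(** Along the axes these are the components of [grad_h]. *)
Definition elementwise_derive (u : pt) : pt -> R := 'D_u w \_ (open_elements T).

Lemma elementwise_deriveE u y : open_elements T y -> elementwise_derive u y = 'D_u w y.
Proof. by move=> oy; rewrite /elementwise_derive patchE mem_set. Qed.

Lemma elementwise_derive0 u y : ~ open_elements T y -> elementwise_derive u y = 0.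
Proof. by move=> oy; rewrite /elementwise_derive patchE memNset. Qed.

Lemma derivable_open_elements u y : open_elements T y -> derivable w y u.
Proof.
move=> [k _ iy]; have [G [U [W [p [ip pp pE]]]]] := element_data k.
by have [] := interior_derive u ip pp pE iy.
Qed.

Lemma elementwise_derive_bounded u : exists2 M :
  R, 0 <= M & forall y, `|elementwise_derive u y| <= M.
Proof.
have /choice[M HM] : forall k, exists M : R, forall y, (T k @` ref_interior) y -> `|'D_u w y| <= M.
  move=> k; have [G [U [W [p [ip pp pE]]]]] := element_data k.
  have [M HM] := pull_derive_bound u ip pp; exists M => y iy.
  have dw := interior_derive u ip pp pE iy; rewrite derive_val; apply: HM.
  by case: iy => x ix <-; exists x => //; exact: ref_interior_sub.
exists (\sum_k `|M k|) => [|y]; first by apply: sumr_ge0.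
have [oy|noy] := pselect (open_elements T y); last first.
  by rewrite elementwise_derive0// normr0 sumr_ge0.
rewrite elementwise_deriveE//; have [k _ iy] := oy.
rewrite (le_trans (HM k _ iy))// (le_trans (ler_norm _))// (bigD1 k)//= lerDl.
exact: sumr_ge0.
Qed.

Lemma elementwise_derive_measurable u : measurable_fun setT (elementwise_derive u).
Proof.
have oU := open_elements_open mesh.
apply/(measurable_restrictT _ (measurable_open_rV oU)).
apply: continuous_measurable_rV => // y [k _ iy].
have [G [U [W [p [ip pp pE]]]]] := element_data k.
have iU := subset_trans (@ref_interior_sub R d) (ip_sub ip).
have Wy : W y by have [] := (ip_image ip y iU).1 iy.
have cf := continuous_pull_derive (u := u) ip Wy pp.
have oi := ip_image_open ip ref_interior_open iU.
have E1 : \forall z \near y, 'D_u w z = pull_derive G (fun i => 'D_(delta_mx 0 i) p) u z.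
  apply: filterS (open_nbhs_nbhs (conj oi iy)) => z iz.
  by have dw := interior_derive u ip pp pE iz; rewrite derive_val.
exact: (continuous_near_eq E1 cf).
Qed.

(** The bounds of the derivative on the compact elements are uniform, and there are
    finitely many elements. *)
Lemma Ph_lipschitz u : exists M : R, forall y t, 0 <= t ->
  (forall s, 0 <= s <= t -> Omega (y + s *: u)) -> `|w (y + t *: u) - w y| <= M * t.
Proof.
have /choice[g Hg] : forall k, exists g : pt -> R, exists M : R,
    forall y, (T k @` ref_simplex) y -> w y = g y /\ (derivable g y u /\ `|'D_u g y| <= M).
  move=> k; have [G [U [W [p [ip pp pE]]]]] := element_data k.
  have [M HM] := pull_derive_bound u ip pp; exists (p \o G), M => y sy.
  have Wy : W y by have [] := (ip_image ip y (ip_sub ip)).1 sy.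
  have dg := pull_deriveE u ip Wy pp.
  split; first exact: (element_value ip pE sy).
  by split; [case: dg|rewrite derive_val; exact: HM].
have {}/choice[M HM] := Hg.
exists (\sum_k `|M k|) => y t t0 yO.
apply: (@le_increment_piecewise R _ E (fun k => T k @` ref_simplex) g) => //.
- move=> k; have [G [U [W ip]]] := diffeo_inverse_pair (mesh_diffeo mesh k).
  apply: compact_closed; first exact: norm_hausdorff.
  by apply: (ip_compact ip); [exact: ref_simplex_compact|exact: (ip_sub ip)].
- by move=> k z sz; have [] := HM k z sz.
- move=> k z sz; have [_ [dg gM]] := HM k z sz; split => //.
  by rewrite (le_trans gM)// (le_trans (ler_norm _))// (bigD1 k)//= lerDl sumr_ge0.
- move=> s st; have := @subset_closure _ Omega _ (yO s st).
  by rewrite (mesh_cover mesh) => -[k _ sk]; exists k.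
Qed.

(** Continuity across the faces, through the Lipschitz bound on segments, is what
    makes the elementwise derivative the weak derivative. *)
Lemma elementwise_derive_weak (u : pt) (phi : pt -> R) (C : set pt) :
  continuous phi -> (forall y, derivable phi y u) -> continuous ('D_u phi) ->
  compact C -> C `<=` Omega -> (forall y, ~ C y -> phi y = 0) ->
  integ Omega (fun y => elementwise_derive u y * phi y) = - integ Omega (fun y => w y * 'D_u phi y).
Proof.
move=> cphi dphi cdphi cC CO phi0.
have [cw _] := wP.
have [M0 HM0] := closure_bounded bO cw; have [M HM] := Ph_lipschitz u.
apply: (@integration_by_parts_lipschitz R d Omega oO bO w _ phi u (closure Omega `\`
  open_elements T) C M0 M) => //.
- by apply: continuous_measurable_rV => //; exact: (continuous_domain oO cw).
- by apply: measurable_funTS; exact: elementwise_derive_measurable.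
- exact: skeleton_negligible.
- move=> y Oy nN; have oy : open_elements T y.
    by apply: contrapT => noy; apply: nN; split => //; exact: subset_closure.
  by split; [exact: derivable_open_elements|rewrite elementwise_deriveE].
Qed.

End piecewise.

(** * Discrete gradients are curl free *)

Lemma dot3E (R : realType) (u v : 'rV[R]_3) :
  dot u v = u 0 0 * v 0 0 + u 0 1 * v 0 1 + u 0 2%R * v 0 2%R.
Proof.
rewrite /dot !big_ord_recl big_ord0 addr0 addrA.
have -> : lift ord0 (lift ord0 ord0) = 2%R :> 'I_3 by exact: val_inj.
by have -> : lift ord0 ord0 = 1 :> 'I_3 by exact: val_inj.
Qed.

Lemma integD (R : realType) d (Omega : set 'rV[R]_d) (f g : 'rV[R]_d -> R) : open Omega ->
  (lebesgue_rV d).-integrable Omega (EFin \o f) -> (lebesgue_rV d).-integrable Omega (EFin \o g) ->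
  integ Omega (fun y => f y + g y) = integ Omega f + integ Omega g.
Proof. by move=> /measurable_open_rV mO fi gi; rewrite /integ RintegralD. Qed.

Lemma regroup_cross (R : comPzRingType) (a b c p q x y z t : R) :
  a * (p - q) + b * (x - y) + c * (z - t) =
  (a * p - b * y) + ((b * x - c * t) + (c * z - a * q)).
Proof. ring. Qed.

Section gradients.
Context {R : realType} {d : nat} (d0 : (0 < d)%N) (d3 : (d <= 3)%N).
Context (Omega : set 'rV[R]_d) (E : finType) (T : E -> 'rV[R]_d -> 'rV[R]_d).
Hypotheses (oO : open Omega) (bO : bounded_set Omega) (mesh : conforming_mesh Omega T).
Local Notation pt := 'rV[R]_d.
Local Notation mu := (lebesgue_rV d).
Context (w : pt -> R) (wP : Ph Omega T w).

(** The direction of [partial k]; it is 0 for [d <= k], in accordance with fields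
    that do not depend on the missing coordinates. *)
Definition axis (k : 'I_3) : pt := \row_(j < d) (j == k :> nat)%:R.

Lemma axis_widen (j : 'I_d) : axis (widen_ord d3 j) = delta_mx 0 j.
Proof. by apply/rowP => i; rewrite !mxE eqxx. Qed.

Lemma axis_ge (k : 'I_3) : (d <= k)%N -> axis k = 0.
Proof.
move=> dk; apply/rowP => i; rewrite !mxE (_ : (i == k :> nat) = false)//.
by apply/negbTE; rewrite neq_ltn (leq_trans (ltn_ord i) dk).
Qed.

Lemma grad_hE y k : grad_h T w y ord0 k = elementwise_derive T w (axis k) y.
Proof.
rewrite /grad_h /elementwise_derive !patchE /open_elements; case: ifP => _.
  by rewrite mxE.
by rewrite mxE.
Qed.

Let D k := elementwise_derive T w (axis k).

Lemma inL2_grad_h : inL2 Omega (grad_h T w).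
Proof.
have /choice[M HM] : forall k : 'I_3, exists M : R, 0 <= M /\ forall y, `|D k y| <= M.
  by move=> k; have [M M0 HM] := elementwise_derive_bounded mesh wP (axis k); exists M.
apply: (bounded_inL2 oO bO (M := \sum_k M k * M k)).
  apply: measurable_fun_rVP => k; under eq_fun do rewrite grad_hE.
  by apply: measurable_funTS; exact: (elementwise_derive_measurable mesh wP).
move=> y _; apply: ler_sum => k _; rewrite grad_hE.
have [M0 /(_ y) HMk] := HM k; rewrite /D in HMk.
by rewrite -[leLHS]ger0_norm -?expr2 ?sqr_ge0// normrX !expr2 ler_pM.
Qed.

(** Integrating by parts twice exchanges the two directions, because the second
    derivatives of [phi] commute. *)
Lemma elementwise_derive_cross (phi : pt -> R) (C : set pt) (i j : 'I_3) :
  (forall k, Ck k setT phi) -> compact C -> C `<=` Omega -> (forall y, ~ C y -> phi y = 0) ->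
  integ Omega (fun y => D i y * partial j phi y) = integ Omega (fun y => D j y * partial i phi y).
Proof.
move=> cphi cC CO phi0.
have c1 u : (forall y, derivable phi y u) /\ Ck 1 setT ('D_u phi).
  by have [_ /(_ u)[h1 h2]] := cphi 2%N; split => // y; exact: (h1 y Logic.I).
have c2 u v : (forall y, derivable ('D_u phi) y v) /\ continuous ('D_v ('D_u phi)).
  have [_ [_ /(_ v)[h1 [h2 _]]]] := c1 u; split => y; [exact: (h1 y Logic.I)|exact: (h2 y Logic.I)].
have cD u : continuous ('D_u phi) by move=> y; have [_ [h _]] := c1 u; exact: (h y Logic.I).
have s0 u y : ~ C y -> 'D_u phi y = 0 by apply: (support_derive _ cC).
have S : 'D_(axis i) ('D_(axis j) phi) = 'D_(axis j) ('D_(axis i) phi).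
  exact: (@schwarz R pt phi (axis j) (axis i) (c1 _).1 (c1 _).1 (c2 _ _).1 (c2 _ _).1 (c2 _
    _).2 (c2 _ _).2).
have weak (k l : 'I_3) := elementwise_derive_weak d0 oO bO mesh wP (cD (axis l)) (fun y =>
  (c2 (axis l) (axis k)).1 y) (c2 _ _).2 cC CO (s0 _).
transitivity (- integ Omega (fun y => w y * 'D_(axis i) ('D_(axis j) phi) y)); first exact: weak.
transitivity (- integ Omega (fun y => w y * 'D_(axis j) ('D_(axis i) phi) y)).
  exact: (congr1 (fun f : pt -> R => - integ Omega (fun y => w y * f y)) S).
by apply: esym; exact: weak.
Qed.

(** The products of the gradient with the curl group into three pairs of cross
    derivatives, one for each component of [psi]. *)
Lemma grad_h_curl_free (psi : pt -> 'rV[R]_3) : test_field Omega psi ->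
  ipL2 Omega (grad_h T w) (curl psi) = 0.
Proof.
move=> tpsi; have cp := curl_continuous_coord tpsi; case: tpsi => cpsi [C [cC CO] psi0].
have psi0' j y : ~ C y -> psi y 0 j = 0 by move=> /psi0 ->; rewrite mxE.
pose P i l := partial i (fun y => psi y 0 l).
have P0 i l y : ~ C y -> P i l y = 0.
  by move=> nC; apply: (support_derive _ cC) => // z; exact: psi0'.
have iDP i j l : mu.-integrable Omega (EFin \o (fun y => D i y * P j l y)).
  have [M M0 HM] := elementwise_derive_bounded mesh wP (axis i).
  have [N [N0 HN]] := compact_bound cC (cp l j) (P0 j l).
  apply: (bounded_integrable oO bO (M := M * N)).
    apply: measurable_funM.
      by apply: measurable_funTS; exact: (elementwise_derive_measurable mesh wP).
    by apply: continuous_measurable_rV => // y _; exact: cp.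
  by move=> y _; rewrite normrM; apply: ler_pM => //; [exact: HM|exact: HN].
have pair i j l : mu.-integrable Omega (EFin \o (fun y => D i y * P j l y - D j y * P i l y)) /\
    integ Omega (fun y => D i y * P j l y - D j y * P i l y) = 0.
  split; first by apply: eq_integrable (integrableB _ (iDP i j l) (iDP j i l)) => //;
    exact: measurable_open_rV.
  rewrite /integ RintegralB//; last exact: measurable_open_rV.
  apply/eqP; rewrite subr_eq0; apply/eqP.
  exact: (elementwise_derive_cross i j (cpsi l) cC CO (psi0' l)).
have [i1 e1] := pair 0 1 2%R; have [i2 e2] := pair 1 2%R 0; have [i3 e3] := pair 2%R 0 1.
have mO := measurable_open_rV oO.
transitivity (integ Omega (fun y => (D 0 y * P 1 2%R y - D 1 y * P 0 2%R y) +
   ((D 1 y * P 2%R 0 y - D 2%R y * P 1 0 y) + (D 2%R y * P 0 1 y - D 0 y * P 2%R 1 y)))).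
  apply: eq_Rintegral => y _.
  by rewrite dot3E !grad_hE !mxE; exact: regroup_cross.
have i23 : mu.-integrable Omega (EFin \o
    (fun y => (D 1 y * P 2%R 0 y - D 2%R y * P 1 0 y) + (D 2%R y * P 0 1 y - D 0 y * P 2%R 1 y))).
  by apply: eq_integrable (integrableD _ i2 i3).
apply: (etrans (integD oO i1 i23)); rewrite e1 add0r.
by apply: (etrans (integD oO i2 i3)); rewrite e2 e3 addr0.
Qed.

Lemma grad_h_is_curl : is_curl Omega (grad_h T w) (fun=> 0).
Proof.
split; first exact: inL2_grad_h.
  apply: (bounded_inL2 oO bO (M := 0)) => [|y _]; last by rewrite dot0l.
  exact: measurable_cst.
move=> psi tpsi; rewrite grad_h_curl_free//.
rewrite /ipL2 /integ (@eq_Rintegral _ _ _ _ _ (fun=> 0)) => [|y _]; last by rewrite dot0l.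
by rewrite /Rintegral integral0.
Qed.

End gradients.

(** * Faces and conormals *)

Section faces.
Context {R : realType} {d : nat}.
Local Notation pt := 'rV[R]_d.
Implicit Types (u v x z : pt).

Lemma dot_mulmx (B : 'M[R]_d) u v : dot (v *m B) u = dot v (u *m B^T).
Proof.
have E1 (p q : pt) : dot p q = (p *m q^T) ord0 ord0.
  by rewrite mxE; apply: eq_bigr => i _; rewrite !mxE.
by rewrite !E1 trmx_mul trmxK mulmxA.
Qed.

Definition bary_grad (a : 'I_d.+1) : pt :=
  \row_i (if unlift ord0 a is Some j then (i == j)%:R else -1).

Lemma bary_line (b : 'I_d.+1) x z (t : R) :
  bary b (x + t *: (z - x)) = (1 - t) * bary b x + t * bary b z.
Proof.
rewrite /bary; case: (unlift ord0 b) => [j|]; first by rewrite !mxE; ring.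
have -> : \sum_i (x + t *: (z - x)) ord0 i = (1 - t) * \sum_i x ord0 i + t * \sum_i z ord0 i.
  by rewrite !mulr_sumr -big_split/=; apply: eq_bigr => i _; rewrite !mxE; ring.
ring.
Qed.

Lemma face_line (F : {set 'I_d.+1}) x z (t : R) : 0 <= t <= 1 ->
  ref_face F x -> ref_face F z -> ref_face F (x + t *: (z - x)).
Proof.
move=> /andP[t0 t1] [sx fx] [sz fz]; split => b.
  rewrite bary_line; apply: addr_ge0; apply: mulr_ge0 => //; rewrite ?subr_ge0//.
by move=> bF; rewrite bary_line fx// fz// !mulr0 addr0.
Qed.

Lemma bary_vertex (a b : 'I_d.+1) : bary a (ref_vertex b : pt) = (a == b)%:R.
Proof.
rewrite /bary; case: (unliftP ord0 a) => [j|] ->.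
  by rewrite mxE eq_sym.
case: (unliftP ord0 b) => [j|] ->.
  rewrite (bigD1 j)//= mxE eqxx big1 ?addr0 ?subrr// => i ij.
  by rewrite mxE (inj_eq lift_inj) eq_sym (negbTE ij).
by rewrite big1 ?subr0// => i _; rewrite mxE.
Qed.

Lemma face_vertex (a b : 'I_d.+1) : b != a -> ref_face [set~ a]%SET (ref_vertex b : pt).
Proof.
move=> ba; split => c; first by rewrite bary_vertex.
by rewrite !inE negbK => /eqP ->; rewrite bary_vertex eq_sym (negbTE ba).
Qed.

(** The edges of the face opposite to the vertex [a] span the kernel of the
    derivative of the barycentric coordinate of [a]. *)
Lemma face_conormal (a : 'I_d.+1) u z :
  (forall b, b != a -> dot u (ref_vertex b - z) = 0) -> exists c : R, u = c *: bary_grad a.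
Proof.
move=> H.
have {}H b : b != a -> dot u (ref_vertex b) = dot u z.
  by move=> /H; rewrite dotDr -scaleN1r dotZr mulN1r => /eqP; rewrite subr_eq0 => /eqP.
have u_lift i : dot u (ref_vertex (lift ord0 i)) = u ord0 i.
  rewrite /dot (bigD1 i)//= mxE eqxx mulr1 big1 ?addr0// => j ji.
  by rewrite mxE (inj_eq lift_inj) eq_sym (negbTE ji) mulr0.
have u0 : dot u (ref_vertex ord0) = 0.
  by rewrite /dot big1// => j _; rewrite mxE mulr0.
case: (unliftP ord0 a) => [j|] aE.
  exists (u ord0 j); apply/rowP => i; rewrite mxE mxE aE liftK.
  have [->|ij] := eqVneq i j; first by rewrite mulr1.
  rewrite mulr0 -u_lift H; last by rewrite aE (inj_eq lift_inj).
  by rewrite -(H ord0) ?u0// aE.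
exists (- dot u z); apply/rowP => i; rewrite mxE mxE aE unlift_none mulrN1 opprK -u_lift H//.
by rewrite aE.
Qed.

Lemma cross_lift3 (c1 c2 : R) u : cross (lift3 (c1 *: u)) (lift3 (c2 *: u)) = 0.
Proof.
rewrite /lift3 -!scalemxAl; move: (u *m _) => v.
by apply/rowP => i; rewrite !mxE; case: i => -[|[|[|]]]//= ?; ring.
Qed.

(** The segment from [x] to the barycentre works. *)
Lemma ref_interior_adherent x : ref_simplex x -> exists v, forall t : R, 0 < t <= 1 ->
  ref_interior (x + t *: v).
Proof.
move=> sx; pose c : pt := \row_(i < d) d.+1%:R^-1.
have c0 : 0 < d.+1%:R^-1 :> R by rewrite invr_gt0.
have bc b : 0 < bary b c.
  rewrite /bary; case: (unlift ord0 b) => [j|]; first by rewrite mxE.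
  under eq_bigr do rewrite mxE.
  rewrite sumr_const card_ord subr_gt0 -[X in X < _]mulr_natl ltr_pdivrMr// mul1r ltr_nat//.
exists (c - x) => t /andP[t0 t1] b; rewrite bary_line.
by rewrite ltr_wpDl// ?mulr_gt0// mulr_ge0// ?subr_ge0//; exact: sx.
Qed.

End faces.

(** * Curves in the boundary and the outward normal *)

Lemma cvg_pos_near (R : realType) (S : Type) (F : set_system S) {FF : Filter F} (f : S ->
  R) (l : R) :
  f @ F --> l -> 0 < l -> \forall t \near F, 0 < f t.
Proof.
move=> fl l0; have H : \forall t \near F, `|l - f t| < l by exact: cvgr_dist_lt.
apply: filterS H => t.
by rewrite ltr_norml ltrBlDr ltrDl => /andP[].
Qed.

Lemma open_lt_fun (R : realType) (S : topologicalType) (f g : S -> R) :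
  continuous f -> continuous g -> open [set y | f y < g y].
Proof.
move=> cf cg; rewrite (_ : [set _ | _] = (fun y => g y - f y) @^-1` `]0, +oo[); last first.
  by apply/seteqP; split => y; rewrite /= in_itv/= andbT subr_gt0.
by apply: open_comp; [move=> y _; exact: continuous_sub|exact: interval_open].
Qed.

Lemma continuous_scaled_distance (R : realType) (V : normedModType R) (e : R) (x : V) :
  continuous (fun y : V => e * `|y - x|).
Proof.
by move=> y; apply: cvgMl_tmp; apply: cvg_norm; apply: cvgB; [exact: cvg_id|exact: cvg_cst].
Qed.

Section boundary.
Context {R : realType} {d : nat}.
Local Notation pt := 'rV[R]_d.
Implicit Types (Omega : set pt) (n x : pt).

Lemma continuous_dot n : continuous (dot n).
Proof.
apply: (@continuous_polynomial _ _ 1).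
apply: polynomial_le_sum => i _; apply: polynomial_leZ; exact: polynomial_le_coord.
Qed.

(** If [tau] had a negative component along [n], the curve would enter the cone
    which [Omega] contains. If it had a positive one, the curve would enter the
    open cone which [Omega] avoids, and with it the closure of [Omega]. *)
Lemma tangent_orthogonal_normal Omega x n (gamma : R -> pt) (tau : pt) :
  outward_normal Omega x n ->
  (forall t, 0 < t <= 1 -> closure Omega (gamma t) /\ ~ Omega (gamma t)) ->
  (fun t => t^-1 *: (gamma t - x)) @ 0^'+ --> tau -> gamma @ 0^'+ --> x -> dot n tau = 0.
Proof.
move=> [_ _ _ Hn] Hg gt gx; apply/eqP; apply/negPn/negP => nt.
(* An opening small enough for [tau] to lie inside the cone. *)
pose e := `|dot n tau| / (2 * (`|tau| + 1)).
have tau1 : 0 < `|tau| + 1 by rewrite ltr_wpDl.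
have e0 : 0 < e by rewrite divr_gt0 ?normr_gt0 ?mulr_gt0.
have et : e * `|tau| < `|dot n tau|.
  rewrite /e mulrAC ltr_pdivrMr ?mulr_gt0// ltr_pM2l ?normr_gt0//.
  by rewrite mulrDr mulr1 ltr_pwDr// ler_peMl// ler1n.
have /nbhs_ballP[r /= r0 Hr] := Hn e e0.
pose q t := t^-1 *: (gamma t - x).
have c1 : (fun t => dot n (q t)) @ 0^'+ --> dot n tau.
  exact: (@cvg_comp _ _ _ q (dot n) _ _ _ gt (@continuous_dot n tau)).
have c2 : (fun t => e * `|q t|) @ 0^'+ --> e * `|tau|.
  by apply: cvgMl_tmp; exact: cvg_norm.
have nb : \forall t \near (0 : R)^'+, ball x r (gamma t).
  exact: (gx _ (nbhsx_ballx x r r0)).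
have n1 : \forall t \near (0 : R)^'+, t <= 1 by exact: nbhs_right_le.
have n0 : \forall t \near (0 : R)^'+, 0 < t by exact: nbhs_right_gt.
have qE t : 0 < t -> gamma t - x = t *: q t.
  by move=> t0; rewrite /q scalerA divff ?gt_eqF// scale1r.
case: (ltrgt0P (dot n tau)) nt et => // ntau _ et.
- have c3 : (fun t => dot n (q t) - e * `|q t|) @ 0^'+ --> dot n tau - e * `|tau| by exact: cvgB.
  have n3 : \forall t \near (0 : R)^'+, 0 < dot n (q t) - e * `|q t|.
    by apply: cvg_pos_near c3 _; rewrite subr_gt0.
  near (0 : R)^'+ => t.
  have t0 : 0 < t by near: t.
  have t1 : t <= 1 by near: t.
  have [|cg _] := Hg t; first by rewrite t0.
  pose C := [set y : pt | e * `|y - x| < dot n (y - x)].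
  have gC : C (gamma t).
    rewrite /C /= (qE _ t0) dotZr normrZ gtr0_norm// mulrCA ltr_pM2l// -subr_gt0.
    by near: t.
  have oC : open C.
    rewrite (_ : C = [set y | e * `|y - x| < dot n y - dot n x]); last first.
      by apply/seteqP; split => y; rewrite /C /= dotDr [dot n (- x)]dotC dotNl [dot x n]dotC.
    apply: open_lt_fun; first exact: continuous_scaled_distance.
    exact: continuous_sub (@continuous_dot n) (@cst_continuous _ _ _).
  have nC : nbhs (gamma t) (ball x r `&` C).
    apply: open_nbhs_nbhs; split; first by apply: openI => //; exact: ball_open.
    by split => //; near: t.
  have [y [Oy [/Hr[_ nO] Cy]]] := cg _ nC.
  exact: nO.
- have c3 : (fun t => - dot n (q t) - e * `|q t|) @ 0^'+ --> - dot n tau - e * `|tau|.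
    by apply: cvgB => //; exact: cvgN.
  have n3 : \forall t \near (0 : R)^'+, 0 < - dot n (q t) - e * `|q t|.
    by apply: cvg_pos_near c3 _; rewrite subr_gt0.
  near (0 : R)^'+ => t.
  have t0 : 0 < t by near: t.
  have t1 : t <= 1 by near: t.
  have [|_ nO] := Hg t; first by rewrite t0.
  have [+ _] : (dot n (gamma t - x) < - (e * `|gamma t - x|) -> Omega (gamma t)) /\
        (e * `|gamma t - x| < dot n (gamma t - x) -> ~ Omega (gamma t)).
    by apply: Hr; near: t.
  move=> /(_ _)/nO; apply.
  rewrite (qE _ t0) dotZr normrZ gtr0_norm// mulrCA -mulrN ltr_pM2l// ltrNr -subr_gt0.
  by near: t.
Unshelve. all: by end_near. Qed.

End boundary.

(** * Discrete gradients are admissible test fields *)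

Lemma line_at_right (R : realType) (V : normedModType R) (y v : V) :
  (fun t : R => y + t *: v) @ 0^'+ --> y.
Proof.
apply: cvg_at_right_filter; rewrite -[X in _ --> X]addr0 -[X in _ --> _ + X](scale0r v).
by apply: cvgD; [exact: cvg_cst|exact: cvgZr_tmp].
Qed.

Section gradient_trace.
Context {R : realType} {d : nat} (d0 : (0 < d)%N) (d3 : (d <= 3)%N).
Context (Omega : set 'rV[R]_d) (E : finType) (T : E -> 'rV[R]_d -> 'rV[R]_d).
Hypotheses (oO : open Omega) (bO : bounded_set Omega) (mesh : conforming_mesh Omega T).
Local Notation pt := 'rV[R]_d.
Local Notation pgrad p := (fun i => 'D_(delta_mx 0 i) p).

Lemma grad_h_ge (w : pt -> R) y (k : 'I_3) : (d <= k)%N -> grad_h T w y ord0 k = 0.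
Proof.
move=> dk; rewrite grad_hE (axis_ge dk) /elementwise_derive patchE.
by case: ifP => // _; rewrite derive0.
Qed.

Lemma lift3_grad_h (w : pt -> R) :
  (fun y => lift3 (inplane d (grad_h T w y))) = grad_h T w.
Proof. by apply/funext => y; rewrite (lift3K d3)// => k; exact: grad_h_ge. Qed.

Lemma pull_derive_delta G (p : pt -> R) y j :
  pull_derive G (pgrad p) (delta_mx 0 j) y = covector G (pgrad p) y ord0 j.
Proof.
rewrite /pull_derive (bigD1 j)//= mxE !eqxx mul1r big1 ?addr0// => i ij.
by rewrite mxE eqxx (negbTE ij) mul0r.
Qed.

Lemma pull_derive_dot G (p : pt -> R) u y :
  pull_derive G (pgrad p) u y = dot (covector G (pgrad p) y) u.
Proof. by rewrite dotC. Qed.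

Lemma grad_h_covector w k G U W p y : inverse_pair ref_simplex (T k) G U W ->
  polynomial_le 2 p -> (forall x, ref_simplex x -> w (T k x) = p x) ->
  (T k @` ref_interior) y -> inplane d (grad_h T w y) = covector G (pgrad p) y.
Proof.
move=> ip pp pE iy; apply/rowP => j.
have oy : open_elements T y by exists k.
rewrite (inplaneE d3) grad_hE (axis_widen d3) elementwise_deriveE// -pull_derive_delta.
by have dw := interior_derive (delta_mx 0 j) ip pp pE iy; rewrite derive_val.
Qed.

Lemma covector_pullback A F G U W (q : 'I_d -> pt -> R) x : inverse_pair A F G U W -> U x ->
  covector G q (F x) *m ('J F x)^T = \row_i q i x.
Proof.
move=> ip Ux; rewrite /covector (ip_FK ip Ux) -mulmxA -trmx_mul.
by rewrite (jacobian_inverse ip Ux) trmx1 mulmx1.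
Qed.

(** The pull-back of the gradient of [w] to the reference element is the gradient
    of a quadratic polynomial, hence affine. *)
Lemma grad_h_Hh w : Ph Omega T w -> Hh Omega T (grad_h T w).
Proof.
move=> wP; split.
- by exists (fun=> 0); rewrite lift3_grad_h; exact: grad_h_is_curl.
- move=> k; have [G [U [W [p [ip pp pE]]]]] := element_data mesh wP k.
  exists (fun x => \row_i 'D_(delta_mx 0 i) p x) => [j|x ix].
    by under eq_fun do rewrite mxE; exact: polynomial_le_derive.
  have Ux : U x by apply: (ip_sub ip); exact: ref_interior_sub.
  have iy : (T k @` ref_interior) (T k x) by exists x.
  by rewrite (grad_h_covector ip pp pE iy); exact: (covector_pullback _ ip Ux).
- move=> j dj; under eq_fun do rewrite grad_h_ge//.
  exact: lagrange0.
Qed.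

Lemma element_interior_adherent k x : (T k @` ref_simplex) x ->
  ProperFilter (within (T k @` ref_interior) (nbhs x)).
Proof.
move=> [xh sx <-]; have [G [U [W ip]]] := diffeo_inverse_pair (mesh_diffeo mesh k).
have [v Hv] := ref_interior_adherent sx.
have FW : Filter (within (T k @` ref_interior) (nbhs (T k xh))) by exact: within_filter.
split => // F0.
(* If the trace filter were trivial, a neighbourhood of the point would miss the
   open element. *)
have N0 : nbhs (T k xh) (~` (T k @` ref_interior)).
  have F0' : nbhs (T k xh) [set z | (T k @` ref_interior) z -> False] := F0.
  exact: F0'.
have cT : T k @ xh --> T k xh := ip_contF ip (ip_sub ip sx).
have cl : (fun t : R => xh + t *: v) @ 0^'+ --> xh by exact: line_at_right.
have n2 : \forall t \near (0 : R)^'+, ~ (T k @` ref_interior) (T k (xh + t *: v)).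
  exact: (cl _ (cT _ N0)).
have n1 : \forall t \near (0 : R)^'+, t <= 1 by exact: nbhs_right_le.
have n0 : \forall t \near (0 : R)^'+, 0 < t by exact: nbhs_right_gt.
near (0 : R)^'+ => t.
have [] : ~ (T k @` ref_interior) (T k (xh + t *: v)) by near: t.
exists (xh + t *: v) => //; apply: Hv; apply/andP; split; by near: t.
Unshelve. all: by end_near. Qed.

(** The trace and the normal are both orthogonal to the images of all segments that
    join the given point to the facet, so that they are multiples of the conormal
    of the facet. *)
Lemma grad_h_zero_trace w : Ph0 Omega T w -> zero_tangential_trace Omega T (grad_h T w).
Proof.
move=> [wP w0] k a x n l fO [xh fxh Txh] xn Hl.
have [G [U [W [p [ip pp pE]]]]] := element_data mesh wP k.
have sxh : ref_simplex xh by case: fxh.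
have Uxh : U xh by apply: (ip_sub ip).
have Wx : W x by rewrite -Txh; exact: (ip_F ip).
have GK : G x = xh by rewrite -Txh (ip_FK ip).
have PF : ProperFilter (within (T k @` ref_interior) (nbhs x)).
  by apply: element_interior_adherent; exists xh.
pose lp := covector G (pgrad p) x.
have lE : l = lift3 lp.
  apply/rowP => i.
  have li : grad_h T w y ord0 i @[y --> within (T k @` ref_interior) (nbhs x)] --> l ord0 i.
    exact: (@cvg_rV_coord R _ _ _ 3 _ l i Hl).
  have [[j ij]|di] := ord3_cases d3 i.
    have l2 : grad_h T w y ord0 i @[y --> within (T k @` ref_interior) (nbhs x)] --> lp ord0 j.
      have cq i' : continuous ('D_(delta_mx 0 i') p) := continuous_polynomial
        (polynomial_le_derive i' pp).
      have cc := @continuous_covector _ _ _ _ G _ _ (pgrad p) ip cq x j Wx.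
      apply: (within_eq_cvg cc) => y iy.
      by rewrite -(grad_h_covector ip pp pE iy) inplaneE ij.
    by rewrite ij lift3E -ij; exact: (cvg_unique _ li l2).
  rewrite lift3_ge//.
  have l2 : grad_h T w y ord0 i @[y --> within (T k @` ref_interior) (nbhs x)] --> (0 : R).
    by under eq_fun do rewrite grad_h_ge//; exact: cvg_cst.
  exact: (cvg_unique _ li l2).
have face_out t z : ref_face [set~ a]%SET z -> 0 <= t <= 1 ->
    closure Omega (T k (xh + t *: (z - xh))) /\ ~ Omega (T k (xh + t *: (z - xh))).
  move=> fz t01; have ft := face_line t01 fxh fz; split.
    by apply: (mesh_sub mesh); case: ft.
  move=> Ot; have : set0 (T k (xh + t *: (z - xh))) by rewrite -fO; split => //;
    exists (xh + t *: (z - xh)).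
  exact.
have tangent z : ref_face [set~ a]%SET z ->
    dot lp ((z - xh) *m 'J (T k) xh) = 0 /\ dot n ((z - xh) *m 'J (T k) xh) = 0.
  move=> fz; pose v := z - xh; pose tau := v *m 'J (T k) xh.
  have dT : differentiable (T k) xh := ip_diffF ip Uxh.
  have dp : differentiable p xh := differentiable_polynomial xh pp.
  split.
    rewrite -pull_derive_dot; have dpG := pull_deriveE tau ip Wx pp.
    have <- : 'D_tau (p \o G) x = pull_derive G (pgrad p) tau x by rewrite derive_val.
    have dpG' : is_derive x tau (p \o G) ('D_(tau *m 'J G x) p (G x)).
      by apply: (derive_pullback ip) => //; rewrite GK.
    have -> : 'D_tau (p \o G) x = 'D_(tau *m 'J G x) p (G x) by rewrite derive_val.
    have -> : tau *m 'J G x = v.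
      by rewrite /tau -mulmxA -Txh (jacobian_inverse ip Uxh) mulmx1.
    rewrite GK.
    have cv : (fun h : R => h^-1 *: ((p \o shift xh) (h *: v) - p xh)) @ 0^'+ --> 'D_v p xh.
      by apply: cvg_dnbhs_at_right; apply: diff_derivable.
    (* From a corner of the facet only forward steps stay in the facet, where the
       polynomial vanishes. *)
    have c0 : (fun h : R => h^-1 *: ((p \o shift xh) (h *: v) - p xh)) @ 0^'+ --> (0 : R).
      have n1 : \forall t \near (0 : R)^'+, t <= 1 by exact: nbhs_right_le.
      have n0 : \forall t \near (0 : R)^'+, 0 < t by exact: nbhs_right_gt.
      apply: cvg_near_cst; near=> t.
      have t01 : 0 <= t <= 1 by apply/andP; split; [apply: ltW|]; near: t.
      have p0 s : 0 <= s <= 1 -> p (xh + s *: v) = 0.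
        move=> s01; rewrite -pE; last by have [] := face_line s01 fxh fz.
        by have [c nc] := face_out _ _ fz s01; exact: w0.
      have pxh : p xh = 0 by rewrite -(p0 0) ?scale0r ?addr0// lexx ler01.
      by rewrite /= [t *: v + _]addrC p0// pxh subrr scaler0.
    exact: (cvg_unique _ cv c0).
  apply: (@tangent_orthogonal_normal R d Omega x n (fun t => T k (xh + t *: v)) tau xn).
  - by move=> t /andP[t0 t1]; apply: face_out => //; rewrite ltW.
  - rewrite /tau -deriveEjacobian//.
    have -> : (fun t : R => t^-1 *: (T k (xh + t *: v) - x)) = (fun t =>
      t^-1 *: ((T k \o shift xh) (t *: v) - T k xh)).
      by apply/funext => t; rewrite /= [xh + _]addrC Txh.
    by apply: cvg_dnbhs_at_right; apply: diff_derivable.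
  - have cT : T k @ xh --> T k xh := ip_contF ip Uxh.
    rewrite -[X in _ --> X]Txh.
    exact: (cvg_comp _ _ (@line_at_right R pt xh v) cT).
have conormal u : (forall z, ref_face [set~ a]%SET z -> dot u ((z - xh) *m 'J (T k) xh) = 0) ->
    exists c : R, u = c *: (bary_grad a *m ('J G x)^T).
  move=> Hu.
  have [c Hc] : exists c : R, u *m ('J (T k) xh)^T = c *: bary_grad a.
    apply: (@face_conormal R d a _ xh) => b ba.
    by rewrite dotC -dot_mulmx dotC; apply: Hu; exact: face_vertex.
  exists c; rewrite scalemxAl -Hc -mulmxA -trmx_mul -Txh.
  by rewrite (jacobian_inverse' ip Uxh) trmx1 mulmx1.
have [c1 E1] := conormal lp (fun z fz => (tangent z fz).1).
have [c2 E2] := conormal n (fun z fz => (tangent z fz).2).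
by rewrite lE E1 E2; exact: cross_lift3.
Unshelve. all: by end_near. Qed.

Lemma grad_h_Hh0 w : Ph0 Omega T w -> Hh0 Omega T (grad_h T w).
Proof. by move=> w0; split; [apply: grad_h_Hh; case: w0|exact: grad_h_zero_trace]. Qed.

End gradient_trace.

(** * Thermodynamics at constant density *)

Section thermodynamic_monotonicity.
Context {R : realType} (D : set (R * R)) (s : R * R -> R) (eos : entropy_law D s).

Lemma segment_in_domain (v e0 e1 t : R) : D (v, e0) -> D (v, e1) -> 0 <= t <= e1 - e0 ->
  D ((v, e0) + t *: ((0, 1) : R * R)).
Proof.
move=> D0 D1 /andP[t0 t1].
have [t00|tn0] := eqVneq t 0; first by rewrite t00 scale0r addr0.
have e01 : 0 < e1 - e0 by rewrite (lt_le_trans _ t1)// lt_neqAle eq_sym tn0.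
have t01 : 0 <= t / (e1 - e0) <= 1.
  by rewrite ler_pdivrMr// mul1r t1 andbT divr_ge0// ltW.
have /= := eos_convex eos D1 D0 t01.
congr (D _); congr pair; first by rewrite /= /GRing.scale/= mulr0; ring.
by rewrite /= /GRing.scale/=; field; rewrite gt_eqF.
Qed.

Lemma eos_derivable p : D p -> derivable s p (0, 1) /\ derivable (d_e s) p (0, 1).
Proof.
move=> Dp; have [_ /(_ (0, 1))[ds [_ /(_ (0, 1))[dds _]]]] := eos_C2 eos.
by split; [exact: ds|exact: dds].
Qed.

(** The mean value theorem along the segment, which lies in the domain of the
    equation of state by convexity. *)
Lemma entropy_monotone v e0 e1 : D (v, e0) -> D (v, e1) -> e0 <= e1 ->
  s (v, e0) <= s (v, e1) /\ d_e s (v, e1) <= d_e s (v, e0).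
Proof.
move=> D0 D1; rewrite le_eqVlt => /orP[/eqP ->//|e01].
have e10 : 0 < e1 - e0 by rewrite subr_gt0.
have E1 : (v, e1) = (v, e0) + (e1 - e0) *: ((0, 1) : R * R).
  by congr pair; rewrite /= /GRing.scale/=; ring.
have E0 : (v, e0) = (v, e0) + (0 : R) *: ((0, 1) : R * R) by rewrite scale0r addr0.
have seg t : 0 <= t <= e1 - e0 -> D ((v, e0) + t *: ((0, 1) : R * R)).
  exact: segment_in_domain.
split.
  have [t /seg /eos_derivable[]//|c /andP[c0 c1]] := @line_mvt R (R * R)%type s (v, e0) (0,
    1) _ _ e10.
  rewrite -E0 -E1 subr0 => E2; rewrite -subr_ge0 E2 mulr_ge0 ?ltW//.
  by apply: (eos_d_e_gt0 eos); apply: seg; rewrite !ltW.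
have [t /seg /eos_derivable[]//|c /andP[c0 c1]] := @line_mvt R (R * R)%type (d_e s) (v, e0) (0,
  1) _ _ e10.
rewrite -E0 -E1 subr0 => E2; rewrite -subr_le0 E2; apply: mulr_le0_ge0; last exact: ltW.
by apply: (eos_d_ee_le0 eos); apply: seg; rewrite !ltW.
Qed.

Lemma heating_monotone (u u' : state R) : 0 < dens u -> dens u' = dens u ->
  D (spec_volume u, spec_energy u) -> D (spec_volume u', spec_energy u') ->
  spec_energy u <= spec_energy u' ->
  [/\ temperature s u <= temperature s u', entropy s u <= entropy s u' &
      math_entropy s u' <= math_entropy s u].
Proof.
move=> r0 ru Du Du' ee.
have vE : spec_volume u' = spec_volume u by rewrite /spec_volume ru.
rewrite vE in Du'; have [s1 de] := entropy_monotone Du Du' ee.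
have ss : entropy s u <= entropy s u' by rewrite /entropy vE.
split => //.
  rewrite /temperature vE lef_pV2//; rewrite posrE; exact: (eos_d_e_gt0 eos).
by rewrite /math_entropy ru !mulNr lerN2 ler_wpM2l// ltW.
Qed.

End thermodynamic_monotonicity.

(** * Nodal functions *)

Section nodal.
Context {R : realType} {d : nat} (d3 : (d <= 3)%N).
Context (Omega : set 'rV[R]_d) (E : finType) (T : E -> 'rV[R]_d -> 'rV[R]_d).
Hypotheses (oO : open Omega) (bO : bounded_set Omega) (mesh : conforming_mesh Omega T).
Context (V : finType) (x : V -> 'rV[R]_d) (phi : V -> 'rV[R]_d -> R).
Hypothesis nodal : nodal_basis Omega T x phi.
Local Notation pt := 'rV[R]_d.
Local Notation mu := (lebesgue_rV d).

(** In each element the nodal function is the affine interpolant of its vertex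
    values, which are 0 or 1. *)
Lemma nodal_ge0 i y : closure Omega y -> 0 <= phi i y.
Proof.
rewrite (mesh_cover mesh) => -[k _ [z sz <-]].
have [_ /(_ k)[p pp pE]] := nodal_in_Vh nodal i.
rewrite pE// (polynomial_bary pp); apply: sumr_ge0 => a _.
apply: mulr_ge0; first exact: sz.
have sv : ref_simplex (ref_vertex a : pt) by move=> b; rewrite bary_vertex.
rewrite -pE//.
have : [set T k (ref_vertex a) | k in setT & a in setT] (T k (ref_vertex a)) by exists k => //;
  exists a.
by rewrite -(nodal_points nodal) => -[j _ <-]; rewrite (nodal_kronecker nodal).
Qed.

Lemma nodal_le1 i y : closure Omega y -> phi i y <= 1.
Proof.
move=> cy; rewrite -(nodal_sum1 nodal cy) (bigD1 i)//= lerDl.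
by apply: sumr_ge0 => j _; exact: nodal_ge0.
Qed.

Lemma Vh_measurable f : Vh Omega T f -> measurable_fun Omega f.
Proof.
by move=> [cf _]; apply: continuous_measurable_rV => //; exact: (continuous_domain oO cf).
Qed.

Lemma mass_ge0 i : 0 <= mass Omega phi i.
Proof. by apply: Rintegral_ge0 => y Oy; apply: nodal_ge0; exact: subset_closure. Qed.

Lemma nodal_integrable i (f : pt -> R) : mu.-integrable Omega (EFin \o f) ->
  mu.-integrable Omega (EFin \o (fun y => f y * phi i y)).
Proof.
move=> fi; have mO := measurable_open_rV oO.
have mphi := Vh_measurable (nodal_in_Vh nodal i).
apply: (le_integrable mO _ _ fi).
  apply/measurable_EFinP; apply: measurable_funM => //.
  by apply/measurable_EFinP; case/integrableP: fi.
move=> y Oy /=; rewrite lee_fin normrM ler_piMr//.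
by rewrite ger0_norm ?nodal_ge0 ?nodal_le1//; exact: subset_closure.
Qed.

Lemma integ_sum (I : Type) (r : seq I) (f : I -> pt -> R) :
  (forall i, mu.-integrable Omega (EFin \o f i)) ->
  integ Omega (fun y => \sum_(i <- r) f i y) = \sum_(i <- r) integ Omega (f i).
Proof.
move=> fi; have mO := measurable_open_rV oO.
have H : mu.-integrable Omega (EFin \o (fun y => \sum_(i <- r) f i y)) /\
   integ Omega (fun y => \sum_(i <- r) f i y) = \sum_(i <- r) integ Omega (f i).
  elim: r => [|i r [ir IH]].
    rewrite big_nil; under eq_fun do rewrite big_nil.
    split; last by rewrite /integ /Rintegral integral0.
    exact: integrable0.
  rewrite big_cons; under eq_fun do rewrite big_cons.
  split; last by rewrite integD// IH.
  by apply: eq_integrable (integrableD _ (fi i) ir).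
by case: H.
Qed.

(** A nonnegative function of zero mass vanishes almost everywhere, so that the
    division by the mass is harmless even for a node whose mass is 0. *)
Lemma mass_cancel i (f : pt -> R) : mu.-integrable Omega (EFin \o f) ->
  mass Omega phi i * (1 / mass Omega phi i * integ Omega (fun y => f y * phi i y)) =
  integ Omega (fun y => f y * phi i y).
Proof.
move=> fi; have [m0|m0] := eqVneq (mass Omega phi i) 0; last by field.
rewrite m0 mul0r; apply: esym.
have mO := measurable_open_rV oO; have mphi := Vh_measurable (nodal_in_Vh nodal i).
have phi1 : mu.-integrable Omega (EFin \o phi i).
  apply: (bounded_integrable oO bO mphi (M := 1)) => y /subset_closure Oy.
  by rewrite ger0_norm ?nodal_ge0// nodal_le1.
have phi0 : (\int[mu]_(y in Omega) `|(EFin \o phi i) y| = 0)%E.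
  transitivity (\int[mu]_(y in Omega) (EFin \o phi i) y)%E.
    apply: eq_integral => y; rewrite inE => /subset_closure Oy.
    by rewrite gee0_abs//= lee_fin nodal_ge0.
  by rewrite -[LHS]fineK ?integrable_fin_num//; congr (_%:E).
have mE : measurable_fun Omega (EFin \o phi i) by exact/measurable_EFinP.
have ae0 := (ae_eq_integral_abs mu mO mE).1 phi0.
rewrite /integ /Rintegral (ae_eq_integral (cst 0%E)) ?integral0//.
- by case/integrableP: (nodal_integrable i fi).
- apply: filterS ae0 => y /= H Oy; have := H Oy => -[->].
  by rewrite mulr0.
Qed.

(** In the plane the weak curl bears on the in-plane part only; the third component
    is continuous on a compact set. *)
Lemma Hh_inL2 xi : Hh Omega T xi -> inL2 Omega xi.
Proof.
move=> [[c [xi2 _ _]] _ Hz].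
(* The out-of-plane part, zero in space. *)
pose rest y : 'rV[R]_3 := xi y - lift3 (inplane d (xi y)).
have -> : xi = (fun y => lift3 (inplane d (xi y)) + rest y).
  by apply/funext => y; rewrite /rest addrC subrK.
apply: inL2D => //.
have rest_lt y (j : 'I_d) : rest y ord0 (widen_ord d3 j) = 0.
  by rewrite mxE [X in _ + X]mxE lift3E inplaneE subrr.
have rest_ge y (j : 'I_3) : (d <= j)%N -> rest y ord0 j = xi y ord0 j.
  by move=> dj; rewrite mxE [X in _ + X]mxE lift3_ge// subr0.
have /choice[M HM] : forall j : 'I_3, exists M : R, 0 <= M /\ forall y, Omega y ->
  `|rest y ord0 j| <= M.
  move=> j; have [[i ->]|dj] := ord3_cases d3 j.
    by exists 0; split => // y _; rewrite rest_lt normr0.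
  have [M HM] := closure_bounded bO (proj1 (Hz j dj)).
  by exists `|M|; split => // y Oy; rewrite rest_ge// (le_trans (HM _ Oy))// ler_norm.
apply: (bounded_inL2 oO bO (M := \sum_j M j * M j)).
  apply: measurable_fun_rVP => j; have [[i ->]|dj] := ord3_cases d3 j.
    by under eq_fun do rewrite rest_lt; exact: measurable_cst.
  by under eq_fun do rewrite rest_ge//; exact: (Vh_measurable (Hz j dj)).
move=> y Oy; apply: ler_sum => j _; have [M0 /(_ y Oy) HMj] := HM j.
by rewrite -[leLHS]ger0_norm -?expr2 ?sqr_ge0// normrX !expr2 ler_pM.
Qed.

End nodal.

(** * The scheme *)

Lemma cross_orthogonal (R : realType) (u v : 'rV[R]_3) : dot (cross u v) u = 0.
Proof. by rewrite dot3E !mxE /=; ring. Qed.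

Lemma dot_midpoint (R : realType) n (a b : 'rV[R]_n) :
  dot (b - a) (2^-1 *: (a + b)) = 2^-1 * (dot b b - dot a a).
Proof. by rewrite dotZr !dotDr !dotDl !dotNl (dotC b a); congr (_ * _); ring. Qed.

Lemma ipL2_midpoint (R : realType) d (Omega : set 'rV[R]_d) (f g : 'rV[R]_d -> 'rV[R]_3) :
  open Omega -> inL2 Omega f -> inL2 Omega g ->
  ipL2 Omega (fun y => g y - f y) (midpoint f g) =
  2^-1 * (normL2 Omega g ^+ 2 - normL2 Omega f ^+ 2).
Proof.
move=> oO f2 g2; have mO := measurable_open_rV oO.
have fi := inL2_dot oO f2 f2; have gi := inL2_dot oO g2 g2.
rewrite !normL2_sqr /ipL2 /integ -RintegralB// -RintegralZl//.
  by apply: eq_Rintegral => y _; rewrite /midpoint dot_midpoint.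
by apply: eq_integrable (integrableB mO gi fi).
Qed.

Section scheme.
Context {R : realType} {d : nat} (d3 : (d <= 3)%N) (d0 : (0 < d)%N).
Context (Omega : set 'rV[R]_d) (E : finType) (T : E -> 'rV[R]_d -> 'rV[R]_d).
Hypotheses (oO : open Omega) (bO : bounded_set Omega) (mesh : conforming_mesh Omega T).
Context (V : finType) (x : V -> 'rV[R]_d) (phi : V -> 'rV[R]_d -> R).
Hypothesis nodal : nodal_basis Omega T x phi.
Local Notation pt := 'rV[R]_d.
Local Notation mu := (lebesgue_rV d).
Local Notation field := (pt -> 'rV[R]_3).

Lemma interp3_node (v : V -> 'rV[R]_3) i : interp3 phi v (x i) = v i.
Proof.
rewrite /interp3 (bigD1 i)//= (nodal_kronecker nodal) eqxx scale1r big1 ?addr0// => j ji.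
by rewrite (nodal_kronecker nodal) (negbTE ji) scale0r.
Qed.

Lemma interp3_Vh3 (v : V -> 'rV[R]_3) : Vh3 Omega T (interp3 phi v).
Proof.
move=> j; rewrite (_ : (fun y => _) = (fun y => \sum_i v i ord0 j * phi i y)).
  by apply: lagrange_sum => i; apply: lagrangeZ; exact: (nodal_in_Vh nodal).
apply/funext => y; rewrite summxE; apply: eq_bigr => i _.
by rewrite mxE mulrC.
Qed.

Lemma midpoint_Vh3 (f g : field) : Vh3 Omega T f -> Vh3 Omega T g -> Vh3 Omega T (midpoint f g).
Proof.
move=> hf hg j; rewrite (_ : (fun y => _) = (fun y => 2^-1 * (f y 0 j + g y 0 j))).
  by apply: lagrangeZ; apply: lagrangeD; [exact: hf|exact: hg].
by apply/funext => y; rewrite !mxE.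
Qed.

Lemma midpoint_Hh0 (f g : field) : Hh0 Omega T f -> Hh0 Omega T g -> Hh0 Omega T (midpoint f g).
Proof.
move=> hf hg; apply: (Hh0Z oO bO); first by rewrite invr_eq0 pnatr_eq0.
exact: (Hh0D d3 oO bO mesh).
Qed.

Lemma lumped_midpoint (rho : V -> R) (v0 : V -> 'rV[R]_3) (v1 : field) :
  lumped Omega phi rho (fun i => v1 (x i) - v0 i) (fun i => midpoint (interp3 phi v0) v1 (x i)) =
  \sum_i mass Omega phi i * (2^-1 * rho i * dot (v1 (x i)) (v1 (x i))) -
  \sum_i mass Omega phi i * (2^-1 * rho i * dot (v0 i) (v0 i)).
Proof.
rewrite /lumped -sumrB; apply: eq_bigr => i _.
by rewrite /midpoint interp3_node dot_midpoint; ring.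
Qed.

Lemma joule_sum (rh : pt -> R) (c : field) : Vh Omega T rh -> inL2 Omega c ->
  \sum_i mass Omega phi i * joule Omega phi rh c i = integ Omega (fun y => rh y * dot (c y) (c y)).
Proof.
move=> hr c2; have mO := measurable_open_rV oO.
have [M HM] := closure_bounded bO (proj1 hr).
have ci := inL2_dot oO c2 c2.
have ri : mu.-integrable Omega (EFin \o (fun y => rh y * dot (c y) (c y))).
  apply: (le_integrable mO _ _ (integrableZl mO `|M| ci)).
    apply/measurable_EFinP; apply: measurable_funM; first exact: (Vh_measurable oO hr).
    by apply: measurable_dot; case: c2.
  move=> y Oy /=; rewrite lee_fin !normrM normr_id; apply: ler_wpM2r => //.
  by rewrite (le_trans (HM _ Oy))// ler_norm.
transitivity (\sum_i integ Omega (fun y => rh y * dot (c y) (c y) * phi i y)).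
  by apply: eq_bigr => i _; rewrite /joule; exact: (mass_cancel oO bO mesh nodal i ri).
rewrite -(integ_sum oO); last by move=> i; exact: (nodal_integrable oO mesh nodal i ri).
apply: eq_Rintegral => y; rewrite inE => /subset_closure Oy.
by rewrite -mulr_sumr (nodal_sum1 nodal Oy) mulr1.
Qed.

Lemma joule_ge0 (rh : pt -> R) (c : field) i : (forall y, Omega y -> 0 <= rh y) ->
  0 <= joule Omega phi rh c i.
Proof.
move=> r0; rewrite /joule mulr_ge0//; first by rewrite divr_ge0// (mass_ge0 mesh nodal).
apply: Rintegral_ge0 => y Oy; rewrite !mulr_ge0 ?r0 ?dot_ge0//.
by apply: (nodal_ge0 mesh nodal); exact: subset_closure.
Qed.

Lemma normL2_sqrt (rh : pt -> R) (c : field) : (forall y, Omega y -> 0 <= rh y) ->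
  normL2 Omega (fun y => Num.sqrt (rh y) *: c y) ^+ 2 = integ Omega (fun y =>
    rh y * dot (c y) (c y)).
Proof.
move=> r0; rewrite normL2_sqr; apply: eq_Rintegral => y; rewrite inE => Oy.
by rewrite dotZl dotZr mulrA -expr2 sqr_sqrtr// r0.
Qed.

Context (mu0 di tau : R) (rh : pt -> R) (rho : V -> R) (v0 : V -> 'rV[R]_3) (v1 H0 H1 cH : field).
Hypotheses (hr : forall y, Omega y -> 0 <= rh y) (h0 : Hh0 Omega T H0)
  (step1 : source_step1 Omega T x phi mu0 di tau rh rho v0 v1 H0 H1 cH).

(** Both equations are tested with the midpoints. *)
Lemma source_energy :
  \sum_i mass Omega phi i * (2^-1 * rho i * dot (v1 (x i)) (v1 (x i)))
    + mu0 / 2 * normL2 Omega H1 ^+ 2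
    + tau * normL2 Omega (fun y => Num.sqrt (rh y) *: cH y) ^+ 2 =
  \sum_i mass Omega phi i * (2^-1 * rho i * dot (v0 i) (v0 i)) + mu0 / 2 * normL2 Omega H0 ^+ 2.
Proof.
have h1 := step1_H step1.
have vh := midpoint_Vh3 (interp3_Vh3 v0) (step1_v step1).
have [+ +] := step1_eqs step1 vh (midpoint_Hh0 h0 h1) (step1_curl step1).
rewrite lumped_midpoint (ipL2_midpoint oO (Hh_inL2 d3 oO bO h0.1) (Hh_inL2 d3 oO bO h1.1)).
have -> : ipL2 Omega (fun y => rh y *: cH y) cH = normL2 Omega (fun y =>
  Num.sqrt (rh y) *: cH y) ^+ 2.
  by rewrite normL2_sqrt//; apply: eq_Rintegral => y _; rewrite dotZl.
have -> : ipL2 Omega (fun y => (1 / interp phi rho y) *: cross (cH y) (midpoint H0 H1 y)) cH = 0.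
  rewrite /ipL2 /integ (@eq_Rintegral _ _ _ _ _ (fun=> 0)) => [|y _].
    by rewrite /Rintegral integral0.
  by rewrite dotZl cross_orthogonal mulr0.
set I := ipL2 _ _ _; set K1 := \sum_i _; set K0 := \sum_i _.
set N1 := normL2 _ H1 ^+ 2; set N0 := normL2 _ H0 ^+ 2; set Q := normL2 _ _ ^+ 2.
clearbody I K1 K0 N1 N0 Q => e1 e2.
(* [I] is the work of the Lorentz force, which occurs in both equations. *)
have -> : K1 = K0 + tau * mu0 * I by rewrite -[K1](subrK K0); move/eqP: e1;
  rewrite subr_eq0 => /eqP ->; rewrite addrC.
have -> : tau * Q = - (mu0 * (2^-1 * (N1 - N0)) + tau * mu0 * I).
  by apply/eqP; rewrite eq_sym -subr_eq0 -opprD oppr_eq0 -e2 mulr0 addr0.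
by field.
Qed.

Lemma source_total_energy (u0 u1 : V -> state R) : Vh Omega T rh ->
  (forall i, 0 < dens (u0 i)) ->
  (forall i, rho i = dens (u0 i)) -> (forall i, v0 i = velocity (u0 i)) ->
  source_step2 Omega x phi tau rh v1 cH u0 u1 ->
  \sum_i mass Omega phi i * ener (u1 i) + mu0 / 2 * normL2 Omega H1 ^+ 2 =
  \sum_i mass Omega phi i * ener (u0 i) + mu0 / 2 * normL2 Omega H0 ^+ 2.
Proof.
move=> hrV rpos rE vE step2; have := source_energy.
have [_ c2 _] := step1_curl step1.
rewrite normL2_sqrt// -joule_sum//.
have -> : \sum_i mass Omega phi i * ener (u1 i) = \sum_i mass Omega phi i * ener (u0 i) +
   \sum_i mass Omega phi i * (2^-1 * rho i * dot (v1 (x i)) (v1 (x i))) -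
   \sum_i mass Omega phi i * (2^-1 * rho i * dot (v0 i) (v0 i)) +
   tau * \sum_i mass Omega phi i * joule Omega phi rh cH i.
  rewrite mulr_sumr -big_split/= -sumrB -big_split/=; apply: eq_bigr => i _.
  have [_ mE ->] := step2 i; rewrite mE rE vE /velocity !dotZl !dotZr.
  by field; rewrite gt_eqF.
set K1 := \sum_i mass Omega phi i * (2^-1 * rho i * dot (v1 (x i)) _).
set K0 := \sum_i mass Omega phi i * (2^-1 * rho i * dot (v0 i) _).
set J := \sum_i mass Omega phi i * joule _ _ _ _ _; set S := \sum_i _.
set N1 := normL2 _ H1 ^+ 2; set N0 := normL2 _ H0 ^+ 2.
clearbody J K1 K0 S N1 N0 => e1.
have -> : S + K1 - K0 + tau * J + mu0 / 2 * N1 = S - K0 + (K1 + mu0 / 2 * N1 + tau * J) by ring.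
by rewrite e1; ring.
Qed.

(** The test field is a discrete gradient, with curl 0. *)
Lemma source_involution w : mu0 != 0 -> Ph0 Omega T w ->
  ipL2 Omega H1 (grad_h T w) = ipL2 Omega H0 (grad_h T w).
Proof.
move=> mu_neq0 hw; have h1 := step1_H step1.
have gw := grad_h_Hh0 d0 d3 oO bO mesh hw.
have cw := grad_h_is_curl d0 oO bO mesh hw.1.
have [_] := step1_eqs step1 (interp3_Vh3 v0) gw cw.
have z0 (f : field) : ipL2 Omega f (fun=> 0) = 0.
  rewrite /ipL2 /integ (@eq_Rintegral _ _ _ _ _ (fun=> 0)) => [|y _].
    by rewrite /Rintegral integral0.
  by rewrite dotC dot0l.
have c0 (f g : field) : ipL2 Omega (fun y => cross 0 (f y)) g = 0.
  rewrite (_ : (fun y => cross 0 (f y)) = (fun=> 0)); first by rewrite ipL2C z0.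
  by apply/funext => y; apply/rowP => i; rewrite !mxE; case: i => -[|[|[|]]]//= ?; ring.
rewrite !z0 c0 !mulr0 !addr0 => /eqP; rewrite mulf_eq0 (negbTE mu_neq0)/= => /eqP.
have i0 := Hh_inL2 d3 oO bO h0.1; have i1 := Hh_inL2 d3 oO bO h1.1.
have ig := Hh_inL2 d3 oO bO gw.1.
have -> : (fun y => H1 y - H0 y) = (fun y => H1 y + (-1) *: H0 y).
  by apply/funext => y; rewrite scaleN1r.
rewrite (ipL2Dl oO)//; last exact: inL2Z.
by rewrite (ipL2Zl oO)// mulN1r => /eqP; rewrite subr_eq0 => /eqP.
Qed.

Lemma source_heating (u0 u1 : V -> state R) i : 0 <= tau -> 0 < dens (u0 i) ->
  source_step2 Omega x phi tau rh v1 cH u0 u1 -> spec_energy (u0 i) <= spec_energy (u1 i).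
Proof.
move=> tau_ge0 r0 /(_ i)[rE _ eE].
have -> : spec_energy (u1 i) = spec_energy (u0 i) + tau * joule Omega phi rh cH i / dens (u0 i).
  by rewrite /spec_energy eE rE; field; rewrite gt_eqF.
rewrite lerDl; apply: divr_ge0; last exact: ltW.
by apply: mulr_ge0 => //; exact: joule_ge0.
Qed.

End scheme.
Theorem proposition3p1 (R : realType) (d : nat) (d23 : d = 2%N \/ d = 3%N)
    (Omega : set 'rV[R]_d) (E : finType) (T : E -> 'rV[R]_d -> 'rV[R]_d)
    (V : finType) (x : V -> 'rV[R]_d) (phi : V -> 'rV[R]_d -> R)
    (dom : domain Omega) (mesh : conforming_mesh Omega T)
    (nodal : nodal_basis Omega T x phi)
    (D : set (R * R)) (s : R * R -> R) (eos : entropy_law D s)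
    (mu di r tau : R) (mu_gt0 : 0 < mu) (di_gt0 : 0 < di) (r_gt0 : 0 < r)
    (tau_gt0 : 0 < tau)
    (rh : 'rV[R]_d -> R) (rh_Vh : Vh Omega T rh)
    (rh_ge : forall y, Omega y -> r <= rh y)
    (u0 u1 : V -> state R) (v1 H0 H1 cH : 'rV[R]_d -> 'rV[R]_3)
    (H0_Hh0 : Hh0 Omega T H0)
    (rho_gt0 : forall i, 0 < dens (u0 i))
    (e_gt0 : forall i,
      0 < ener (u0 i) / dens (u0 i)
          - 2^-1 * dot (velocity (u0 i)) (velocity (u0 i)))
    (theta_gt0 : forall i,
      0 < (d_e s (1 / dens (u0 i),
                  ener (u0 i) / dens (u0 i)
                  - 2^-1 * dot (velocity (u0 i)) (velocity (u0 i))))^-1)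
    (u0_D : forall i, D (spec_volume (u0 i), spec_energy (u0 i)))
    (u1_D : forall i, D (spec_volume (u1 i), spec_energy (u1 i)))
    (step1 : source_step1 Omega T x phi mu di tau rh (fun i => dens (u0 i))
               (fun i => velocity (u0 i)) v1 H0 H1 cH)
    (step2 : source_step2 Omega x phi tau rh v1 cH u0 u1) :
  [/\ \sum_i mass Omega phi i *
          (2^-1 * dens (u0 i) * dot (v1 (x i)) (v1 (x i)))
        + mu / 2 * normL2 Omega H1 ^+ 2
        + tau * normL2 Omega (fun y => Num.sqrt (rh y) *: cH y) ^+ 2
      = \sum_i mass Omega phi i *
          (2^-1 * dens (u0 i) * dot (velocity (u0 i)) (velocity (u0 i)))
        + mu / 2 * normL2 Omega H0 ^+ 2,
      \sum_i mass Omega phi i * ener (u1 i) + mu / 2 * normL2 Omega H1 ^+ 2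
      = \sum_i mass Omega phi i * ener (u0 i) + mu / 2 * normL2 Omega H0 ^+ 2,
      forall i,
        [/\ dens (u1 i) = dens (u0 i),
            spec_energy (u0 i) <= spec_energy (u1 i),
            temperature s (u0 i) <= temperature s (u1 i),
            entropy s (u0 i) <= entropy s (u1 i) &
            math_entropy s (u1 i) <= math_entropy s (u0 i)] &
      forall w, Ph0 Omega T w ->
        ipL2 Omega H1 (grad_h T w) = ipL2 Omega H0 (grad_h T w)].

Proof.
have d3 : (d <= 3)%N by case: d23 => ->.
have d0 : (0 < d)%N by case: d23 => ->.
have [_ oO _ bO] := dom.
have rh_ge0 y : Omega y -> 0 <= rh y by move=> /rh_ge; apply: le_trans; exact: ltW.
split.
- exact: (source_energy d3 oO bO mesh nodal rh_ge0 H0_Hh0 step1).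
- exact: (source_total_energy d3 oO bO mesh nodal rh_ge0 H0_Hh0 step1 rh_Vh rho_gt0 _ _ step2).
- move=> i; have [rE _ _] := step2 i.
  have ee := source_heating mesh nodal rh_ge0 (ltW tau_gt0) (rho_gt0 i) step2.
  by have [? ? ?] := heating_monotone eos (rho_gt0 i) rE (u0_D i) (u1_D i) ee; split.
- move=> w hw; apply: (source_involution d3 d0 oO bO mesh nodal H0_Hh0 step1 _ hw).
  by rewrite gt_eqF.
Qed.
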